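(* TREE-COMPLETION is $\mathbb{NP}$-hard, even when the input tree is a spider.
   Context: A connected graph $H$ has a $(k,1)$-cover if every edge of $H$ is contained in at least one clique of order $k$. For a connected graph $G=(V,E)$, a set $E'\subseteq (V\times V)\setminus E$ of non-edges is a $k$-completion set of $G$ if $G\cup E'$ has a $(k,1)$-cover. TREE-COMPLETION: given a tree $T=(V,E)$ and two integers $k\le |V|$ and $t\ge 0$ (both part of the input), decide whether $T$ has a $k$-completion set of size $t$. A spider is a tree with exactly one vertex of degree at least $3$ (its center); the tree is the union of paths (legs) meeting at the center. *)

(* Defs.v *)
From mathcomp Require Import all_boot.
Set Implicit Arguments. Unset Strict Implicit. Unset Printing Implicit Defensive.

Definition eadj (n : nat) (E : seq (nat * nat)) : rel 'I_n :=
  fun x y => (x != y) && (((val x, val y) \in E) || ((val y, val x) \in E)).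

Definition wf_edges (n : nat) (E : seq (nat * nat)) : bool :=
  all (fun e => [&& e.1 < n, e.2 < n & e.1 != e.2]) E.

(* edges as unordered pairs, represented by ordered pairs x < y *)
Definition edge_set (n : nat) (adj : rel 'I_n) : {set 'I_n * 'I_n} :=
  [set p | (val p.1 < val p.2) && adj p.1 p.2].

Definition connected_graph (n : nat) (adj : rel 'I_n) : Prop :=
  forall x y : 'I_n, connect adj x y.

Definition is_tree (n : nat) (adj : rel 'I_n) : Prop :=
  0 < n /\ connected_graph adj /\ #|edge_set adj| = n.-1.

Definition degree (n : nat) (adj : rel 'I_n) (x : 'I_n) : nat :=
  #|[set y | adj x y]|.

Definition is_spider (n : nat) (adj : rel 'I_n) : Prop :=
  is_tree adj /\ #|[set x | 3 <= degree adj x]| = 1.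

Definition is_clique (n : nat) (adj : rel 'I_n) (K : {set 'I_n}) : Prop :=
  forall a b, a \in K -> b \in K -> a != b -> adj a b.

Definition has_k1_cover (n : nat) (adj : rel 'I_n) (k : nat) : Prop :=
  forall x y, adj x y ->
    exists K : {set 'I_n}, [/\ #|K| = k, x \in K, y \in K & is_clique adj K].

Definition add_edges (n : nat) (adj : rel 'I_n) (F : {set 'I_n * 'I_n}) : rel 'I_n :=
  fun x y => [|| adj x y, (x, y) \in F | (y, x) \in F].

Definition has_completion_set (n : nat) (adj : rel 'I_n) (k t : nat) : Prop :=
  exists F : {set 'I_n * 'I_n},
    [/\ (forall p, p \in F -> (val p.1 < val p.2) && ~~ adj p.1 p.2),
        #|F| = t
      & has_k1_cover (add_edges adj F) k].

Fixpoint bits_aux (fuel m : nat) : seq bool :=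
  if fuel is fuel'.+1 then
    (if m is 0 then [::] else odd m :: bits_aux fuel' m./2)
  else [::].
Definition bits (m : nat) : seq bool := bits_aux m m.

(* self-delimiting binary code of a natural number *)
Definition enc_nat (m : nat) : seq bool :=
  flatten [seq [:: true; b] | b <- bits m] ++ [:: false; false].

Definition enc_nats (s : seq nat) : seq bool := flatten (map enc_nat s).

Definition enc_instance (n k t : nat) (E : seq (nat * nat)) : seq bool :=
  enc_nats (n :: k :: t :: flatten [seq [:: e.1; e.2] | e <- E]).

Definition SPIDER_COMPLETION (w : seq bool) : Prop :=
  exists (n k t : nat) (E : seq (nat * nat)),
    [/\ w = enc_instance n k t E, wf_edges n E, is_spider (@eadj n E),
        k <= n & has_completion_set (@eadj n E) k t].

(* A model of computation: deterministic single-tape Turing machines   *)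
(* over the alphabet {0,1,blank}                                        *)

Inductive dir := DLeft | DRight | DStay.

Record TM := {
  tm_n : nat;
  tm_delta : 'I_tm_n.+1 -> option bool -> 'I_tm_n.+1 * option bool * dir;
  tm_start : 'I_tm_n.+1;
  tm_halt : 'I_tm_n.+1 }.

(* configuration: state, left part (nearest cell first), head cell, right part *)
Record config (M : TM) := Config {
  c_state : 'I_(tm_n M).+1;
  c_left : seq (option bool);
  c_head : option bool;
  c_right : seq (option bool) }.

Definition step (M : TM) (c : config M) : config M :=
  if c_state c == tm_halt M then c else
  let: (q', s', d) := tm_delta (c_state c) (c_head c) in
  match d with
  | DLeft => Config q' (behead (c_left c)) (head None (c_left c)) (s' :: c_right c)
  | DRight => Config q' (s' :: c_left c) (head None (c_right c)) (behead (c_right c))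
  | DStay => Config q' (c_left c) s' (c_right c)
  end.

Definition init (M : TM) (w : seq bool) : config M :=
  Config (tm_start M) [::] (head None (map Some w)) (behead (map Some w)).

Definition run (M : TM) (T : nat) (w : seq bool) : config M :=
  iter T (step (M := M)) (init M w).

Definition halted (M : TM) (c : config M) : bool := c_state c == tm_halt M.

Definition output (M : TM) (c : config M) : seq bool :=
  let s := c_head c :: c_right c in
  map (odflt false) (take (find (fun o => o == None) s) s).

Definition poly_time_computable (f : seq bool -> seq bool) : Prop :=
  exists (M : TM) (a d : nat), forall w,
    let T := a * (size w) ^ d + a in
    halted (run M T w) /\ output (run M T w) = f w.

Definition in_P (L : seq bool -> Prop) : Prop :=
  exists b : seq bool -> bool,
    poly_time_computable (fun w => [:: b w]) /\ (forall w, L w <-> b w).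

Definition pair_enc (w y : seq bool) : seq bool :=
  flatten [seq [:: true; b] | b <- w] ++ [:: false; false] ++ y.

Definition in_NP (L : seq bool -> Prop) : Prop :=
  exists V : seq bool -> Prop, in_P V /\
  exists a d : nat, forall w,
    L w <-> exists y, size y <= a * (size w) ^ d + a /\ V (pair_enc w y).

Definition NP_hard (L : seq bool -> Prop) : Prop :=
  forall L', in_NP L' ->
    exists f, poly_time_computable f /\ forall w, L' w <-> L (f w).

(* Main.v *)
(** A verifier's run on an unknown certificate is a space-time tableau, hence a cyclic tiling in
    which consecutive cells and cells one row apart carry matching colours.  Such a tiling is a
    perfect bin packing with polynomially bounded numbers: every possible tile of every cell is a
    bin which takes either the "actual" elements of its edges, and is then the chosen tile, or
    dummies; a bin per edge and colour absorbs the actual elements of the unused colours.  The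
    items become the legs of a spider: a connected graph on [n] vertices whose edges lie in
    [k]-cliques has at least [(n - 1) k / 2] edges, with equality only if the cliques pairwise
    share at most one vertex, and then each clique is the center together with entire legs of
    total length [k - 1].
    The reduction is a bounded-loop program over unary counters, and any such program runs in
    polynomial time on a one-tape machine that keeps the counters as interleaved unary tracks. *)
Require Import Defs.
From mathcomp Require Import all_boot perm zify.
Set Implicit Arguments. Unset Strict Implicit. Unset Printing Implicit Defensive.

(** * Composing Turing machines *)

Definition symbol : Type := option bool.

Record tape := Tape { tape_left : seq symbol; tape_head : symbol; tape_right : seq symbol }.

Definition write_move (s : symbol) (d : dir) (tp : tape) : tape :=
  match d with
  | DLeft => Tape (behead (tape_left tp)) (head None (tape_left tp)) (s :: tape_right tp)
  | DRight => Tape (s :: tape_left tp) (head None (tape_right tp)) (behead (tape_right tp))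
  | DStay => Tape (tape_left tp) s (tape_right tp)
  end.

(* A machine exits with a value of type [X], on which the rest of a program may branch. *)
Record machine (X : Type) := Machine {
  mstate : finType;
  mentry : mstate + X;
  mtrans : mstate -> symbol -> (mstate + X) * symbol * dir }.

Definition mconf X (M : machine X) : Type := ((mstate M + X) * tape)%type.

Definition mstep X (M : machine X) (c : mconf M) : mconf M :=
  match c.1 with
  | inl q => let: (s, b, d) := mtrans q (tape_head c.2) in (s, write_move b d c.2)
  | inr _ => c
  end.
Arguments mstep {X} M c.

Definition runs X (M : machine X) (tp : tape) (n : nat) (x : X) (tp' : tape) : Prop :=
  iter n (mstep M) (mentry M, tp) = (inr x, tp').

Lemma iter_mstep_exit X (M : machine X) n x tp : iter n (mstep M) (inr x, tp) = (inr x, tp).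
Proof. by elim: n => //= n ->. Qed.

Lemma runs_leq X (M : machine X) tp n n' x tp' :
  n <= n' -> runs M tp n x tp' -> runs M tp n' x tp'.
Proof. by move=> /subnK <-; rewrite /runs iterD => ->; apply: iter_mstep_exit. Qed.

Section Simulation.
Variables (X Y : Type) (M : machine X) (M' : machine Y).
Variable emb : mstate M + X -> mstate M' + Y.
Hypothesis emb_mstep : forall q tp,
  mstep M' (emb (inl q), tp) = (emb (mstep M (inl q, tp)).1, (mstep M (inl q, tp)).2).

Lemma simulate_exit n s tp x tp' : iter n (mstep M) (s, tp) = (inr x, tp') ->
  exists2 n', n' <= n & iter n' (mstep M') (emb s, tp) = (emb (inr x), tp').
Proof.
elim: n s tp => [|n IHn] [q|x1] tp //.
- by case=> -> ->; exists 0.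
- rewrite iterSr; case E: (mstep M (inl q, tp)) => [s tp1] /IHn [n' len' run'].
  by exists n'.+1; rewrite // iterSr emb_mstep E.
- by rewrite iter_mstep_exit => -[-> ->]; exists 0.
Qed.

End Simulation.

Definition mret X (x : X) : machine X :=
  @Machine X void (inr x) (fun v => match v with end).

Lemma runs_mret X (x : X) tp n : runs (mret x) tp n x tp.
Proof. exact: iter_mstep_exit. Qed.

Definition mmove (d : dir) : machine unit :=
  @Machine unit unit (inl tt) (fun _ a => (inr tt, a, d)).

Section Bind.
Variables (X : finType) (Y : Type) (M : machine X) (f : X -> machine Y).

Let bind_state : finType := (mstate M + {x : X & mstate (f x)})%type.

Definition bind_second (x : X) (s : mstate (f x) + Y) : bind_state + Y :=
  match s with inl q => inl (inr (existT _ x q)) | inr y => inr y end.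

Definition bind_first (s : mstate M + X) : bind_state + Y :=
  match s with inl q => inl (inl q) | inr x => bind_second (mentry (f x)) end.

Definition mbind : machine Y :=
  @Machine Y bind_state (bind_first (mentry M)) (fun q a =>
    match q with
    | inl q1 => let: (s, b, d) := mtrans q1 a in (bind_first s, b, d)
    | inr (existT x q2) => let: (s, b, d) := mtrans q2 a in (bind_second s, b, d)
    end).

Lemma runs_mbind tp n1 x tp1 n2 y tp2 :
  runs M tp n1 x tp1 -> runs (f x) tp1 n2 y tp2 -> runs mbind tp (n1 + n2) y tp2.
Proof.
have first_mstep q t : mstep mbind (bind_first (inl q), t) =
    (bind_first (mstep M (inl q, t)).1, (mstep M (inl q, t)).2).
  by rewrite /mstep /=; case: (mtrans q _) => [[s b] d].
have second_mstep q t : mstep mbind (bind_second (inl q), t) =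
    (bind_second (mstep (f x) (inl q, t)).1, (mstep (f x) (inl q, t)).2).
  by rewrite /mstep /=; case: (mtrans q _) => [[s b] d].
move=> /(simulate_exit first_mstep) [n1' le1 run1].
move=> /(simulate_exit second_mstep) [n2' le2 run2].
apply: (@runs_leq _ _ _ (n1' + n2')); first exact: leq_add.
by rewrite /runs addnC iterD [iter n1' _ _]run1.
Qed.

End Bind.

Section Loop.
Variables (Y : Type) (M : machine (option Y)).

Definition loop_body (s : mstate M + option Y) : option (mstate M) + Y :=
  match s with
  | inl q => inl (Some q)
  | inr None => inl None
  | inr (Some y) => inr y
  end.

Definition mloop : machine Y :=
  @Machine Y (option (mstate M)) (inl None) (fun q a =>
    match q with
    | None => (loop_body (mentry M), a, DStay)
    | Some q' => let: (s, b, d) := mtrans q' a in (loop_body s, b, d)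
    end).

Lemma mloop_pass tp n o tp1 : runs M tp n o tp1 ->
  exists2 n', n' <= n.+1 & iter n' (mstep mloop) (mentry mloop, tp) = (loop_body (inr o), tp1).
Proof.
have body_mstep q t : mstep mloop (loop_body (inl q), t) =
    (loop_body (mstep M (inl q, t)).1, (mstep M (inl q, t)).2).
  by rewrite /mstep /=; case: (mtrans q _) => [[s b] d].
move=> /(simulate_exit body_mstep) [n' le_n' run'].
by exists n'.+1; rewrite // iterSr; case: (tp) run'.
Qed.

Lemma runs_mloop_exit tp n y tp1 :
  runs M tp n (Some y) tp1 -> runs mloop tp n.+1 y tp1.
Proof. by move=> /mloop_pass [n' le_n' run']; apply: runs_leq le_n' _. Qed.

Lemma runs_mloop_iter tp n tp1 n1 y tp2 :
  runs M tp n None tp1 -> runs mloop tp1 n1 y tp2 -> runs mloop tp (n.+1 + n1) y tp2.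
Proof.
move=> /mloop_pass [n' le_n' run'] run1.
apply: (@runs_leq _ _ _ (n' + n1)); first by rewrite leq_add2r.
by rewrite /runs addnC iterD [iter n' _ _]run'.
Qed.

End Loop.

Section Compile.
Variable M : machine unit.

Definition state_code (s : mstate M + unit) : 'I_(#|mstate M|.+1) :=
  cast_ord (card_option (mstate M))
    (enum_rank (match s with inl q => Some q | inr _ => None end)).

Definition state_decode (i : 'I_(#|mstate M|.+1)) : mstate M + unit :=
  match enum_val (cast_ord (esym (card_option (mstate M))) i) with
  | Some q => inl q | None => inr tt end.

Lemma state_codeK : cancel state_code state_decode.
Proof. by case=> [q|[]]; rewrite /state_code /state_decode cast_ordK enum_rankK. Qed.

Definition TM_of_machine : TM :=
  @Build_TM #|mstate M| (fun i a =>
    match state_decode i with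
    | inl q => let: (s, b, d) := mtrans q a in (state_code s, b, d)
    | inr _ => (i, a, DStay)
    end) (state_code (mentry M)) (state_code (inr tt)).

Definition config_of (c : mconf M) : config TM_of_machine :=
  @Config TM_of_machine (state_code c.1) (tape_left c.2) (tape_head c.2) (tape_right c.2).

Lemma step_config_of c : step (config_of c) = config_of (mstep M c).
Proof.
case: c => [[q|[]] tp]; rewrite /step /mstep /=; last by rewrite eqxx.
rewrite (can_eq state_codeK) /= state_codeK.
by case: (mtrans q (tape_head tp)) => [[s b] []].
Qed.

Definition input_tape (w : seq bool) : tape :=
  Tape [::] (head None (map Some w)) (behead (map Some w)).

Definition tape_output (tp : tape) : seq bool :=
  let s := tape_head tp :: tape_right tp in
  map (odflt false) (take (find (fun o => o == None) s) s).

Lemma run_TM_of_machine w n tp : runs M (input_tape w) n tt tp ->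
  halted (run TM_of_machine n w) /\ output (run TM_of_machine n w) = tape_output tp.
Proof.
have -> : run TM_of_machine n w = config_of (iter n (mstep M) (mentry M, input_tape w)).
  by rewrite /run; elim: n => //= n ->; rewrite step_config_of.
by move=> ->; split=> //; rewrite /halted /=.
Qed.

End Compile.

(** * A work word and a bit stack *)

(* At rest the head scans the blank separating the work word [u], whose cells are listed from
   right to left, from the stack [r]; both are surrounded by a supply of blanks. *)
Definition tape_holds (u r : seq bool) (tp : tape) : Prop :=
  exists k k', tp = Tape (map Some u ++ nseq k None) None (map Some r ++ nseq k' None).

Definition head_left (l r : seq symbol) : tape := Tape (behead l) (head None l) r.
Definition head_right (l r : seq symbol) : tape := Tape l (head None r) (behead r).

Lemma head_nseq (T : Type) k (x : T) : head x (nseq k x) = x.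
Proof. by case: k. Qed.

Lemma behead_nseq (T : Type) k (x : T) : behead (nseq k x) = nseq k.-1 x.
Proof. by case: k. Qed.

Section Scan.
Variables (X : Type) (M : machine X) (q : mstate M).

Lemma scan_left v l r : (forall b, mtrans q (Some b) = (inl q, Some b, DLeft)) ->
  iter (size v) (mstep M) (inl q, head_left (map Some v ++ l) r) =
  (inl q, head_left l (rev (map Some v) ++ r)).
Proof.
move=> q_left; elim: v r => // b v IHv r.
by rewrite [size _]/= iterSr /mstep /= q_left IHv rev_cons cat_rcons.
Qed.

Lemma scan_right v l r : (forall b, mtrans q (Some b) = (inl q, Some b, DRight)) ->
  iter (size v) (mstep M) (inl q, head_right l (map Some v ++ r)) =
  (inl q, head_right (rev (map Some v) ++ l) r).
Proof.
move=> q_right; elim: v l => // b v IHv l.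
by rewrite [size _]/= iterSr /mstep /= q_right IHv rev_cons cat_rcons.
Qed.

End Scan.

Section Transducer.
Variables (S : Type) (d : S -> bool -> S * bool) (e : S -> option (bool * S)).

Fixpoint transduce (s : S) (u : seq bool) : S * seq bool :=
  if u is b :: u' then
    let: (s1, b1) := d s b in let: (s2, u2) := transduce s1 u' in (s2, b1 :: u2)
  else (s, [::]).

Inductive extension : S -> seq bool -> S -> Prop :=
| extension_nil s : e s = None -> extension s [::] s
| extension_cons s b s1 l s2 :
    e s = Some (b, s1) -> extension s1 l s2 -> extension s (b :: l) s2.

Lemma size_transduce s u : size (transduce s u).2 = size u.
Proof.
elim: u s => //= b u IHu s; case: (d s b) => s1 b1.
by move: (IHu s1); case: (transduce s1 u) => s2 u2 /= ->.
Qed.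

Lemma transduce_cat s u v :
  transduce s (u ++ v) = let: (s1, u1) := transduce s u in
                         let: (s2, v2) := transduce s1 v in (s2, u1 ++ v2).
Proof.
elim: u s => [|b u IHu] s /=; first by case: (transduce s v).
case: (d s b) => s1 b1; rewrite IHu; case: (transduce s1 u) => s2 u2.
by case: (transduce s2 v).
Qed.

End Transducer.

Section Sweep.
Variables (S : finType) (X : Type) (s0 : S).
Variables (d : S -> bool -> S * bool) (e : S -> option (bool * S)) (out : S -> X).

Local Notation leftward s := (inl (Some (inl s))).
Local Notation rightward s := (inl (Some (inr s))).

(* On the way left the word is rewritten by [d] and prolonged by [e]. *)
Definition sweep : machine X :=
  @Machine X (option (S + S)) (inl None) (fun q a =>
    match q, a with
    | None, _ => (leftward s0, a, DLeft)
    | Some (inl s), Some b => let: (s1, b1) := d s b in (leftward s1, Some b1, DLeft)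
    | Some (inl s), None =>
        if e s is Some (b, s1) then (leftward s1, Some b, DLeft) else (rightward s, None, DRight)
    | Some (inr s), Some b => (rightward s, Some b, DRight)
    | Some (inr s), None => (inr (out s), None, DStay)
    end).

Lemma sweep_transduce u s l r :
  iter (size u) (mstep sweep) (leftward s, head_left (map Some u ++ l) r) =
  (leftward (transduce d s u).1, head_left l (rev (map Some (transduce d s u).2) ++ r)).
Proof.
elim: u s r => // b u IHu s r; rewrite [size _]/= iterSr /mstep /=.
case: (d s b) => s1 b1 /=; rewrite IHu.
by case: (transduce d s1 u) => s2 u2 /=; rewrite rev_cons cat_rcons.
Qed.

Lemma sweep_extension s u s' k r : extension e s u s' ->
  iter (size u) (mstep sweep) (leftward s, head_left (nseq k None) r) =
  (leftward s', head_left (nseq (k - size u) None) (rev (map Some u) ++ r)).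
Proof.
move=> ext; elim: ext k r => {s u s'} [s _|s b s1 u s2 es _ IH] k r; first by rewrite subn0.
rewrite [size _]/= iterSr /mstep /= head_nseq es /= !behead_nseq.
have := IH k.-1 (Some b :: r); rewrite /head_left !behead_nseq => ->.
have -> : k - size (b :: u) = k.-1 - size u by rewrite /=; lia.
by rewrite rev_cons cat_rcons.
Qed.

Lemma sweep_turn s k r : e s = None ->
  mstep sweep (leftward s, head_left (nseq k None) r) =
  (rightward s, head_right (None :: nseq k.-1 None) r).
Proof. by move=> es; rewrite /mstep /= head_nseq es /= behead_nseq. Qed.

Lemma extension_end s l s' : extension e s l s' -> e s' = None.
Proof. by elim. Qed.

Lemma runs_sweep u u' s1 l s2 r tp : tape_holds u r tp ->
  transduce d s0 u = (s1, u') -> extension e s1 l s2 ->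
  exists2 tp', tape_holds (u' ++ l) r tp' &
    runs sweep tp (2 * (size u' + size l) + 3) (out s2) tp'.
Proof.
case=> k [k' ->] tr ext; have sz_u' : size u' = size u by rewrite -(size_transduce d s0 u) tr.
exists (Tape (map Some (u' ++ l) ++ nseq (k - size l).-1.+1 None) None
             (map Some r ++ nseq k' None)); first by exists (k - size l).-1.+1, k'.
have -> : 2 * (size u' + size l) + 3 = 1 + (size (rev (u' ++ l)) + (1 + (size l + (size u + 1)))).
  by rewrite size_rev size_cat; lia.
have enter l1 r1 : mstep sweep (mentry sweep, Tape l1 None r1) =
  (leftward s0, head_left l1 (None :: r1)) by [].
rewrite /runs !iterD [iter 1 _ (mentry _, _)]enter.
rewrite sweep_transduce tr [(s1, u').1]/= [(s1, u').2]/= (sweep_extension _ _ ext).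
rewrite [iter 1 _ (leftward _, _)]/= sweep_turn; last exact: extension_end ext.
by rewrite catA -rev_cat -map_cat -map_rev scan_right // map_rev revK.
Qed.

End Sweep.

Section Stack.

Local Notation entering := (inl None).
Local Notation to_top := (inl (Some None)).
Local Notation from_top := (inl (Some (Some tt))).

Definition push (b : bool) : machine unit :=
  @Machine unit (option (option unit)) entering (fun q a =>
    match q, a with
    | None, _ => (to_top, a, DRight)
    | Some None, Some c => (to_top, Some c, DRight)
    | Some None, None => (from_top, Some b, DLeft)
    | Some (Some _), Some c => (from_top, Some c, DLeft)
    | Some (Some _), None => (inr tt, None, DStay)
    end).

Lemma runs_push b u r tp : tape_holds u r tp ->
  exists2 tp', tape_holds u (rcons r b) tp' & runs (push b) tp (2 * size r + 3) tt tp'.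
Proof.
case=> k [k' ->].
exists (Tape (map Some u ++ nseq k None) None (map Some (rcons r b) ++ nseq k'.-1 None)).
  by exists k, k'.-1.
have -> : 2 * size r + 3 = 1 + (size (rev r) + (1 + (size r + 1))) by rewrite size_rev; lia.
have enter l1 r1 : mstep (push b) (mentry (push b), Tape l1 None r1) =
  (to_top, head_right (None :: l1) r1) by [].
rewrite /runs !iterD [iter 1 _ (mentry _, _)]enter scan_right //.
have turn l : mstep (push b) (to_top, head_right l (nseq k' None)) =
    (from_top, head_left l (Some b :: nseq k'.-1 None)).
  by rewrite /mstep /= head_nseq /= behead_nseq.
rewrite [iter 1 _ (to_top, _)]turn -map_rev scan_left // map_rev revK.
by rewrite /= /mstep /= -cats1 map_cat -catA.
Qed.

Local Notation at_top := (inl (Some (Some None))).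
Local Notation carrying b := (inl (Some (Some (Some b)))).

Definition pop : machine (option bool) :=
  @Machine (option bool) (option (option (option bool))) entering (fun q a =>
    match q, a with
    | None, _ => (to_top, a, DRight)
    | Some None, Some c => (to_top, Some c, DRight)
    | Some None, None => (at_top, None, DLeft)
    | Some (Some None), Some c => (carrying c, None, DLeft)
    | Some (Some None), None => (inr None, None, DStay)
    | Some (Some (Some b)), Some c => (carrying b, Some c, DLeft)
    | Some (Some (Some b)), None => (inr (Some b), None, DStay)
    end).

Lemma runs_pop_nil u tp : tape_holds u [::] tp ->
  exists2 tp', tape_holds u [::] tp' & runs pop tp 3 None tp'.
Proof.
case=> k [k' ->]; exists (Tape (map Some u ++ nseq k None) None (nseq k'.-1.+1 None)).
  by exists k, k'.-1.+1.
by rewrite /runs /= /mstep /= head_nseq /= behead_nseq.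
Qed.

Lemma runs_pop_rcons u r b tp : tape_holds u (rcons r b) tp ->
  exists2 tp', tape_holds u r tp' & runs pop tp (2 * size r + 5) (Some b) tp'.
Proof.
case=> k [k' ->].
exists (Tape (map Some u ++ nseq k None) None (map Some r ++ nseq k'.-1.+2 None)).
  by exists k, k'.-1.+2.
have -> : 2 * size r + 5 = 1 + (size (rev r) + (1 + (1 + (size (rcons r b) + 1)))).
  by rewrite size_rev size_rcons; lia.
have enter l1 r1 : mstep pop (mentry pop, Tape l1 None r1) =
  (to_top, head_right (None :: l1) r1) by [].
rewrite /runs !iterD [iter 1 _ (mentry _, _)]enter scan_right //.
have turn l : mstep pop (to_top, head_right l (nseq k' None)) =
    (at_top, head_left l (None :: nseq k'.-1 None)).
  by rewrite /mstep /= head_nseq /= behead_nseq.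
rewrite [iter 1 _ (to_top, _)]turn map_rcons rev_rcons.
have take_top l1 r1 : mstep pop (at_top, head_left (Some b :: l1) r1) =
  (carrying b, head_left l1 (None :: r1)) by [].
rewrite [iter 1 _ (at_top, _)]take_top.
by rewrite -map_rev scan_left // map_rev revK.
Qed.

End Stack.

(** * Registers on interleaved tracks *)

Lemma flatten_map_iotaS (T : Type) (u : nat -> seq T) h :
  flatten [seq u p | p <- iota 0 h.+1] = flatten [seq u p | p <- iota 0 h] ++ u h.
Proof. by rewrite -[h.+1]addn1 (iotaD 0 h 1) map_cat flatten_cat /= cats0. Qed.

Fixpoint column_pass (S : Type) (d : nat -> S -> bool -> S * bool) (s : S) (js : seq nat)
    (f : nat -> bool) : S * seq bool :=
  if js is j :: js' then
    let: (s1, b1) := d j s (f j) in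
    let: (s2, u2) := column_pass d s1 js' f in (s2, b1 :: u2)
  else (s, [::]).

Lemma column_pass_read S (g : nat -> S -> bool -> S) s js f :
  column_pass (fun j s b => (g j s b, b)) s js f =
  (foldl (fun s j => g j s (f j)) s js, map f js).
Proof. by elim: js s => //= j js IH s; rewrite IH. Qed.

Lemma column_pass_update S (g : S -> bool -> S * bool) r s js f : uniq js ->
  column_pass (fun j s b => if j == r then g s b else (s, b)) s js f =
  ((if r \in js then (g s (f r)).1 else s),
   map (fun j => if j == r then (g s (f r)).2 else f j) js).
Proof.
elim: js s => //= j js IH s /andP [jNjs Ujs]; rewrite inE.
have [e|ne] := eqVneq j r; last by rewrite IH // [r == j]eq_sym (negbTE ne).
subst j; rewrite /=; case E: (g s (f r)) => [s1 b1] /=.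
rewrite IH // (negbTE jNjs); congr (_, _ :: _).
by apply/eq_in_map => i ij; case: eqP => // ir; rewrite -ir ij in jNjs.
Qed.

Lemma foldl_filter (S I : Type) (P : pred I) (h : S -> I -> S) s js :
  (forall s j, ~~ P j -> h s j = s) -> foldl h s js = foldl h s (filter P js).
Proof. by move=> hP; elim: js s => //= j js IH s; case: ifPn => [_|/hP ->]; apply: IH. Qed.

Lemma filter_pred2_iota lo hi n : lo < hi < n -> filter (pred2 lo hi) (iota 0 n) = [:: lo; hi].
Proof.
move=> /andP [lt_lo_hi lt_hi]; apply: (irr_sorted_eq ltn_trans ltnn).
- by apply: (sorted_filter ltn_trans); apply: iota_ltn_sorted.
- by rewrite /= lt_lo_hi.
- by move=> j; rewrite mem_filter mem_iota !inE; lia.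
Qed.

Lemma column_pass_read2 S (g1 g2 : S -> bool -> S) lo hi n s f : lo < hi < n ->
  column_pass (fun j s b => ((if j == lo then g1 s b else if j == hi then g2 s b else s), b))
    s (iota 0 n) f =
  (g2 (g1 s (f lo)) (f hi), map f (iota 0 n)).
Proof.
move=> lohi; rewrite (column_pass_read (fun j s b => _)); congr (_, _).
rewrite (foldl_filter (P := pred2 lo hi)); last first.
  by move=> s1 j /=; case: (j == lo) => //=; case: (j == hi).
by rewrite filter_pred2_iota //= !eqxx ifF //; lia.
Qed.

Definition set_reg (f : nat -> nat) (r v : nat) : nat -> nat := fun j => if j == r then v else f j.

Lemma set_reg_eq f r v : set_reg f r v r = v.
Proof. by rewrite /set_reg eqxx. Qed.

Lemma set_reg_neq f r v j : j != r -> set_reg f r v j = f j.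
Proof. by rewrite /set_reg => /negbTE ->. Qed.

Section Tracks.
Variable n : nat.
Local Notation num_tracks := n.+1.
Local Notation track_ids := (iota 0 num_tracks).

Definition columns (h : nat) (tk : nat -> nat -> bool) : seq bool :=
  flatten [seq map (tk p) track_ids | p <- iota 0 h].

Lemma columnsS h tk : columns h.+1 tk = columns h tk ++ map (tk h) track_ids.
Proof. exact: flatten_map_iotaS. Qed.

Lemma size_columns h tk : size (columns h tk) = h * num_tracks.
Proof.
by elim: h => // h IH; rewrite columnsS size_cat IH size_map size_iota mulSn addnC.
Qed.

Lemma eq_columns h tk tk' : (forall p j, p < h -> j < num_tracks -> tk p j = tk' p j) ->
  columns h tk = columns h tk'.
Proof.
move=> E; congr flatten; apply/eq_in_map => p; rewrite mem_iota add0n => /andP [_ lp].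
by apply/eq_in_map => j; rewrite mem_iota => /andP [_ lj]; apply: E.
Qed.

Definition track_trans S (d : nat -> S -> bool -> S * bool) (q : 'I_num_tracks * S) (b : bool) :=
  let: (s', b') := d (val q.1) q.2 b in ((ordS q.1, s'), b').

Lemma ordS_val (j : 'I_num_tracks) : j.+1 < num_tracks -> ordS j = j.+1 :> nat.
Proof. by move=> lt; rewrite /= modn_small. Qed.

Lemma ordS_last (j : 'I_num_tracks) : j.+1 = num_tracks -> ordS j = ord0.
Proof. by move=> e; apply: val_inj; rewrite /= e modnn. Qed.

Lemma transduce_column S (d : nat -> S -> bool -> S * bool) f s (j : 'I_num_tracks) m :
  j + m.+1 = num_tracks ->
  transduce (track_trans d) (j, s) (map f (iota j m.+1)) =
  let: (s', v) := column_pass d s (iota j m.+1) f in ((ord0, s'), v).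
Proof.
elim: m j s => [|m IH] j s e.
  rewrite /= /track_trans /=; case: (d j s (f j)) => s1 b1.
  by rewrite ordS_last //; lia.
have lt : j.+1 < num_tracks by lia.
have {}IH s1 : transduce (track_trans d) (ordS j, s1) (map f (iota (ordS j) m.+1)) =
  let: (s', v) := column_pass d s1 (iota (ordS j) m.+1) f in ((ord0, s'), v).
  by apply: IH; rewrite ordS_val //; lia.
have -> : iota j m.+2 = (j : nat) :: iota (ordS j) m.+1 by rewrite ordS_val.
move: (iota (ordS j) m.+1) IH => js IH; rewrite map_cons.
rewrite [transduce _ _ _]/= [column_pass _ _ _ _]/= {1}/track_trans [(j, s).1]/= [(j, s).2]/=.
by case: (d j s (f j)) => s1 b1; rewrite IH; case: (column_pass _ _ _ _).
Qed.

Definition columns_pass S (d : nat -> S -> bool -> S * bool) (sg : nat -> S) h tk tk' : Prop :=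
  forall p, p < h -> column_pass d (sg p) track_ids (tk p) = (sg p.+1, map (tk' p) track_ids).

Lemma transduce_columns S d (sg : nat -> S) h tk tk' : columns_pass d sg h tk tk' ->
  transduce (track_trans d) (ord0, sg 0) (columns h tk) = ((ord0, sg h), columns h tk').
Proof.
elim: h => [|h IH] pass //.
rewrite !columnsS transduce_cat IH => [|p lt]; last by apply: pass; lia.
by rewrite (@transduce_column _ d (tk h) (sg h) ord0 n) // pass.
Qed.

Definition append_column (g : nat -> bool) (q : 'I_num_tracks * bool) :
    option (bool * ('I_num_tracks * bool)) :=
  if q.2 then None else Some (g (val q.1), (ordS q.1, val q.1 == n)).

Lemma extension_append_column_from g (j : 'I_num_tracks) m : j + m.+1 = num_tracks ->
  extension (append_column g) (j, false) (map g (iota j m.+1)) (ord0, true).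
Proof.
elim: m j => [|m IH] j e.
  apply: (@extension_cons _ _ _ _ (ord0, true)); last exact: extension_nil.
  rewrite /append_column /= ordS_last; last by lia.
  by congr (Some (_, (_, _))); apply/eqP; lia.
have lt : j.+1 < num_tracks by lia.
apply: (@extension_cons _ _ _ _ (ordS j, false)).
  by rewrite /append_column /=; congr (Some (_, (_, _))); apply/eqP; lia.
by rewrite -[j.+1]ordS_val //; apply: IH; rewrite ordS_val //; lia.
Qed.

Lemma extension_append_column g :
  extension (append_column g) (ord0, false) (map g track_ids) (ord0, true).
Proof. exact: (@extension_append_column_from g ord0 n). Qed.

Definition track_sweep (S : finType) X (s0 : S) d e (out : S -> X) : machine X :=
  @sweep _ X (ord0 : 'I_num_tracks, s0) (track_trans d) e (fun q => out q.2).

Lemma runs_track_sweep (S : finType) X d e (out : S -> X) (sg : nat -> S) tk tk' h l s r tp :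
  tape_holds (columns h tk) r tp -> columns_pass d sg h tk tk' ->
  extension e (ord0, sg h) l s ->
  exists2 tp', tape_holds (columns h tk' ++ l) r tp' &
    runs (track_sweep (sg 0) d e out) tp (2 * (h * num_tracks + size l) + 3) (out s.2) tp'.
Proof.
move=> holds /transduce_columns pass ext.
have := runs_sweep (fun q : 'I_num_tracks * S => out q.2) holds pass ext.
by case=> tp' holds' run; exists tp' => //; rewrite size_columns in run.
Qed.

(* Track 0 holds the input from its last bit on, the order in which the stack delivers it;
   track [j > 0] holds the register [f j] in unary. *)
Definition tracks (w : seq bool) (f : nat -> nat) (p j : nat) : bool :=
  if j == 0 then nth false (rev w) p else p < f j.

Lemma tracks_reg w f p j : 0 < j -> tracks w f p j = (p < f j).
Proof. by rewrite /tracks; case: j. Qed.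

Definition registers_fit (w : seq bool) (f : nat -> nat) (h : nat) : Prop :=
  size w <= h /\ forall j, 0 < j < num_tracks -> f j <= h.

Definition represents (w : seq bool) (f : nat -> nat) (r : seq bool) (h : nat) (tp : tape) : Prop :=
  registers_fit w f h /\ tape_holds (columns h (tracks w f)) r tp.

Definition sweep_cost (c : nat) : nat := 2 * (num_tracks * c) + 2 * c + 3.

(* [N] bounds both the number of sweeps and the growth of the tape. *)
Definition exec (w : seq bool) X (M : machine X) (f : nat -> nat) (r : seq bool)
    (N : nat) (x : X) (f' : nat -> nat) (r' : seq bool) : Prop :=
  forall h c tp, represents w f r h tp -> h + size r + N <= c ->
  exists h' tp', [/\ represents w f' r' h' tp', h' + size r' <= h + size r + N &
    runs M tp (N * sweep_cost c) x tp'].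

Lemma exec_mret w X (x : X) f r : exec w (mret x) f r 0 x f r.
Proof. by move=> h c tp rep _; exists h, tp; split; rewrite ?addn0 //; apply: runs_mret. Qed.

Lemma exec_mbind w (X : finType) Y (M : machine X) (k : X -> machine Y) f r N1 x f1 r1 N2 y f2 r2 :
  exec w M f r N1 x f1 r1 -> exec w (k x) f1 r1 N2 y f2 r2 ->
  exec w (mbind M k) f r (N1 + N2) y f2 r2.
Proof.
move=> ex1 ex2 h c tp rep le_c.
have [|h1 [tp1 [rep1 le1 run1]]] := ex1 h c tp rep; first by lia.
have [|h2 [tp2 [rep2 le2 run2]]] := ex2 h1 c tp1 rep1; first by lia.
by exists h2, tp2; split=> //; [lia | rewrite mulnDl; apply: runs_mbind run1 run2].
Qed.

Lemma exec_mloop_exit w Y (M : machine (option Y)) f r N y f1 r1 :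
  exec w M f r N (Some y) f1 r1 -> exec w (mloop M) f r N.+1 y f1 r1.
Proof.
move=> ex1 h c tp rep le_c.
have [|h1 [tp1 [rep1 le1 run1]]] := ex1 h c tp rep; first by lia.
exists h1, tp1; split=> //; first by lia.
by apply: runs_leq (runs_mloop_exit run1); rewrite mulSn /sweep_cost; lia.
Qed.

Lemma exec_mloop_iter w Y (M : machine (option Y)) f r N f1 r1 N1 y f2 r2 :
  exec w M f r N None f1 r1 -> exec w (mloop M) f1 r1 N1 y f2 r2 ->
  exec w (mloop M) f r (N.+1 + N1) y f2 r2.
Proof.
move=> ex1 ex2 h c tp rep le_c.
have [|h1 [tp1 [rep1 le1 run1]]] := ex1 h c tp rep; first by lia.
have [|h2 [tp2 [rep2 le2 run2]]] := ex2 h1 c tp1 rep1; first by lia.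
exists h2, tp2; split=> //; first by lia.
by apply: runs_leq (runs_mloop_iter run1 run2); rewrite mulnDl mulSn /sweep_cost; lia.
Qed.

Lemma exec_leq w X (M : machine X) f r N N' x f' r' : N <= N' ->
  exec w M f r N x f' r' -> exec w M f r N' x f' r'.
Proof.
move=> leN ex h c tp rep le_c; have [|h' [tp' [rep' le' run]]] := ex h c tp rep; first by lia.
exists h', tp'; split=> //; first by lia.
by apply: runs_leq run; rewrite leq_mul2r leN orbT.
Qed.

Lemma exec_push w b f r : exec w (push b) f r 1 tt f (rcons r b).
Proof.
move=> h c tp [fit /(runs_push b) [tp' holds' run]] le_c; exists h, tp'.
split=> //; first by rewrite size_rcons; lia.
by apply: runs_leq run; rewrite mul1n /sweep_cost; lia.
Qed.

Lemma exec_sweep w (S : finType) X d e (out : S -> X) (sg : nat -> S) x f f' r :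
  (forall h, registers_fit w f h -> exists h' tk' l s,
    [/\ registers_fit w f' h' /\ h' <= h.+1, columns_pass d sg h (tracks w f) tk',
        extension e (ord0, sg h) l s, columns h tk' ++ l = columns h' (tracks w f') &
        out s.2 = x]) ->
  exec w (track_sweep (sg 0) d e out) f r 1 x f' r.
Proof.
move=> sweeps h c tp [fit holds] le_c.
have [h' [tk' [l [s [[fit' le_h'] pass ext eq_cols <-]]]]] := sweeps h fit.
have [tp' holds' run] := runs_track_sweep out holds pass ext.
exists h', tp'; split; [by split; rewrite -?eq_cols | lia |].
apply: runs_leq run; rewrite mul1n /sweep_cost.
have -> : h * num_tracks + size l = num_tracks * h'.
  by rewrite -(size_columns h tk') -size_cat eq_cols size_columns mulnC.
have : num_tracks * h' <= num_tracks * c by rewrite leq_mul2l; lia.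
lia.
Qed.

Definition no_extension (S : Type) (_ : S) : option (bool * S) := None.

Lemma exec_sweep_in_place w (S : finType) X d (out : S -> X) (sg : nat -> S) x f f' r :
  (forall h, registers_fit w f h -> registers_fit w f' h) ->
  (forall h, columns_pass d sg h (tracks w f) (tracks w f')) ->
  (forall h, registers_fit w f h -> out (sg h) = x) ->
  exec w (track_sweep (sg 0) d (@no_extension _) out) f r 1 x f' r.
Proof.
move=> fit' pass out_x; apply: exec_sweep => h fit.
exists h, (tracks w f'), [::], (ord0, sg h); rewrite cats0 out_x //.
by split=> //; [split=> //; apply: fit' | apply: extension_nil].
Qed.

Definition zero_reg (r : nat) : machine unit :=
  track_sweep tt (fun j s b => if j == r then (tt, false) else (s, b)) (@no_extension _)
    (fun _ => tt).

Lemma exec_zero_reg w j f r : 0 < j < num_tracks ->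
  exec w (zero_reg j) f r 1 tt (set_reg f j 0) r.
Proof.
move=> j_ok; apply: (exec_sweep_in_place (sg := fun=> tt)) => // h.
  by case=> le_w le_f; split=> // i /le_f; rewrite /set_reg; case: eqP.
move=> p _; rewrite (@column_pass_update _ (fun s b => (tt, false))) ?iota_uniq //.
congr (_, _); first by case: ifP.
apply: eq_map => i; rewrite /tracks /set_reg.
by case: (i =P j) => // ->; case: eqP => //; lia.
Qed.

(* The first column in which track [r] is blank receives a mark, and if there is none a column is
   appended: the state tells whether the mark has been set. *)
Definition incr_reg (r : nat) : machine unit :=
  track_sweep false (fun j s b => if j == r then (s || ~~ b, b || ~~ s) else (s, b))
    (append_column (pred1 r)) (fun _ => tt).

Lemma columns_pass_incr w f j h : 0 < j < num_tracks ->
  columns_pass (fun i s b => if i == j then (s || ~~ b, b || ~~ s) else (s, b))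
    (fun p => f j < p) h (tracks w f) (tracks w (set_reg f j (f j).+1)).
Proof.
move=> j_ok p _; rewrite (@column_pass_update _ (fun s b => (s || ~~ b, b || ~~ s))) ?iota_uniq //.
rewrite tracks_reg ?ifT ?mem_iota; [| lia | lia].
congr (_, _); first by rewrite [fst _]/=; lia.
apply: eq_map => i; rewrite /tracks /set_reg; case: (i =P j) => [->|//].
by rewrite [LHS]/= ifF; lia.
Qed.

Lemma exec_incr_reg w j f r : 0 < j < num_tracks ->
  exec w (incr_reg j) f r 1 tt (set_reg f j (f j).+1) r.
Proof.
move=> j_ok; apply: (exec_sweep (sg := fun p => f j < p)) => h [le_w le_f].
have pass := columns_pass_incr w f (h := h) j_ok; have le_fj := le_f j j_ok.
have fit' h' : f j < h' -> h <= h' -> registers_fit w (set_reg f j (f j).+1) h'.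
  move=> lt le_h; split=> [|i /le_f]; first by lia.
  by rewrite /set_reg; case: eqP => [->|_]; lia.
exists (if f j < h then h else h.+1), (tracks w (set_reg f j (f j).+1)),
  (if f j < h then [::] else map (pred1 j) track_ids), (ord0, true).
case: ifP => lt; split=> //.
- by split; [apply: fit' | lia].
- exact: extension_nil.
- by rewrite cats0.
- by split; [apply: fit'; lia | lia].
- exact: extension_append_column.
- rewrite columnsS; congr (_ ++ _); apply/eq_in_map => i; rewrite mem_iota => /andP [_ lt_i] /=.
  rewrite /tracks /set_reg; case: (i =P 0) => [->|i0].
    by rewrite nth_default ?size_rev //; lia.
  by case: eqP => [_|_]; [lia | have := le_f i; lia].
Qed.

Definition eq_regs (r s : nat) : machine bool :=
  track_sweep (false, true)
    (fun j q b => ((if j == minn r s then (b, q.2)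
                    else if j == maxn r s then (q.1, q.2 && (q.1 == b)) else q), b))
    (@no_extension _) (fun q => q.2).

Lemma exec_eq_regs w i j f r : 0 < i < num_tracks -> 0 < j < num_tracks -> i != j ->
  exec w (eq_regs i j) f r 1 (f i == f j) f r.
Proof.
move=> i_ok j_ok ij; set lo := minn i j; set hi := maxn i j.
have [lo_gt0 hi_gt0 lohi] : [/\ 0 < lo, 0 < hi & lo < hi < num_tracks].
  by rewrite /lo /hi; split; lia.
pose sg p := ((if p is p'.+1 then p' < f lo else false), minn p (f lo) == minn p (f hi)).
have sg0 : sg 0 = (false, true) by rewrite /sg !min0n eqxx.
rewrite /eq_regs -sg0; apply: exec_sweep_in_place => // h.
- move=> p _; rewrite (@column_pass_read2 _ (fun q b => (b, q.2))
    (fun q b => (q.1, q.2 && (q.1 == b)))) //.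
  rewrite !tracks_reg //.
  rewrite /sg [fst _]/= [snd _]/=; congr ((_, _), _).
  by move: (f lo) (f hi) => x y; apply/idP/idP; lia.
- case=> _ le_f; have := le_f _ i_ok; have := le_f _ j_ok; rewrite /sg /lo /hi /=.
  by case: (ltngtP i j) ij => // _ _ le_j le_i; apply/idP/idP; lia.
Qed.

(* The state records the previous bit of the input track, whether the end of track [r] has been
   passed, and the bit sought. *)
Definition test_input_bit (r : nat) : machine bool :=
  track_sweep (false, false, false)
    (fun j q b =>
       ((if j == 0 then (b, q.1.2, q.2)
         else if j == r then (if q.1.2 || b then q else (q.1.1, true, q.1.1)) else q), b))
    (@no_extension _) (fun q => q.2).

Lemma exec_test_input_bit w j f r : 0 < j < num_tracks ->
  exec w (test_input_bit j) f r 1 (nth false (rev w) (f j)) f r.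
Proof.
move=> j_ok; pose sg p := ((if p is p'.+1 then nth false (rev w) p' else false), f j < p,
                           (f j < p) && nth false (rev w) (f j)).
apply: (exec_sweep_in_place (sg := sg)) => // h.
- move=> p _; rewrite (@column_pass_read2 _ (fun q b => (b, q.1.2, q.2))
    (fun q b => if q.1.2 || b then q else (q.1.1, true, q.1.1))); last by lia.
  rewrite (@tracks_reg _ _ _ j); last by lia.
  rewrite [tracks w f p 0]/tracks /= /sg; congr (_, _); cbn [fst snd].
  case: (ltngtP (f j) p) => cmp; cbn [orb andb].
  + by have -> : f j < p.+1 by lia.
  + by have -> : (f j < p.+1) = false by lia.
  + by rewrite cmp ltnSn.
- case=> le_w _; rewrite /sg /=; case: ltnP => //= le.
  by rewrite nth_default // size_rev; lia.
Qed.

Definition input_column (b : bool) (j : nat) : bool := if j == 0 then b else j == 1.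

Definition append_input (b : bool) : machine unit :=
  track_sweep false (fun _ s b => (s, b)) (append_column (input_column b)) (fun _ => tt).

Lemma runs_append_input b h tk r tp : tape_holds (columns h tk) r tp ->
  exists2 tp', tape_holds (columns h tk ++ map (input_column b) track_ids) r tp' &
    runs (append_input b) tp (2 * (h * num_tracks + num_tracks) + 3) tt tp'.
Proof.
move=> holds; have pass : columns_pass (fun _ s b => (s, b)) (fun=> false) h tk tk.
  move=> p _; rewrite (column_pass_read (fun _ s _ => s)); congr (_, _).
  by elim: track_ids.
have appended := extension_append_column (input_column b).
have [tp' holds' run] := runs_track_sweep (fun=> tt) holds pass appended.
by exists tp' => //; move: run; rewrite size_map size_iota.
Qed.

Definition load_bit (o : option bool) : machine (option unit) :=
  if o is Some b then mbind (append_input b) (fun _ => mret None) else mret (Some tt).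

Definition load_input : machine unit := mloop (mbind pop load_bit).

Definition input_regs (w : seq bool) (j : nat) : nat := if j == 1 then size w else 0.

Lemma columns_input_rcons v b :
  columns (size (rcons v b)) (tracks (rev (rcons v b)) (input_regs (rcons v b))) =
  columns (size v) (tracks (rev v) (input_regs v)) ++ map (input_column b) track_ids.
Proof.
rewrite size_rcons columnsS; congr (_ ++ _).
  apply: eq_columns => p j ltp _; rewrite /tracks /input_regs !revK nth_rcons ltp size_rcons.
  by case: eqP => // _; case: eqP => // _; lia.
apply/eq_map => j; rewrite /tracks /input_regs /input_column revK nth_rcons ltnn eqxx size_rcons.
by case: eqP => // _; case: eqP => // _; lia.
Qed.

Definition load_cost (m : nat) : nat := 2 * (num_tracks * m.+1) + 2 * m + 10.

Lemma runs_load_input w v u tp : rev w = v ++ rev u ->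
  tape_holds (columns (size v) (tracks (rev v) (input_regs v))) u tp ->
  exists2 tp', represents w (input_regs w) [::] (size w) tp' &
    runs load_input tp ((size u).+1 * load_cost (size w)) tt tp'.
Proof.
elim/last_ind: u v tp => [|u b IH] v tp eq_w holds.
  have ev : v = rev w by rewrite eq_w cats0.
  have [tp' holds' run] := runs_pop_nil holds.
  exists tp'.
    split; first by split=> // j; rewrite /input_regs; case: eqP.
    by move: holds'; rewrite ev revK /input_regs size_rev.
  have run_bit : runs (load_bit None) tp' 0 (Some tt) tp' by apply: runs_mret.
  apply: runs_leq (runs_mloop_exit (runs_mbind run run_bit)).
  by rewrite /load_cost; lia.
have [tp1 holds1 run1] := runs_pop_rcons holds.
have [tp2 holds2 run2] := runs_append_input b holds1.
have [||tp3 rep3 run3] := IH (rcons v b) tp2.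
- by rewrite eq_w rev_rcons cat_rcons.
- by rewrite columns_input_rcons.
exists tp3 => //.
have run_bit : runs (load_bit (Some b)) tp1
    (2 * (size v * num_tracks + num_tracks) + 3 + 0) None tp2.
  by apply: runs_mbind run2 _; apply: runs_mret.
apply: runs_leq (runs_mloop_iter (runs_mbind run1 run_bit) run3).
rewrite size_rcons [(size u).+2 * _]mulSn leq_add2r.
have sz_w : size w = size v + (size u).+1.
  by rewrite -size_rev eq_w size_cat size_rev size_rcons.
have : size v * num_tracks + num_tracks <= num_tracks * (size w).+1.
  by rewrite -mulSnr mulnC leq_mul2l; lia.
by rewrite /load_cost; lia.
Qed.

End Tracks.

(** * Loop programs run in polynomial time *)

Definition mseq (M1 M2 : machine unit) : machine unit := mbind M1 (fun _ => M2).

Section ForLoop.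
Variables (n : nat) (w : seq bool).

Definition for_pass x body (finished : bool) : machine (option unit) :=
  if finished then mret (Some tt)
  else mbind body (fun _ : unit => mbind (incr_reg n x) (fun _ => mret None)).

Definition for_loop x y body : machine unit :=
  mseq (zero_reg n x) (mloop (mbind (eq_regs n x y) (for_pass x body))).

Lemma exec_mseq M1 M2 f r N1 f1 r1 N2 f2 r2 :
  exec n w M1 f r N1 tt f1 r1 -> exec n w M2 f1 r1 N2 tt f2 r2 ->
  exec n w (mseq M1 M2) f r (N1 + N2) tt f2 r2.
Proof. by move=> ex1 ex2; apply: exec_mbind ex1 _. Qed.

Lemma exec_for_pass x y body f r N f1 r1 : 0 < x < n.+1 -> 0 < y < n.+1 -> x != y ->
  f x != f y -> exec n w body f r N tt f1 r1 ->
  exec n w (mbind (eq_regs n x y) (for_pass x body)) f r (N + 2) None (set_reg f1 x (f1 x).+1) r1.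
Proof.
move=> x_ok y_ok xy /negbTE neq_fxy ex.
have -> : N + 2 = 1 + (N + (1 + 0)) by lia.
apply: (exec_mbind (exec_eq_regs x_ok y_ok xy)); rewrite neq_fxy.
by apply: (exec_mbind ex); apply: (exec_mbind (exec_incr_reg x_ok)); apply: exec_mret.
Qed.

Lemma exec_for_loop x y body m (N : nat -> nat) (I : nat -> (nat -> nat) -> seq bool -> Prop) f r :
  0 < x < n.+1 -> 0 < y < n.+1 -> x != y -> f y = m -> I 0 (set_reg f x 0) r ->
  (forall i f r, i < m -> f x = i -> f y = m -> I i f r ->
     exists f' r', [/\ exec n w body f r (N i) tt f' r', f' x = i, f' y = m &
       I i.+1 (set_reg f' x i.+1) r']) ->
  exists f' r', [/\ exec n w (for_loop x y body) f r (3 + \sum_(i < m) (N i + 3)) tt f' r',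
    f' x = m, f' y = m & I m f' r'].
Proof.
move=> x_ok y_ok xy fy I0 body_ok.
suff loop_ok d i f1 r1 : i + d = m -> f1 x = i -> f1 y = m -> I i f1 r1 ->
    exists f' r', [/\ exec n w (mloop (mbind (eq_regs n x y) (for_pass x body))) f1 r1
      (2 + \sum_(i <= j < m) (N j + 3)) tt f' r', f' x = m, f' y = m & I m f' r'].
  have [||||f' [r' [ex e1 e2 e3]]] := loop_ok m 0 (set_reg f x 0) r => //.
  - exact: set_reg_eq.
  - by rewrite set_reg_neq // eq_sym.
  exists f', r'; split=> //.
  by have := exec_mseq (exec_zero_reg (f := f) (r := r) x_ok) ex; rewrite big_mkord.
elim: d i f1 r1 => [|d IH] i f1 r1 e ex ey Ii.
  have ein : i = m by lia.
  rewrite ein in ex Ii *; exists f1, r1; split=> //.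
  rewrite big_geq // addn0; apply: exec_mloop_exit.
  rewrite -[1]/(1 + 0); apply: (exec_mbind (exec_eq_regs x_ok y_ok xy)).
  by rewrite ex ey eqxx; apply: exec_mret.
have lt : i < m by lia.
have [f2 [r2 [ex2 e2 e2' I2]]] := body_ok i f1 r1 lt ex ey Ii.
have neq_fxy : f1 x != f1 y by rewrite ex ey; lia.
have := exec_for_pass x_ok y_ok xy neq_fxy ex2; rewrite e2 => pass.
have [||||f' [r' [ex' e4 e5 e6]]] := IH i.+1 (set_reg f2 x i.+1) r2 => //.
- by lia.
- exact: set_reg_eq.
- by rewrite set_reg_neq // eq_sym.
exists f', r'; split=> //; rewrite big_ltn //.
by apply: exec_leq (exec_mloop_iter pass ex'); lia.
Qed.

Lemma exec_copy x y f r : 0 < x < n.+1 -> 0 < y < n.+1 -> x != y ->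
  exists f', [/\ exec n w (for_loop x y (mret tt)) f r (3 + f y * 3) tt f' r,
    f' x = f y & forall j, j != x -> f' j = f j].
Proof.
move=> x_ok y_ok xy.
have [|||f' [r' [ex e1 e2 [e3 e4]]]] := @exec_for_loop x y (mret tt) (f y) (fun=> 0)
  (fun _ f1 r1 => (forall j, j != x -> f1 j = f j) /\ r1 = r) f r x_ok y_ok xy.
- by [].
- by split=> // j js; rewrite set_reg_neq.
- move=> i f1 r1 lti ex ey [e ->]; exists f1, r; split=> //; first exact: exec_mret.
  by split=> // j js; rewrite set_reg_neq ?e.
rewrite e4 in ex; exists f'; split=> //.
by move: ex; rewrite sum_nat_const card_ord.
Qed.

Lemma exec_add x y z f r : 0 < x < n.+1 -> 0 < y < n.+1 -> 0 < z < n.+1 ->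
  x != y -> z != y -> z != x ->
  exists f', [/\ exec n w (for_loop x y (incr_reg n z)) f r (3 + f y * 4) tt f' r,
    f' z = f z + f y & forall j, j != x -> j != z -> f' j = f j].
Proof.
move=> x_ok y_ok z_ok xy zy zx.
have [|||f' [r' [ex e1 e2 [e3 e4 e5]]]] := @exec_for_loop x y (incr_reg n z) (f y) (fun=> 1)
  (fun i f1 r1 => [/\ forall j, j != x -> j != z -> f1 j = f j, r1 = r & f1 z = f z + i])
  f r x_ok y_ok xy.
- by [].
- by split=> // [j jx|]; rewrite set_reg_neq // addn0.
- move=> i f1 r1 lti ex ey [e -> ez].
  exists (set_reg f1 z (f1 z).+1), r; split.
  + exact: exec_incr_reg.
  + by rewrite set_reg_neq // eq_sym.
  + by rewrite set_reg_neq // eq_sym.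
  + split=> // [j jx jz|]; first by rewrite !set_reg_neq ?e.
    by rewrite set_reg_neq // set_reg_eq ez addnS.
rewrite e4 in ex; exists f'; split=> //.
by move: ex; rewrite sum_nat_const card_ord.
Qed.

Definition sum_loop t body : machine unit :=
  mseq (zero_reg n t)
    (for_loop (t + 2) (t + 1) (mseq body (for_loop (t + 4) (t + 3) (incr_reg n t)))).

Lemma exec_sum_loop t body m (N V : nat -> nat) (U : nat -> seq bool) f r :
  0 < t -> t + 4 <= n -> f (t + 1) = m ->
  (forall i f1 r1, i < m -> (forall j, j < t -> f1 j = f j) -> f1 (t + 2) = i ->
     exists f', [/\ exec n w body f1 r1 (N i) tt f' (r1 ++ U i), f' (t + 3) = V i &
       forall j, j < t + 3 -> f' j = f1 j]) ->
  exists f', [/\ exec n w (sum_loop t body) f r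
      (1 + (3 + \sum_(i < m) (N i + (3 + V i * 4) + 3))) tt f'
      (r ++ flatten [seq U i | i <- iota 0 m]),
    f' t = \sum_(i < m) V i & forall j, j < t -> f' j = f j].
Proof.
move=> t0 t_le fm body_ok; pose f0 := set_reg f t 0.
have f0_lt j : j < t -> f0 j = f j by move=> jt; rewrite /f0 set_reg_neq //; lia.
have [||||||f' [r' [ex _ _ [low er acc]]]] :=
  @exec_for_loop (t + 2) (t + 1) (mseq body (for_loop (t + 4) (t + 3) (incr_reg n t))) m
   (fun i => N i + (3 + V i * 4))
   (fun i f' r' => [/\ forall j, j < t -> f' j = f j,
      r' = r ++ flatten [seq U j | j <- iota 0 i] & f' t = \sum_(u < i) V u]) f0 r; try lia.
- by rewrite /f0 set_reg_neq //; lia.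
- rewrite cats0 big_ord0; split=> // [j jt|]; rewrite set_reg_neq; try lia.
    exact: f0_lt.
  by rewrite /f0 set_reg_eq.
- move=> i f1 r1 lti ex ey [low -> acc].
  have [f2 [ex2 val2 keep2]] := body_ok i f1 (r ++ flatten [seq U j | j <- iota 0 i]) lti low ex.
  have [||||||f3 [ex3 val3 keep3]] := @exec_add (t + 4) (t + 3) t f2
    (r ++ flatten [seq U j | j <- iota 0 i] ++ U i); try lia.
  exists f3, (r ++ flatten [seq U j | j <- iota 0 i.+1]); split.
  + by rewrite flatten_map_iotaS -val2; apply: exec_mseq ex3; rewrite catA.
  + by rewrite keep3 ?keep2 //; lia.
  + by rewrite keep3 ?keep2 //; lia.
  + split=> // [j jt|]; rewrite set_reg_neq; try lia.
      by rewrite keep3 ?keep2 ?low //; lia.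
    by rewrite val3 big_ord_recr /= val2 keep2 ?acc //; lia.
exists f'; rewrite er in ex; split=> //; apply: exec_mseq ex.
by apply: exec_zero_reg; lia.
Qed.

End ForLoop.

(* A context is an input word together with the values of the enclosing loop counters. *)
Fixpoint context (k : nat) : Type := if k is k'.+1 then (context k' * nat)%type else seq bool.

Fixpoint input_of (k : nat) : context k -> seq bool :=
  match k return context k -> seq bool with
  | 0 => fun g => g
  | k'.+1 => fun g => input_of g.1
  end.

(* A loop program with [k] counters in scope yields the number [F g] and emits the word [G g];
   input bits are addressed from the end of the input, because the machine reads it as a stack. *)
Inductive loop_prog : forall k, (context k -> nat) -> (context k -> seq bool) -> Prop :=
| prog_zero k : @loop_prog k (fun _ => 0) (fun _ => [::])
| prog_input_size : @loop_prog 0 (fun w => size w) (fun _ => [::])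
| prog_input_bit k (F : context k -> nat) : loop_prog F (fun _ => [::]) ->
    loop_prog (fun g => nat_of_bool (nth false (rev (input_of g)) (F g))) (fun _ => [::])
| prog_counter k : @loop_prog k.+1 (fun g => g.2) (fun _ => [::])
| prog_weaken k (F : context k -> nat) G : loop_prog F G ->
    @loop_prog k.+1 (fun g => F g.1) (fun g => G g.1)
| prog_succ k (F : context k -> nat) : loop_prog F (fun _ => [::]) ->
    loop_prog (fun g => (F g).+1) (fun _ => [::])
| prog_emit k b : @loop_prog k (fun _ => 0) (fun _ => [:: b])
| prog_seq k (F1 F2 : context k -> nat) G1 G2 : loop_prog F1 G1 -> loop_prog F2 G2 ->
    loop_prog F2 (fun g => G1 g ++ G2 g)
| prog_for k (F : context k -> nat) (F1 : context k -> nat -> nat)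
      (G1 : context k -> nat -> seq bool) :
    loop_prog F (fun _ => [::]) -> @loop_prog k.+1 (fun g => F1 g.1 g.2) (fun g => G1 g.1 g.2) ->
    loop_prog (fun g => \sum_(i < F g) F1 g i) (fun g => flatten [seq G1 g i | i <- iota 0 (F g)])
| prog_if k (F1 F2 F3 F4 : context k -> nat) G3 G4 :
    loop_prog F1 (fun _ => [::]) -> loop_prog F2 (fun _ => [::]) ->
    loop_prog F3 G3 -> loop_prog F4 G4 ->
    loop_prog (fun g => if F1 g == F2 g then F3 g else F4 g)
              (fun g => if F1 g == F2 g then G3 g else G4 g)
| prog_ext k (F F' : context k -> nat) G G' :
    F =1 F' -> G =1 G' -> loop_prog F G -> loop_prog F' G'.

Fixpoint bounded_by (z : nat) (k : nat) : context k -> Prop :=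
  match k return context k -> Prop with
  | 0 => fun w => size w <= z
  | k'.+1 => fun g => g.2 <= z /\ bounded_by z g.1
  end.

Lemma bounded_by_leq z z' k (g : context k) : z <= z' -> bounded_by z g -> bounded_by z' g.
Proof.
move=> le; elim: k g => [|k IH] g /=; first by move/leq_trans; apply.
by case=> le2 /IH; split=> //; apply: leq_trans le2 le.
Qed.

Definition poly_bounded k (F : context k -> nat) : Prop :=
  exists d, forall g z, 1 < z -> bounded_by z g -> F g <= z ^ d.

Lemma poly_bounded_leq k (F G : context k -> nat) :
  (forall g, F g <= G g) -> poly_bounded G -> poly_bounded F.
Proof. by move=> le [d bd]; exists d => g z lt b; apply: leq_trans (le g) (bd _ _ lt b). Qed.

Lemma poly_bounded_const k c : @poly_bounded k (fun _ => c).
Proof.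
exists c => g z lt _; apply: (leq_trans (ltnW (ltn_expl c (ltnSn 1)))).
by case: c => // c; rewrite leq_exp2r.
Qed.

Lemma poly_bounded_add k (F G : context k -> nat) :
  poly_bounded F -> poly_bounded G -> poly_bounded (fun g => F g + G g).
Proof.
move=> [d1 bd1] [d2 bd2]; exists (d1 + d2).+1 => g z lt b.
have le1 : F g <= z ^ (d1 + d2) by apply: leq_trans (bd1 _ _ lt b) _; rewrite leq_exp2l // leq_addr.
have le2 : G g <= z ^ (d1 + d2) by apply: leq_trans (bd2 _ _ lt b) _; rewrite leq_exp2l // leq_addl.
rewrite expnS; apply: (@leq_trans (2 * z ^ (d1 + d2))); first by lia.
by rewrite leq_mul2r lt orbT.
Qed.

Lemma poly_bounded_mul k (F G : context k -> nat) :
  poly_bounded F -> poly_bounded G -> poly_bounded (fun g => F g * G g).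
Proof.
move=> [d1 bd1] [d2 bd2]; exists (d1 + d2) => g z lt b.
by rewrite expnD leq_mul ?bd1 ?bd2.
Qed.

Lemma poly_bounded_succ k (F : context k -> nat) :
  poly_bounded F -> poly_bounded (fun g => (F g).+1).
Proof.
by move=> bd; apply: poly_bounded_leq (poly_bounded_add bd (poly_bounded_const k 1)) => g; lia.
Qed.

Lemma poly_bounded_weaken k (F : context k -> nat) :
  poly_bounded F -> @poly_bounded k.+1 (fun g => F g.1).
Proof. by move=> [d bd]; exists d => g z lt [_ b]; apply: bd. Qed.

Lemma poly_bounded_counter k : @poly_bounded k.+1 (fun g => g.2).
Proof. by exists 1 => g z lt [b _]; rewrite expn1. Qed.

Lemma poly_bounded_input_size : @poly_bounded 0 (fun w => size w).
Proof. by exists 1 => w z _ b; rewrite expn1. Qed.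

Lemma poly_bounded_sum k (F : context k -> nat) (G : context k -> nat -> nat) :
  poly_bounded F -> @poly_bounded k.+1 (fun g => G g.1 g.2) ->
  poly_bounded (fun g => \sum_(i < F g) G g i).
Proof.
move=> [d1 bd1] [d2 bd2]; exists (d1 + d1.+1 * d2) => g z lt b.
have le1 := bd1 _ _ lt b.
have le_z : z <= z ^ d1.+1 by rewrite -{1}[z]expn1 leq_exp2l.
rewrite expnD expnM; apply: (@leq_trans (\sum_(i < F g) (z ^ d1.+1) ^ d2)).
  apply: leq_sum => i _; apply: (bd2 (g, i : nat)); first by apply: leq_trans le_z.
  split; last exact: bounded_by_leq b.
  apply: leq_trans (ltnW (ltn_ord i)) (leq_trans le1 _).
  by rewrite leq_exp2l.
by rewrite sum_nat_const card_ord leq_mul2r le1 orbT.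
Qed.

Lemma loop_prog_poly_bounded k (F : context k -> nat) G : loop_prog F G -> poly_bounded F.
Proof.
elim=> {k F G}.
- by move=> k; apply: poly_bounded_const.
- exact: poly_bounded_input_size.
- by move=> k F _ _; apply: poly_bounded_leq (poly_bounded_const k 1) => g; case: nth.
- exact: poly_bounded_counter.
- by move=> k F G _; apply: poly_bounded_weaken.
- by move=> k F _; apply: poly_bounded_succ.
- by move=> k _; apply: poly_bounded_const.
- by [].
- by move=> k F F1 G1 _ bd _ bd1; apply: poly_bounded_sum.
- move=> k F1 F2 F3 F4 G3 G4 _ _ _ _ _ bd3 _ bd4.
  by apply: poly_bounded_leq (poly_bounded_add bd3 bd4) => g; case: ifP; lia.
- by move=> k F F' G G' e _ _; apply: poly_bounded_leq => g; rewrite e.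
Qed.

Fixpoint holds_context (rho : nat -> nat) (k : nat) : context k -> (nat -> nat) -> Prop :=
  match k return context k -> (nat -> nat) -> Prop with
  | 0 => fun w f => f 1 = size w
  | k'.+1 => fun g f => f (rho k') = g.2 /\ holds_context rho g.1 f
  end.

Definition context_below (rho : nat -> nat) (k t : nat) : Prop :=
  1 < t /\ forall j, j < k -> 0 < rho j < t.

Lemma holds_context_eq k (g : context k) rho rho' t f f' :
  context_below rho k t -> (forall j, j < t -> f' j = f j) ->
  (forall j, j < k -> rho' j = rho j) -> holds_context rho g f -> holds_context rho' g f'.
Proof.
case=> t1; elim: k g => [|k IH] g below eq_f eq_rho /=; first by rewrite eq_f.
case=> e1 e2; split; first by rewrite eq_rho // eq_f //; have := below k (ltnSn k); lia.
by apply: IH e2 => // j jk; [apply: below | apply: eq_rho]; lia.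
Qed.

Lemma holds_context_push k (g : context k) rho t f f' x i :
  context_below rho k t -> (forall j, j < t -> f' j = f j) -> f' x = i ->
  holds_context rho g f -> holds_context (k := k.+1) (set_reg rho k x) (g, i) f'.
Proof.
move=> below eq_f fx holds; split; first by rewrite set_reg_eq.
by apply: (holds_context_eq below eq_f _ holds) => j jk; rewrite set_reg_neq //; lia.
Qed.

Lemma context_below_leq rho k t t' : t <= t' -> context_below rho k t -> context_below rho k t'.
Proof. by move=> le [t1 below]; split=> [|j /below]; lia. Qed.

Lemma context_below_push rho k t x t' : context_below rho k t -> t <= x < t' ->
  context_below (set_reg rho k x) k.+1 t'.
Proof.
move=> [t1 below] le_x; split=> [|j]; first by lia.
by rewrite /set_reg; case: eqP => [_|/eqP jk jk1]; [lia | have := below j; lia].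
Qed.

(* The number is left in register [t]; the registers below [t] are preserved, and [scratch]
   registers from [t] on may be overwritten. *)
Definition implements k (F : context k -> nat) (G : context k -> seq bool)
    (scratch : nat) (N : context k -> nat) : Prop :=
  forall n rho t, context_below rho k t -> t + scratch <= n ->
  exists M : machine unit, forall g f r, holds_context rho g f ->
  exists f', [/\ exec n (input_of g) M f r (N g) tt f' (r ++ G g), f' t = F g &
    forall j, j < t -> f' j = f j].

Definition implementable k (F : context k -> nat) (G : context k -> seq bool) : Prop :=
  exists scratch N, poly_bounded N /\ implements F G scratch N.

Lemma implementable_zero k : @implementable k (fun _ => 0) (fun _ => [::]).
Proof.
exists 1, (fun=> 1); split; first exact: poly_bounded_const.
move=> n rho t [t1 _] tn; exists (zero_reg n t) => g f r _.
exists (set_reg f t 0); rewrite cats0; split; [by apply: exec_zero_reg; lia | exact: set_reg_eq |].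
by move=> j jt; rewrite set_reg_neq //; lia.
Qed.

Lemma poly_bounded_copy k (F : context k -> nat) :
  poly_bounded F -> poly_bounded (fun g => 3 + F g * 3).
Proof.
move=> bd; apply: poly_bounded_add; first exact: poly_bounded_const.
by apply: poly_bounded_mul => //; apply: poly_bounded_const.
Qed.

Lemma implementable_input_size : @implementable 0 (fun w => size w) (fun _ => [::]).
Proof.
exists 1, (fun w => 3 + size w * 3); split; first exact: poly_bounded_copy poly_bounded_input_size.
move=> n rho t [t1 _] tn; exists (for_loop n t 1 (mret tt)) => w f r /= <-.
have [|||f' [ex e keep]] := @exec_copy n w t 1 f r; try lia.
by exists f'; rewrite cats0; split=> // j jt; apply: keep; lia.
Qed.

Lemma implementable_counter k : @implementable k.+1 (fun g => g.2) (fun _ => [::]).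
Proof.
exists 1, (fun g => 3 + g.2 * 3); split; first exact: poly_bounded_copy (poly_bounded_counter k).
move=> n rho t [t1 below] tn; have k_ok := below k (ltnSn k).
exists (for_loop n t (rho k) (mret tt)) => g f r [<- _].
have [|||f' [ex e keep]] := @exec_copy n (input_of g) t (rho k) f r; try lia.
by exists f'; rewrite cats0; split=> // j jt; apply: keep; lia.
Qed.

Lemma implementable_weaken k (F : context k -> nat) G :
  implementable F G -> @implementable k.+1 (fun g => F g.1) (fun g => G g.1).
Proof.
move=> [scratch [N [bd impl]]]; exists scratch, (fun g => N g.1).
split; first exact: poly_bounded_weaken.
move=> n rho t [t1 below] tn; have [|M M_ok] := impl n rho t _ tn.
  by split=> // j jk; apply: below; lia.
by exists M => g f r [_ holds]; apply: M_ok.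
Qed.

Lemma implementable_emit k b : @implementable k (fun _ => 0) (fun _ => [:: b]).
Proof.
exists 1, (fun=> 1 + 1); split; first exact: poly_bounded_const.
move=> n rho t [t1 _] tn; exists (mseq (zero_reg n t) (push b)) => g f r _.
exists (set_reg f t 0); rewrite cats1; split; last 1 first.
- by move=> j jt; rewrite set_reg_neq //; lia.
- by apply: exec_mseq (exec_zero_reg _) (@exec_push _ _ _ _ _); lia.
- exact: set_reg_eq.
Qed.

Lemma implementable_succ k (F : context k -> nat) :
  implementable F (fun _ => [::]) -> implementable (fun g => (F g).+1) (fun _ => [::]).
Proof.
move=> [scratch [N [bd impl]]]; exists scratch.+1, (fun g => N g + 1); split.
  by apply: poly_bounded_add => //; apply: poly_bounded_const.
move=> n rho t below tn; have [|M M_ok] := impl n rho t below; first by lia.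
have [t1 _] := below; exists (mseq M (incr_reg n t)) => g f r holds.
have [f1 [ex1 e1 keep1]] := M_ok g f r holds; rewrite cats0 in ex1.
exists (set_reg f1 t (f1 t).+1); rewrite cats0; split.
- by apply: exec_mseq ex1 _; apply: exec_incr_reg; lia.
- by rewrite set_reg_eq e1.
- by move=> j jt; rewrite set_reg_neq ?keep1 //; lia.
Qed.

Lemma implementable_input_bit k (F : context k -> nat) : implementable F (fun _ => [::]) ->
  implementable (fun g => nat_of_bool (nth false (rev (input_of g)) (F g))) (fun _ => [::]).
Proof.
move=> [scratch [N [bd impl]]]; exists scratch.+1, (fun g => N g + 3); split.
  by apply: poly_bounded_add => //; apply: poly_bounded_const.
move=> n rho t below tn; have [|M M_ok] := impl n rho t below; first by lia.
have t_ok : 0 < t < n.+1 by have [] := below; lia.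
exists (mbind (mbind M (fun _ => test_input_bit n t))
  (fun b : bool => mseq (zero_reg n t) (if b then incr_reg n t else mret tt))) => g f r holds.
have [f1 [ex1 e1 keep1]] := M_ok g f r holds; rewrite cats0 in ex1.
have ex2 := exec_test_input_bit (w := input_of g) (f := f1) (r := r) t_ok; rewrite e1 in ex2.
have {}ex2 := exec_mbind (k := fun _ => test_input_bit n t) ex1 ex2.
have ex3 := exec_zero_reg (w := input_of g) (f := f1) (r := r) t_ok.
rewrite cats0 -[3]/(1 + 2) addnA; case: nth ex2 => ex2.
  exists (set_reg (set_reg f1 t 0) t (set_reg f1 t 0 t).+1); split.
  - by apply: (exec_mbind ex2); apply: exec_mseq ex3 _; apply: exec_incr_reg.
  - by rewrite !set_reg_eq.
  - by move=> j jt; rewrite !set_reg_neq ?keep1 //; lia.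
exists (set_reg f1 t 0); split; last 1 first.
- by move=> j jt; rewrite set_reg_neq ?keep1 //; lia.
- apply: (exec_mbind ex2); apply: (@exec_leq _ _ _ _ _ _ (1 + 0)) => //.
  by apply: exec_mseq ex3 _; apply: exec_mret.
- exact: set_reg_eq.
Qed.

Lemma implementable_seq k (F1 F2 : context k -> nat) G1 G2 :
  implementable F1 G1 -> implementable F2 G2 -> implementable F2 (fun g => G1 g ++ G2 g).
Proof.
move=> [scratch1 [N1 [bd1 impl1]]] [scratch2 [N2 [bd2 impl2]]].
exists (scratch1 + scratch2), (fun g => N1 g + N2 g); split; first exact: poly_bounded_add.
move=> n rho t below tn.
have [|M1 M1_ok] := impl1 n rho t below; first by lia.
have [|M2 M2_ok] := impl2 n rho t below; first by lia.
exists (mseq M1 M2) => g f r holds; have [f1 [ex1 _ keep1]] := M1_ok g f r holds.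
have holds1 := holds_context_eq below keep1 (fun _ _ => erefl) holds.
have [f2 [ex2 e2 keep2]] := M2_ok g f1 (r ++ G1 g) holds1.
exists f2; rewrite catA; split=> // [|j jt]; first exact: exec_mseq ex1 ex2.
by rewrite keep2 ?keep1.
Qed.

Lemma implementable_for k (F : context k -> nat) (F1 : context k -> nat -> nat)
    (G1 : context k -> nat -> seq bool) :
  poly_bounded F -> @poly_bounded k.+1 (fun g => F1 g.1 g.2) ->
  implementable F (fun _ => [::]) ->
  @implementable k.+1 (fun g => F1 g.1 g.2) (fun g => G1 g.1 g.2) ->
  implementable (fun g => \sum_(i < F g) F1 g i)
                (fun g => flatten [seq G1 g i | i <- iota 0 (F g)]).
Proof.
move=> bdF bdF1 [scratch1 [N1 [bd1 impl1]]] [scratch2 [N2 [bd2 impl2]]].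
exists (scratch1 + scratch2 + 5), (fun g =>
  N1 g + (1 + (3 + \sum_(i < F g) (N2 (g, i : nat) + (3 + F1 g i * 4) + 3)))); split.
  apply: poly_bounded_add => //; do 2!apply: poly_bounded_add (poly_bounded_const _ _) _.
  apply: (poly_bounded_sum (G := fun g i => N2 (g, i) + (3 + F1 g i * 4) + 3)) => //.
  apply: poly_bounded_add (poly_bounded_const _ _); apply: poly_bounded_add.
    by apply: poly_bounded_leq bd2 => -[].
  apply: poly_bounded_add (poly_bounded_const _ _) _.
  by apply: poly_bounded_mul => //; apply: poly_bounded_const.
move=> n rho t below tn; have [t1 _] := below.
have [||M1 M1_ok] := impl1 n rho (t + 1).
- by apply: context_below_leq below; lia.
- by lia.
have [||M2 M2_ok] := impl2 n (set_reg rho k (t + 2)) (t + 3).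
- by apply: context_below_push below _; lia.
- by lia.
exists (mseq M1 (sum_loop n t M2)) => g f r holds.
have [f1 [ex1 e1 keep1]] := M1_ok g f r holds; rewrite cats0 in ex1.
have keep1' j : j < t -> f1 j = f j by move=> jt; apply: keep1; lia.
have [||||f2 [ex2 e2 keep2]] := @exec_sum_loop n (input_of g) t M2 (F g)
  (fun i => N2 (g, i)) (F1 g) (G1 g) f1 r.
- by lia.
- by lia.
- exact: e1.
- move=> i f2 r2 _ low ei; apply: (M2_ok (g, i)).
  by apply: holds_context_push below _ ei holds => j jt; rewrite low ?keep1'.
exists f2; split=> // [|j jt]; last by rewrite keep2 ?keep1'.
exact: exec_mseq ex1 ex2.
Qed.

Lemma implementable_if k (F1 F2 F3 F4 : context k -> nat) G3 G4 :
  implementable F1 (fun _ => [::]) -> implementable F2 (fun _ => [::]) ->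
  implementable F3 G3 -> implementable F4 G4 ->
  implementable (fun g => if F1 g == F2 g then F3 g else F4 g)
                (fun g => if F1 g == F2 g then G3 g else G4 g).
Proof.
move=> [scratch1 [N1 [bd1 impl1]]] [scratch2 [N2 [bd2 impl2]]].
move=> [scratch3 [N3 [bd3 impl3]]] [scratch4 [N4 [bd4 impl4]]].
exists (scratch1 + scratch2 + scratch3 + scratch4 + 3), (fun g => N1 g + N2 g + 1 + (N3 g + N4 g)).
split.
  by do !apply: poly_bounded_add => //; apply: poly_bounded_const.
move=> n rho t below tn; have [t1 _] := below.
have [|M1 M1_ok] := impl1 n rho t below; first by lia.
have [||M2 M2_ok] := impl2 n rho t.+1; [exact: context_below_leq below | by lia |].
have [|M3 M3_ok] := impl3 n rho t below; first by lia.
have [|M4 M4_ok] := impl4 n rho t below; first by lia.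
exists (mbind (mbind (mseq M1 M2) (fun _ => eq_regs n t t.+1))
  (fun b : bool => if b then M3 else M4)).
move=> g f r holds; have [f1 [ex1 e1 keep1]] := M1_ok g f r holds; rewrite cats0 in ex1.
have holds1 := holds_context_eq below keep1 (fun _ _ => erefl) holds.
have [f2 [ex2 e2 keep2]] := M2_ok g f1 r holds1; rewrite cats0 in ex2.
have keep12 j : j < t -> f2 j = f j by move=> jt; rewrite keep2 ?keep1 //; lia.
have holds2 := holds_context_eq below keep12 (fun _ _ => erefl) holds.
have test : exec n (input_of g) (mbind (mseq M1 M2) (fun _ => eq_regs n t t.+1)) f r
    (N1 g + N2 g + 1) (F1 g == F2 g) f2 r.
  apply: (exec_mbind (exec_mseq ex1 ex2)); rewrite -e1 -(keep2 t) // -e2.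
  by apply: exec_eq_regs; lia.
case: eqP test => _ test.
  have [f3 [ex3 e3 keep3]] := M3_ok g f2 r holds2.
  exists f3; split=> // [|j jt]; last by rewrite keep3 ?keep12.
  by apply: exec_mbind test _; apply: exec_leq ex3; lia.
have [f3 [ex3 e3 keep3]] := M4_ok g f2 r holds2.
exists f3; split=> // [|j jt]; last by rewrite keep3 ?keep12.
by apply: exec_mbind test _; apply: exec_leq ex3; lia.
Qed.

Lemma loop_prog_implementable k (F : context k -> nat) G : loop_prog F G -> implementable F G.
Proof.
elim=> {k F G}.
- exact: implementable_zero.
- exact: implementable_input_size.
- by move=> k F _; apply: implementable_input_bit.
- exact: implementable_counter.
- by move=> k F G _; apply: implementable_weaken.
- by move=> k F _; apply: implementable_succ.
- exact: implementable_emit.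
- by move=> k F1 F2 G1 G2 _ impl1 _; apply: implementable_seq impl1.
- move=> k F F1 G1 prog impl prog1 impl1.
  by apply: implementable_for => //; apply: loop_prog_poly_bounded; [exact: prog | exact: prog1].
- by move=> k F1 F2 F3 F4 G3 G4 _ impl1 _ impl2 _ impl3 _; apply: implementable_if.
- move=> k F F' G G' eqF eqG _ [scratch [N [bd impl]]].
  exists scratch, N; split=> // n rho t below tn.
  have [M M_ok] := impl n rho t below tn; exists M => g f r holds.
  by have [f' [ex e keep]] := M_ok g f r holds; exists f'; rewrite -eqF -eqG.
Qed.

Definition program_time (n : nat) (N : seq bool -> nat) (w : seq bool) : nat :=
  1 + (size w).+1 * load_cost n (size w) + (N w * sweep_cost n (size w + N w) + 1).

Lemma poly_bounded_program_time n (N : context 0 -> nat) :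
  poly_bounded N -> @poly_bounded 0 (program_time n N).
Proof.
move=> bdN; have bd_sz := poly_bounded_input_size.
have bd_const c := poly_bounded_const 0 c.
have bd_load : @poly_bounded 0 (fun w => load_cost n (size w)).
  apply: poly_bounded_add (bd_const _); apply: poly_bounded_add; last exact: poly_bounded_mul.
  by do 2!apply: poly_bounded_mul (bd_const _) _; apply: poly_bounded_succ.
have bd_sweep : @poly_bounded 0 (fun w => sweep_cost n (size w + N w)).
  have bd_sum := poly_bounded_add bd_sz bdN.
  apply: poly_bounded_add (bd_const _); apply: poly_bounded_add; last exact: poly_bounded_mul.
  by do 2!apply: poly_bounded_mul (bd_const _) _.
apply: poly_bounded_add; apply: poly_bounded_add => //; last exact: poly_bounded_mul.
by apply: poly_bounded_mul => //; apply: poly_bounded_succ.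
Qed.

Lemma poly_bounded_time (F : context 0 -> nat) : poly_bounded F ->
  exists a d, forall w, F w <= a * size w ^ d + a.
Proof.
move=> [d bd]; exists (3 ^ d), d => w.
apply: (leq_trans (bd w (size w + 2) _ _)); [by rewrite addn2 | exact: leq_addr |].
case: (posnP (size w)) => [->|pos].
  by rewrite add0n; apply: leq_trans (leq_addl _ _); case: (d) => // d'; rewrite leq_exp2r.
apply: leq_trans (leq_addr _ _); rewrite -expnMn.
by case: (d) => // d'; rewrite leq_exp2r //; lia.
Qed.

Lemma input_tape_holds w :
  tape_holds [::] w (write_move (tape_head (input_tape w)) DLeft (input_tape w)).
Proof.
exists 0; case: w => [|b w]; first by exists 1.
by exists 0; rewrite /= cats0.
Qed.

Lemma tape_output_stack u r tp : tape_holds u r tp ->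
  tape_output (write_move (tape_head tp) DRight tp) = r.
Proof.
case=> k [k' ->]; rewrite /tape_output /=.
case: r => [|b r] /=; first by rewrite head_nseq.
congr (_ :: _); elim: r => [|c r IH] /=; first by case: (k').
by rewrite IH.
Qed.

Lemma poly_time_of_exec n (M : machine unit) (N : context 0 -> nat) (f : seq bool -> seq bool) :
  poly_bounded N ->
  (forall w, exists regs, exec n w M (input_regs w) [::] (N w) tt regs (f w)) ->
  poly_time_computable f.
Proof.
move=> /(poly_bounded_program_time n) /poly_bounded_time [a [d le_time]] M_ok.
pose M' := mseq (mseq (mmove DLeft) (load_input n)) (mseq M (mmove DRight)).
exists (TM_of_machine M'), a, d => w T.
have [tp1 rep1 run1] := @runs_load_input n w [::] w _ erefl (input_tape_holds w).
have [regs ex] := M_ok w.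
have [|h [tp2 [[_ holds2] _ run2]]] := ex (size w) (size w + N w) tp1 rep1; first by rewrite addn0.
have moves dr tp : runs (mmove dr) tp 1 tt (write_move (tape_head tp) dr tp) by [].
have run : runs M' (input_tape w) T tt (write_move (tape_head tp2) DRight tp2).
  apply: (@runs_leq _ _ _ (program_time n N w)) (le_time w) _.
  by apply: (runs_mbind (runs_mbind (moves DLeft _) run1)); apply: (runs_mbind run2).
have [halts ->] := run_TM_of_machine run.
by split; rewrite // (tape_output_stack holds2).
Qed.

Theorem loop_prog_poly_time (F : context 0 -> nat) (G : context 0 -> seq bool) :
  loop_prog F G -> poly_time_computable G.
Proof.
move=> /loop_prog_implementable [scratch [N [bd impl]]].
have [||M M_ok] := impl (scratch + 2) id 2; [by split | by lia |].
apply: (poly_time_of_exec (n := scratch + 2) (M := M) bd) => w.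
by have [|f' [ex _ _]] := M_ok w (input_regs w) [::]; last by exists f'.
Qed.

(** * Graphs covered by cliques *)

Definition offdiag (V : finType) (K : {set V}) : {set V * V} :=
  [set p | [&& p.1 \in K, p.2 \in K & p.1 != p.2]].

Lemma card_rel (V : finType) (r : rel V) : #|[set p | r p.1 p.2]| = \sum_x #|[set y | r x y]|.
Proof.
rewrite -sum1_card (eq_bigl (fun p : V * V => r p.1 p.2)); last by move=> p; rewrite inE.
rewrite -(pair_big_dep xpredT r (fun _ _ => 1)) /=.
by apply: eq_bigr => x _; rewrite -sum1_card; apply: eq_bigl => y; rewrite inE.
Qed.

Lemma card_offdiag (V : finType) (K : {set V}) : #|offdiag K| = #|K| * #|K|.-1.
Proof.
rewrite (@card_rel V (fun x y => [&& x \in K, y \in K & x != y])).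
rewrite (bigID [in K]) /= [X in _ + X]big1 ?addn0; last first.
  by move=> x /negbTE xK; apply: eq_card0 => y; rewrite !inE xK.
rewrite (eq_bigr (fun=> #|K|.-1)) ?sum_nat_const // => x xK.
have -> : #|K|.-1 = #|K :\ x| by rewrite (cardsD1 x K) xK.
by apply: eq_card => y; rewrite !inE [x == y]eq_sym xK /= andbC.
Qed.

Lemma offdiag_subset (V : finType) (K K' : {set V}) : K \subset K' -> offdiag K \subset offdiag K'.
Proof.
by move/subsetP=> sub; apply/subsetP => p; rewrite !inE => /and3P [/sub -> /sub -> ->].
Qed.

Lemma offdiagI (V : finType) (K K' : {set V}) : offdiag (K :&: K') = offdiag K :&: offdiag K'.
Proof.
apply/setP => p; rewrite !inE.
by case: (p.1 \in K) (p.1 \in K') (p.2 \in K) (p.2 \in K') (p.1 != p.2) => [] [] [] [] [].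
Qed.

Lemma new_pairs_lower_bound k j : 0 < j <= k -> (k - j) * k <= k * k.-1 - j * j.-1.
Proof.
case/andP=> j0 jk; rewrite -(subnK jk); case: j j0 {jk} => // j _.
move: (k - j.+1) => d; rewrite addnK addnS /=; nia.
Qed.

Lemma overlapping_pairs_lower_bound k j : 1 < j < k ->
  (k + k - j).-1 * k < 2 * (k * k.-1) - j * j.-1.
Proof.
case/andP=> j1 jk; rewrite -(subnK (ltnW jk)); move: jk; rewrite -subn_gt0.
case: j j1 => [|[|j]] // _; case: (k - j.+2) => // d _.
have -> : (d.+1 + j.+2 + (d.+1 + j.+2) - j.+2).-1 = d.*2.+1 + j.+2 by lia.
rewrite [(d.+1 + _).-1]/= [j.+2.-1]/=; nia.
Qed.

Definition arcs (V : finType) (G : rel V) (S : {set V}) : {set V * V} :=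
  [set p | [&& p.1 \in S, p.2 \in S & G p.1 p.2]].

Definition kcliques (V : finType) (G : rel V) (k : nat) : {set {set V}} :=
  [set K : {set V} | (#|K| == k) && (offdiag K \subset [set p | G p.1 p.2])].

Definition covered_by_kcliques (V : finType) (G : rel V) (k : nat) : Prop :=
  forall x y, G x y -> exists K, [/\ K \in kcliques G k, x \in K & y \in K].

Section CliqueCover.
Variables (V : finType) (G : rel V) (k : nat).
Hypotheses (G_irr : irreflexive G) (k_gt0 : 0 < k).
Hypothesis G_connected : forall x y, connect G x y.
Hypothesis G_covered : covered_by_kcliques G k.

Lemma kclique_card K : K \in kcliques G k -> #|K| = k.
Proof. by rewrite inE => /andP [/eqP]. Qed.

Lemma kclique_adj K x y : K \in kcliques G k -> x \in K -> y \in K -> x != y -> G x y.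
Proof.
rewrite inE => /andP [_ /subsetP adj] xK yK xy.
by have := adj (x, y); rewrite !inE /= xK yK xy => /(_ isT).
Qed.

Lemma kclique_arcs (K S : {set V}) :
  K \in kcliques G k -> K \subset S -> offdiag K \subset arcs G S.
Proof.
move=> cliqueK /subsetP KS; apply/subsetP => -[u v]; rewrite !inE /= => /and3P [uK vK uv].
by rewrite !KS //=; apply: kclique_adj cliqueK uK vK uv.
Qed.

Lemma exit_edge (S : {set V}) : S != set0 -> S != setT ->
  exists x y, [/\ x \in S, y \notin S & G x y].
Proof.
move=> /set0Pn [x xS]; rewrite -subTset => /subsetPn [y _ yNS].
case/connectP: (G_connected x y) => p; elim: p x xS => [|z p IH] x xS /=.
  by move=> _ e; rewrite e xS in yNS.
case/andP=> Gxz pth e; case zS: (z \in S); first exact: (IH z).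
by exists x, z; rewrite zS.
Qed.

Lemma arcs_extend (S : {set V}) : S != set0 -> S != setT ->
  exists2 S' : {set V}, S \proper S' & #|arcs G S| + (#|S'| - #|S|) * k <= #|arcs G S'|.
Proof.
move=> S0 ST; have [x [y [xS yNS Gxy]]] := exit_edge S0 ST.
have [K [cliqueK xK yK]] := G_covered Gxy; have cardK := kclique_card cliqueK.
exists (S :|: K).
  by rewrite properE subsetUl; apply/subsetPn; exists y; rewrite // inE yK orbT.
have overlap : 0 < #|S :&: K| <= k.
  rewrite -cardK subset_leq_card ?subsetIr // andbT.
  by apply/card_gt0P; exists x; rewrite inE xS.
have -> : #|S :|: K| - #|S| = k - #|S :&: K|.
  by have := cardsUI S K; rewrite cardK; have := subset_leq_card (subsetUl S K); lia.
have disj : [disjoint arcs G S & offdiag K :\: offdiag (S :&: K)].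
  rewrite disjoint_subset; apply/subsetP => p; rewrite !inE => /and3P [-> -> _].
  by case: (p.1 \in K) (p.2 \in K) (p.1 != p.2) => [] [] [].
apply: (@leq_trans #|arcs G S :|: (offdiag K :\: offdiag (S :&: K))|).
  rewrite cardsU (disjoint_setI0 disj) cards0 subn0 leq_add2l.
  rewrite cardsD (setIidPr (offdiag_subset (subsetIr S K))) !card_offdiag cardK.
  exact: new_pairs_lower_bound.
apply: subset_leq_card; rewrite subUset; apply/andP; split.
  by apply/subsetP => p; rewrite !inE => /and3P [-> -> ->].
by apply: subset_trans (subsetDl _ _) _; apply: kclique_arcs; rewrite ?subsetUr.
Qed.

Lemma arcs_lower_bound (S : {set V}) : S != set0 ->
  #|arcs G S| + (#|V| - #|S|) * k <= #|arcs G setT|.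
Proof.
have [m] := ubnP (#|V| - #|S|); elim: m S => // m IH S lt_m S0.
have [->|ST] := eqVneq S setT; first by rewrite cardsT subnn mul0n addn0.
have [S' SS' le_arcs] := arcs_extend S0 ST.
have ltS := proper_card SS'; have leS' : #|S'| <= #|V| := max_card _.
have S'0 : S' != set0 by rewrite -card_gt0; lia.
apply: leq_trans (IH S' _ S'0); last by lia.
have -> : #|V| - #|S| = (#|S'| - #|S|) + (#|V| - #|S'|) by lia.
by rewrite mulnDl addnA leq_add2r.
Qed.

Hypothesis few_arcs : #|arcs G setT| <= #|V|.-1 * k.

Lemma arcs_upper_bound (S : {set V}) : S != set0 -> #|arcs G S| <= #|S|.-1 * k.
Proof.
move=> S0; have := arcs_lower_bound S0; move: S0; rewrite -card_gt0 => S0.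
have leS : #|S| <= #|V| := max_card _.
have e : #|V|.-1 = (#|V| - #|S|) + #|S|.-1 by lia.
by move: few_arcs; rewrite e mulnDl; lia.
Qed.

Lemma card_arcs : 0 < #|V| -> #|arcs G setT| = #|V|.-1 * k.
Proof.
case/card_gt0P=> x _; apply/eqP; rewrite eqn_leq few_arcs /=.
have S0 : [set x] != set0 by apply/set0Pn; exists x; rewrite inE.
have := arcs_lower_bound S0; rewrite cards1 subn1.
exact: leq_trans (leq_addl _ _).
Qed.

Lemma kcliques_eq K K' x y : K \in kcliques G k -> K' \in kcliques G k ->
  x != y -> x \in K -> y \in K -> x \in K' -> y \in K' -> K = K'.
Proof.
move=> cliqueK cliqueK' xy xK yK xK' yK'.
have cardK := kclique_card cliqueK; have cardK' := kclique_card cliqueK'.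
have cardI2 : 1 < #|K :&: K'|.
  have := cards2 x y; rewrite xy => <-; apply: subset_leq_card; apply/subsetP => z.
  by rewrite !inE => /orP [] /eqP ->; apply/andP.
have cardIk : #|K :&: K'| <= k by rewrite -cardK subset_leq_card // subsetIl.
have U0 : K :|: K' != set0 by apply/set0Pn; exists x; rewrite inE xK.
have sub : offdiag K :|: offdiag K' \subset arcs G (K :|: K').
  by rewrite subUset !kclique_arcs // ?subsetUl ?subsetUr.
have le_arcs := leq_trans (subset_leq_card sub) (arcs_upper_bound U0).
have eqI : #|K :&: K'| = k.
  apply/eqP; rewrite eqn_leq cardIk leqNgt; apply/negP => ltIk.
  have := @overlapping_pairs_lower_bound k #|K :&: K'|; rewrite cardI2 ltIk => /(_ isT).
  rewrite ltnNge => /negP; apply; move: le_arcs.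
  by rewrite cardsU -offdiagI cardsU !card_offdiag cardK cardK' mul2n addnn.
have eq_inter (A : {set V}) : #|A| = k -> K :&: K' \subset A -> K :&: K' = A.
  by move=> cardA sub_A; apply/eqP; rewrite eqEcard sub_A cardA eqI /=.
by rewrite -(eq_inter K cardK (subsetIl K K')) -[RHS](eq_inter K' cardK' (subsetIr K K')).
Qed.

Definition edge_clique (x y : V) : {set V} :=
  odflt set0 [pick K in kcliques G k | (x \in K) && (y \in K)].

Lemma edge_cliqueP x y : G x y ->
  [/\ edge_clique x y \in kcliques G k, x \in edge_clique x y & y \in edge_clique x y].
Proof.
move=> Gxy; rewrite /edge_clique; case: pickP => [K /and3P [] //|none].
by have [K [cliqueK xK yK]] := G_covered Gxy; have := none K; rewrite cliqueK xK yK.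
Qed.

Lemma edge_clique_uniq K x y : G x y -> K \in kcliques G k -> x \in K -> y \in K ->
  edge_clique x y = K.
Proof.
move=> Gxy cliqueK xK yK; have [cliqueE xE yE] := edge_cliqueP Gxy.
have xy : x != y by apply: contraTneq Gxy => ->; rewrite G_irr.
exact: kcliques_eq cliqueE cliqueK xy xE yE xK yK.
Qed.

Lemma card_kcliques : 0 < #|V| -> #|kcliques G k| * k.-1 = #|V|.-1.
Proof.
move=> V_gt0; have total := card_arcs V_gt0.
suff : #|arcs G setT| = #|kcliques G k| * (k * k.-1).
  by rewrite total mulnCA mulnC => /eqP; rewrite eqn_pmul2l // => /eqP.
rewrite -sum1_card (partition_big (fun p => edge_clique p.1 p.2) [in kcliques G k]) /=; last first.
  by move=> -[x y]; rewrite inE => /and3P [_ _ /edge_cliqueP []].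
rewrite -sum_nat_const; apply: eq_bigr => K cliqueK.
rewrite -(kclique_card cliqueK) -card_offdiag sum1_card.
apply: eq_card => -[x y]; rewrite [RHS]inE unfold_in /= inE /= !in_setT /=.
apply/andP/and3P => [[Gxy /eqP <-]|[xK yK xy]].
  by have [_ -> ->] := edge_cliqueP Gxy; split=> //; apply: contraTneq Gxy => ->; rewrite G_irr.
have Gxy := kclique_adj cliqueK xK yK xy; split=> //.
by apply/eqP; apply: edge_clique_uniq.
Qed.

End CliqueCover.

(** * Clique completion of spiders and bin packing *)

Definition packable (I : finType) (a : I -> nat) (B : nat) : Prop :=
  exists (T : finType) (bin : I -> T), forall q, \sum_(q' | bin q' == bin q) a q' = B.

Lemma packable_reindex (I J : finType) (h : J -> I) (a : I -> nat) (a' : J -> nat) B :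
  bijective h -> (forall q, a' q = a (h q)) -> packable a' B <-> packable a B.
Proof.
move=> bij_h a'E; have [h' hK h'K] := bij_h; split=> -[T [bin full]].
  exists T, (bin \o h') => q; rewrite -(full (h' q)) (reindex h) /=; last exact: onW_bij.
  by apply: eq_big => [x|x _]; rewrite ?hK ?a'E.
exists T, (bin \o h) => q; rewrite -(full (h q)) [RHS](reindex h) /=; last exact: onW_bij.
by apply: eq_bigr => x _; rewrite a'E.
Qed.

Lemma packable_leq (I : finType) (a : I -> nat) B (q : I) : packable a B -> B <= \sum_i a i.
Proof.
by case=> T [bin full]; rewrite -(full q) [leqRHS](bigID (fun i => bin i == bin q)) leq_addr.
Qed.

Definition ordered_pairs n (r : rel 'I_n) : {set 'I_n * 'I_n} :=
  [set p : 'I_n * 'I_n | (val p.1 < val p.2) && r p.1 p.2].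

Lemma card_ordered_pairs n (r : rel 'I_n) : symmetric r -> irreflexive r ->
  2 * #|ordered_pairs r| = #|[set p | r p.1 p.2]|.
Proof.
move=> r_sym r_irr; set R := [set p | r p.1 p.2].
pose lt := [set p : 'I_n * 'I_n | val p.1 < val p.2].
have swap_inj : injective (fun p : 'I_n * 'I_n => (p.2, p.1)) by move=> [x y] [x' y'] [-> ->].
have -> : ordered_pairs r = R :&: lt by apply/setP => p; rewrite !inE andbC.
suff eqD : #|R :\: lt| = #|R :&: lt| by rewrite -(cardsID lt R) eqD mul2n addnn.
rewrite -(card_imset _ swap_inj); apply: eq_card => -[x y]; rewrite !inE /=.
apply/imsetP/idP => [[[x' y'] /setDP [] /[!inE] /= rxy] | /andP [rxy ltxy]].
  rewrite -leqNgt => le [-> ->]; rewrite r_sym rxy /= ltn_neqAle le andbT.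
  by apply: contraTneq rxy => /val_inj ->; rewrite r_irr.
by exists (y, x) => //; rewrite !inE /= -leqNgt r_sym rxy ltnW.
Qed.

Lemma k1_cover_covered n (G : rel 'I_n) k : has_k1_cover G k -> covered_by_kcliques G k.
Proof.
move=> cover x y /cover [K [cardK xK yK cliqueK]]; exists K; split=> //.
rewrite inE cardK eqxx; apply/subsetP => p; rewrite !inE => /and3P [p1K p2K ne].
exact: cliqueK.
Qed.

Lemma add_edges_sym n (adj : rel 'I_n) F : symmetric adj -> symmetric (add_edges adj F).
Proof. by move=> adj_sym x y; rewrite /add_edges adj_sym [X in _ || X]orbC. Qed.

Section Spider.
Variables (a : nat -> nat) (Q B : nat).

Definition leg_start (q : nat) := \sum_(j < q) a j.

Definition leg_edges (q : nat) : seq (nat * nat) :=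
  [seq ((if s == 0 then 0 else leg_start q + s), (leg_start q + s).+1) | s <- iota 0 (a q)].

(* Vertex 0 is the center, and leg [q] consists of [leg_start q + 1, ..., leg_start q.+1]. *)
Definition spider_edges : seq (nat * nat) := flatten [seq leg_edges q | q <- iota 0 Q].

Let N := leg_start Q.
Local Notation E := spider_edges.
Local Notation V := 'I_N.+1.
Local Notation adj := (@eadj N.+1 E).

Lemma leg_startS q : leg_start q.+1 = leg_start q + a q.
Proof. by rewrite /leg_start big_ord_recr. Qed.

Lemma leg_start_leq q q' : q <= q' -> leg_start q <= leg_start q'.
Proof. by move=> /subnK <-; elim: (q' - q) => // d IH; rewrite addSn leg_startS; lia. Qed.

Definition leg_of (v : nat) := find (fun q => v <= leg_start q.+1) (iota 0 Q).

Lemma leg_ofP v : 0 < v <= N ->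
  leg_of v < Q /\ leg_start (leg_of v) < v <= leg_start (leg_of v).+1.
Proof.
move=> /andP [v0 vN]; pose p q := v <= leg_start q.+1.
have Q_gt0 : 0 < Q.
  by rewrite lt0n; apply: contraTneq vN => Q0; rewrite /N Q0 /leg_start big_ord0 -ltnNge.
have p_some : has p (iota 0 Q).
  by apply/hasP; exists Q.-1; [rewrite mem_iota; lia | rewrite /p prednK].
have lt : leg_of v < Q by rewrite -[Q in _ < Q](size_iota 0) -has_find.
have := nth_find 0 p_some; rewrite -/(leg_of v) nth_iota // add0n /p => le; split=> //.
rewrite le andbT; case e: (leg_of v) => [|l]; first by rewrite /leg_start big_ord0.
rewrite ltnNge; apply/negP => le_v.
have : l < find p (iota 0 Q) by rewrite -/(leg_of v) e.
by move/(before_find 0); rewrite nth_iota ?add0n /p ?le_v //; lia.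
Qed.

Lemma leg_of_eq v q : q < Q -> leg_start q < v <= leg_start q.+1 -> leg_of v = q.
Proof.
move=> qQ v_ok; have vN : 0 < v <= N by have := @leg_start_leq q.+1 Q; rewrite /N; lia.
have [lQ l_ok] := leg_ofP vN.
by case: (ltngtP (leg_of v) q) => // c; have := leg_start_leq c; lia.
Qed.

Definition parent (v : nat) := if v == (leg_start (leg_of v)).+1 then 0 else v.-1.

Lemma parent_lt v : 0 < v -> parent v < v.
Proof. by rewrite /parent; case: ifP; lia. Qed.

Lemma parentP v : 0 < v <= N ->
  (parent v = 0 /\ v = (leg_start (leg_of v)).+1) \/
  [/\ parent v = v.-1, 1 < v & leg_of v.-1 = leg_of v].
Proof.
move=> v_ok; have [lQ l_ok] := leg_ofP v_ok; rewrite /parent; case: eqP => e; [by left | right].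
by split=> //; [lia | apply: leg_of_eq => //; lia].
Qed.

Lemma mem_spider_edges x y : ((x, y) \in E) = (0 < y <= N) && (x == parent y).
Proof.
apply/flattenP/andP.
  case=> _ /mapP [q /[!mem_iota] qQ ->] /mapP [s /[!mem_iota] sa [-> ->]].
  have el : leg_of (leg_start q + s).+1 = q by apply: leg_of_eq; rewrite ?leg_startS; lia.
  have := @leg_start_leq q.+1 Q; rewrite leg_startS -/N => le; split; first by lia.
  by rewrite /parent el; case: (s =P 0) => [->|s0]; [rewrite addn0 eqxx | rewrite ifF //=; lia].
case=> y_ok /eqP ->; have [lQ l_ok] := leg_ofP y_ok; rewrite leg_startS in l_ok.
exists (leg_edges (leg_of y)); first by apply/mapP; exists (leg_of y) => //; rewrite mem_iota.
apply/mapP; exists (y - (leg_start (leg_of y)).+1); first by rewrite mem_iota; lia.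
rewrite /parent; congr (_, _); last by lia.
by case: eqP => e1; case: eqP => e2 //; lia.
Qed.

Lemma wf_spider_edges : wf_edges N.+1 E.
Proof.
apply/allP => -[x y]; rewrite mem_spider_edges /= => /andP [y_ok /eqP ->].
by have := @parent_lt y; lia.
Qed.

Lemma spider_adjE (x y : V) :
  adj x y = ((0 < y) && (x == parent y :> nat)) || ((0 < x) && (y == parent x :> nat)).
Proof.
rewrite /eadj !mem_spider_edges.
have := ltn_ord x; have := ltn_ord y; rewrite !ltnS => -> ->; rewrite !andbT.
case: (eqVneq x y) => //= -> ; case: posnP => //= y0.
by have := parent_lt y0; case: eqP; lia.
Qed.

Lemma spider_adj_sym : symmetric adj.
Proof. by move=> x y; rewrite !spider_adjE orbC. Qed.

Lemma spider_adj_irr : irreflexive adj.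
Proof. by move=> x; rewrite /eadj eqxx. Qed.

Lemma vertex_range (v : V) : 0 < v -> 0 < v <= N.
Proof. by move=> v0; rewrite v0 -ltnS ltn_ord. Qed.

Definition parent_vertex (v : V) : V := inord (parent v).

Lemma val_parent_vertex v : parent_vertex v = parent v :> nat.
Proof.
rewrite /parent_vertex /= inordK //; case: (posnP v) => [e|v0]; first by rewrite /parent e.
by have := parent_lt v0; have := ltn_ord v; lia.
Qed.

Lemma adj_parent (v : V) : 0 < v -> adj (parent_vertex v) v.
Proof. by move=> v0; rewrite spider_adjE v0 val_parent_vertex eqxx. Qed.

Lemma connect_center (v : V) : connect adj v ord0.
Proof.
have [m le] := ubnP (nat_of_ord v); elim: m v le => // m IH v lt.
case: (posnP v) => [e|v0]; first by have -> : v = ord0 by apply: val_inj.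
have up : adj v (parent_vertex v) by rewrite spider_adj_sym adj_parent.
apply: connect_trans (connect1 up) (IH _ _); rewrite val_parent_vertex.
exact: leq_trans (parent_lt v0) lt.
Qed.

Lemma spider_connected : connected_graph adj.
Proof.
move=> x y; apply: connect_trans (connect_center x) _.
by rewrite sym_connect_sym ?connect_center //; apply: spider_adj_sym.
Qed.

Lemma card_nonzero : #|[set v : V | 0 < v]| = N.
Proof.
have -> : [set v : V | 0 < v] = setT :\ ord0 by apply/setP => v; rewrite !inE andbT lt0n.
by have /eqP := cardsD1 ord0 [set: V]; rewrite inE cardsT card_ord add1n eqSS eq_sym => /eqP.
Qed.

Lemma card_spider_edges : #|edge_set adj| = N.
Proof.
have -> : edge_set adj = [set (parent_vertex v, v) | v in [set v : V | 0 < v]].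
  apply/setP => -[x y]; rewrite inE /= spider_adjE; apply/andP/imsetP.
    case=> ltxy /orP [/andP [y0 /eqP e]|/andP [x0 /eqP e]].
      by exists y; rewrite ?inE //; congr (_, _); apply: val_inj; rewrite /= val_parent_vertex.
    by have := parent_lt x0; rewrite -e ltnNge (ltnW ltxy).
  case=> v; rewrite inE => v0 [-> ->].
  by split; [rewrite /= val_parent_vertex parent_lt | rewrite v0 val_parent_vertex eqxx].
by rewrite card_imset ?card_nonzero // => x y [].
Qed.

Lemma degree_leq2 (v : V) : 0 < v -> degree adj v <= 2.
Proof.
move=> v0; apply: (@leq_trans #|[set parent_vertex v; inord v.+1]|); last first.
  by rewrite cards2; case: eqP.
apply: subset_leq_card; apply/subsetP => y; rewrite !inE spider_adjE v0 /=.
case/orP=> [/andP [y0 /eqP e]|/eqP e]; last first.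
  by rewrite -val_parent_vertex in e; rewrite (val_inj e) eqxx.
have [[e1 _]|[e1 y1 _]] := parentP (vertex_range y0); first by rewrite e1 in e; lia.
apply/orP; right; apply/eqP; apply: val_inj => /=; rewrite inordK; first by lia.
by have := ltn_ord y; lia.
Qed.

Hypothesis a_gt0 : forall q, q < Q -> 0 < a q.

Lemma leg_firstP q : q < Q ->
  [/\ (leg_start q).+1 <= N, leg_of (leg_start q).+1 = q & parent (leg_start q).+1 = 0].
Proof.
move=> qQ; have aq := a_gt0 qQ.
have el : leg_of (leg_start q).+1 = q by apply: leg_of_eq; rewrite ?leg_startS; lia.
have := @leg_start_leq q.+1 Q; rewrite leg_startS -/N => le; split=> //; first by lia.
by rewrite /parent el eqxx.
Qed.

Lemma degree_center : Q <= degree adj ord0.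
Proof.
have ltN (q : 'I_Q) : (leg_start q).+1 < N.+1 by have [] := leg_firstP (ltn_ord q).
have -> : Q = #|[set Ordinal (ltN q) | q in 'I_Q]|.
  rewrite card_imset ?card_ord // => q q' /(congr1 val) /= e; apply: val_inj => /=.
  by have [_ <- _] := leg_firstP (ltn_ord q); have [_ <- _] := leg_firstP (ltn_ord q'); rewrite e.
apply: subset_leq_card; apply/subsetP => y /imsetP [q _ ->]; rewrite inE spider_adjE /=.
by have [_ _ ->] := leg_firstP (ltn_ord q).
Qed.

Hypothesis Q_ge3 : 2 < Q.

Lemma is_spider_edges : is_spider adj.
Proof.
split; first by split=> //; split; [exact: spider_connected | rewrite card_spider_edges].
have -> : [set x | 2 < degree adj x] = [set ord0]; last by rewrite cards1.
apply/setP => x; rewrite !inE; apply/idP/eqP => [|->]; last exact: leq_trans Q_ge3 degree_center.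
case: (posnP x) => [e _|x0]; first exact: val_inj.
by rewrite ltnNge degree_leq2.
Qed.

Definition vertex_leg (v : V) : 'I_Q := insubd (Ordinal (ltnW (ltnW Q_ge3))) (leg_of v).

Lemma val_vertex_leg (v : V) : 0 < v -> vertex_leg v = leg_of v :> nat.
Proof.
by move=> /vertex_range /leg_ofP [lQ _]; rewrite /vertex_leg -[LHS]/(val _) val_insubd lQ.
Qed.

Lemma card_leg (q : 'I_Q) : #|[set v : V | (0 < v) && (vertex_leg v == q)]| = a q.
Proof.
have le : leg_start q + a q <= N by rewrite -leg_startS; apply: leg_start_leq.
have ltN (s : 'I_(a q)) : (leg_start q + s).+1 < N.+1 by have := ltn_ord s; lia.
have -> : [set v : V | (0 < v) && (vertex_leg v == q)] = [set Ordinal (ltN s) | s in 'I_(a q)].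
  apply/setP => v; rewrite inE; apply/andP/imsetP.
    case=> v0 /eqP e; have [_] := leg_ofP (vertex_range v0).
    rewrite -val_vertex_leg // e leg_startS => l_ok.
    have lt_s : v - (leg_start q).+1 < a q by lia.
    by exists (Ordinal lt_s) => //; apply: val_inj => /=; lia.
  case=> s _ ->; split=> //=; rewrite -val_eqE /= val_vertex_leg //; apply/eqP.
  apply: leg_of_eq => //;  rewrite /= leg_startS; have := ltn_ord s; lia.
by rewrite card_imset ?card_ord // => s s' /(congr1 val) /= e; apply: val_inj => /=; lia.
Qed.

Lemma card_legs (P : pred 'I_Q) :
  #|[set v : V | (0 < v) && P (vertex_leg v)]| = \sum_(q | P q) a q.
Proof.
rewrite -sum1_card (partition_big vertex_leg P) /=; last by move=> v; rewrite inE => /andP [].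
apply: eq_bigr => q Pq; rewrite sum1_card -(card_leg q); apply: eq_card => v.
by rewrite !inE unfold_in /= inE; case: eqP => [->|]; rewrite ?andbF // Pq !andbT.
Qed.

Hypothesis a_leB : forall q, q < Q -> a q <= B.

Lemma bin_size_gt0 : 0 < B.
Proof. exact: leq_trans (a_gt0 (ltnW (ltnW Q_ge3))) (a_leB (ltnW (ltnW Q_ge3))). Qed.

Lemma mul_bin_sizeS : N * B.+1 = 2 * N + N * B.-1.
Proof. by rewrite -{1}(prednK bin_size_gt0) !mulnS addnA mul2n addnn. Qed.

Section CompletionToPacking.
Variable F : {set V * V}.
Hypotheses (F_new : forall p, p \in F -> (val p.1 < val p.2) && ~~ adj p.1 p.2).
Hypothesis F_small : 2 * #|F| <= N * B.-1.
Hypothesis F_cover : has_k1_cover (add_edges adj F) B.+1.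

Let G := add_edges adj F.

Let G_irr : irreflexive G.
Proof.
move=> x; rewrite /G /add_edges spider_adj_irr /= orbb; apply/negP => /F_new.
by rewrite /= ltnn.
Qed.

Let G_connected x y : connect G x y.
Proof.
apply: connect_sub (spider_connected x y) => u v uv.
by apply: connect1; rewrite /G /add_edges uv.
Qed.

Let G_covered : covered_by_kcliques G B.+1 := k1_cover_covered F_cover.

Let G_few_arcs : #|arcs G setT| <= #|V|.-1 * B.+1.
Proof.
have -> : arcs G setT = [set p | G p.1 p.2] by apply/setP => p; rewrite !inE.
rewrite -(card_ordered_pairs (add_edges_sym F spider_adj_sym) G_irr) card_ord.
have le : #|ordered_pairs G| <= N + #|F|.
  apply: (@leq_trans #|edge_set adj :|: F|); last by rewrite cardsU card_spider_edges leq_subr.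
  apply: subset_leq_card; apply/subsetP => -[x y]; rewrite !inE /= => /andP [lt].
  by case/or3P=> [->|->|/F_new /=]; rewrite ?lt ?orbT //; lia.
apply: leq_trans (leq_mul (leqnn 2) le) _.
by rewrite mul_bin_sizeS mulnDr leq_add2l.
Qed.

Let V_gt0 : 0 < #|V|. Proof. by rewrite card_ord. Qed.

Local Notation cliques := (kcliques G B.+1).

Definition up_clique (v : V) : {set V} := edge_clique G B.+1 (parent_vertex v) v.

Lemma up_cliqueP (v : V) : 0 < v ->
  [/\ up_clique v \in cliques, parent_vertex v \in up_clique v & v \in up_clique v].
Proof.
by move=> v0; apply: (edge_cliqueP G_covered); rewrite /G /add_edges adj_parent.
Qed.

Definition up_members (K : {set V}) : {set V} := [set v : V | (0 < v) && (up_clique v == K)].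

(* The least vertex of a clique is the only one whose edge to its parent may lie outside. *)
Lemma up_members_subset K : K \in cliques -> exists2 m, m \in K & up_members K \subset K :\ m.
Proof.
move=> cliqueK; have /card_gt0P [x xK] : 0 < #|K| by rewrite (kclique_card cliqueK).
case: (@arg_minnP _ x [in K] val xK) => m mK least_m; exists m => //.
apply/subsetP => v; rewrite !inE => /andP [v0 /eqP e]; have [_ pv vv] := up_cliqueP v0.
rewrite e in pv vv; rewrite vv andbT; apply: contraTneq v0 => e'.
have := least_m _ pv; rewrite /= val_parent_vertex -e' leqNgt.
by case: posnP => // v0; rewrite parent_lt.
Qed.

Lemma card_up_members_leq K : K \in cliques -> #|up_members K| <= B.
Proof.
move=> cliqueK; have [m mK /subset_leq_card] := up_members_subset cliqueK.
by have := cardsD1 m K; rewrite mK (kclique_card cliqueK) add1n => -[->].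
Qed.

Lemma card_up_members K : K \in cliques -> #|up_members K| = B.
Proof.
have total : \sum_(K' in cliques) #|up_members K'| = N.
  rewrite -[RHS]card_nonzero -[RHS]sum1_card.
  rewrite (partition_big up_clique [in cliques]) /=; last first.
    by move=> v; rewrite inE => /up_cliqueP [].
  apply: eq_bigr => K' _; rewrite sum1_card; apply: eq_card => v.
  by rewrite !inE unfold_in /= inE.
have num := card_kcliques G_irr (ltn0Sn B) G_connected G_covered G_few_arcs V_gt0.
rewrite card_ord /= in num.
move=> cliqueK; apply/eqP; rewrite eqn_leq card_up_members_leq //= leqNgt; apply/negP => lt.
suff : N < N by rewrite ltnn.
rewrite -{1}total -[X in _ < X]num -sum_nat_const (bigD1 K) //= [X in _ < X](bigD1 K) //= -addSn.
by apply: leq_add => //; apply: leq_sum => K' /andP [cliqueK' _]; apply: card_up_members_leq.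
Qed.

(* A clique avoiding the center would lie in a single leg, which has at most [B] vertices. *)
Lemma center_in_clique K : K \in cliques -> ord0 \in K.
Proof.
move=> cliqueK; have [m mK sub] := up_members_subset cliqueK; apply: contraT => center_NK.
have cardK := kclique_card cliqueK.
have up_eq : up_members K = K :\ m.
  apply/eqP; rewrite eqEcard sub (card_up_members cliqueK) /=.
  by have := cardsD1 m K; rewrite mK cardK add1n => -[->].
have nonzero (v : V) : v \in K -> 0 < v.
  move=> vK; rewrite lt0n; apply: contraNneq center_NK => e.
  by have <- : v = ord0 by apply: val_inj.
have same_leg (v : V) : v \in K -> leg_of v = leg_of m.
  have [b lb] := ubnP (nat_of_ord v); elim: b v lb => // b IH v lb vK.
  have [->//|vm] := eqVneq v m.
  have : v \in up_members K by rewrite up_eq !inE vm.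
  rewrite inE => /andP [v0 /eqP e]; have [_ pv _] := up_cliqueP v0; rewrite e in pv.
  have [[p0 _]|[p1 v1 <-]] := parentP (vertex_range v0).
    by have := nonzero _ pv; rewrite val_parent_vertex p0.
  have := IH (parent_vertex v); rewrite val_parent_vertex p1; apply=> //.
  by move: lb v0; rewrite /=; case: (nat_of_ord v).
have sub_leg : K \subset [set v : V | (0 < v) && (vertex_leg v == vertex_leg m)].
  apply/subsetP => v vK; rewrite inE nonzero //= -val_eqE /=.
  by rewrite !val_vertex_leg ?nonzero //= same_leg.
have := subset_leq_card sub_leg; rewrite card_leg cardK.
by have := a_leB (ltn_ord (vertex_leg m)); lia.
Qed.

Definition first_clique (q : 'I_Q) : {set V} := up_clique (inord (leg_start q).+1).

Lemma up_clique_leg (v : V) : 0 < v -> up_clique v = first_clique (vertex_leg v).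
Proof.
have [b lb] := ubnP (nat_of_ord v); elim: b v lb => // b IH v lb v0.
rewrite /first_clique val_vertex_leg //.
have [[_ e]|[p1 v1 el]] := parentP (vertex_range v0).
  by congr up_clique; apply: val_inj => /=; rewrite inordK -e.
have p0 : 0 < parent_vertex v by rewrite val_parent_vertex p1; lia.
have [clique_v pv _] := up_cliqueP v0; have [clique_p _ pp] := up_cliqueP p0.
have -> : up_clique v = up_clique (parent_vertex v).
  apply: (kcliques_eq (ltn0Sn B) G_connected G_covered G_few_arcs clique_v clique_p
            (x := ord0) (y := parent_vertex v)) => //; try exact: center_in_clique.
  by apply: contraTneq p0 => <-.
rewrite IH //; first by rewrite /first_clique val_vertex_leg // val_parent_vertex p1 el.
by rewrite val_parent_vertex p1; lia.
Qed.

Lemma packable_of_completion : packable (fun q : 'I_Q => a q) B.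
Proof.
exists {set V}, first_clique => q.
have [le _ _] := leg_firstP (ltn_ord q).
have q0 : 0 < (inord (leg_start q).+1 : V) by rewrite inordK.
have [clique_q _ _] := up_cliqueP q0; rewrite -(card_up_members clique_q) -card_legs.
apply: eq_card => v; rewrite !inE; case: posnP => //= v0.
by rewrite -up_clique_leg.
Qed.

End CompletionToPacking.

Section PackingToCompletion.
Variables (T : finType) (bin : 'I_Q -> T).
Hypothesis bin_full : forall q, \sum_(q' | bin q' == bin q) a q' = B.

Let vbin (v : V) : T := bin (vertex_leg v).

Definition joined (x y : V) : bool :=
  (x != y) && [|| x == ord0, y == ord0 | vbin x == vbin y].

Lemma joined_sym : symmetric joined.
Proof. by move=> x y; rewrite /joined [x == y]eq_sym orbCA [vbin x == _]eq_sym. Qed.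

Lemma joined_irr : irreflexive joined.
Proof. by move=> x; rewrite /joined eqxx. Qed.

Lemma spider_adj_joined x y : adj x y -> joined x y.
Proof.
have up (u v : V) : 0 < v -> u = parent v :> nat -> joined u v.
  move=> v0 e; rewrite /joined -!val_eqE /= e neq_ltn parent_lt //=.
  have [[-> _] //|[p1 v1 el]] := parentP (vertex_range v0).
  have u0 : 0 < u by lia.
  suff -> : vbin u = vbin v by rewrite eqxx !orbT.
  by congr bin; apply: val_inj; rewrite /= !val_vertex_leg // e p1.
rewrite spider_adjE => /orP [] /andP [p /eqP e]; first exact: up.
by rewrite joined_sym; apply: up.
Qed.

Lemma card_bin (v : V) : #|[set y : V | (0 < y) && (vbin y == vbin v)]| = B.
Proof. by rewrite -(bin_full (vertex_leg v)) -card_legs. Qed.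

Lemma card_joined : #|[set p | joined p.1 p.2]| = N * B.+1.
Proof.
rewrite card_rel (bigD1 ord0) //=.
have -> : #|[set y : V | joined ord0 y]| = N.
  rewrite -[RHS]card_nonzero; apply: eq_card => y; rewrite !inE /joined eqxx andbT eq_sym.
  by rewrite lt0n.
rewrite mulnS; congr (_ + _).
have -> : N * B = \sum_(x in [set v : V | 0 < v]) B by rewrite sum_nat_const card_nonzero.
apply: eq_big => [x|x x0]; first by rewrite inE lt0n.
have -> : [set y | joined x y] = ord0 |: ([set y : V | (0 < y) && (vbin y == vbin x)] :\ x).
  apply/setP => y; rewrite !inE /joined (negbTE x0) /= [x == y]eq_sym [vbin x == _]eq_sym.
  rewrite lt0n -[(y : nat) == 0]/(y == ord0).
  by have [->|_] := eqVneq y ord0; rewrite //= eq_sym x0.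
rewrite cardsU1 -(card_bin x) [RHS](cardsD1 x) !inE eqxx andbF lt0n x0.
by congr (_ + _); rewrite eqxx.
Qed.

Let F : {set V * V} := ordered_pairs joined :\: edge_set adj.

Lemma card_completion : #|F| = (N * B.-1)./2.
Proof.
have sub : edge_set adj \subset ordered_pairs joined.
  by apply/subsetP => p; rewrite !inE => /andP [-> /spider_adj_joined ->].
have := card_ordered_pairs joined_sym joined_irr; rewrite card_joined.
rewrite /F cardsD (setIidPr sub) card_spider_edges.
have := subset_leq_card sub; rewrite card_spider_edges mul_bin_sizeS.
by move: #|_| (N * B.-1) => x y; lia.
Qed.

Lemma add_edges_joined x y : add_edges adj F x y = joined x y.
Proof.
rewrite /add_edges !inE /= [adj y x]spider_adj_sym [joined y x]joined_sym.
have := @spider_adj_joined x y; case: (adj x y) => [->//|_]; rewrite ?andbF //=.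
by rewrite -andb_orl -neq_ltn; case: eqP => // /val_inj ->; rewrite joined_irr.
Qed.

Lemma completion_of_packing : has_completion_set adj B.+1 (N * B.-1)./2.
Proof.
exists F; split; [| exact: card_completion |].
  by move=> p; rewrite !inE => /andP [+ /andP [lt _]]; rewrite lt.
move=> x y; rewrite add_edges_joined => jxy.
pose z := if x == ord0 then y else x.
exists [set v : V | (v == ord0) || (vbin v == vbin z)]; split.
- have -> : [set v : V | (v == ord0) || (vbin v == vbin z)] =
      ord0 |: [set v : V | (0 < v) && (vbin v == vbin z)].
    by apply/setP => v; rewrite !inE -val_eqE /=; case: posnP.
  by rewrite cardsU1 inE /= add1n card_bin.
- by rewrite inE /z; case: (x =P ord0) => //= _; rewrite eqxx.
- rewrite inE /z; case: (x =P ord0) => [_|/eqP x0]; first by rewrite eqxx orbT.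
  by move: jxy; rewrite /joined (negbTE x0) /= [vbin y == _]eq_sym => /andP [].
- move=> u v; rewrite !inE add_edges_joined /joined => u_in v_in -> /=.
  case/orP: u_in => [->//|/eqP ->]; case/orP: v_in => [->|/eqP ->]; first by rewrite orbT.
  by rewrite eqxx !orbT.
Qed.

End PackingToCompletion.

Theorem spider_completion_packable :
  has_completion_set adj B.+1 (N * B.-1)./2 <-> packable (fun q : 'I_Q => a q) B.
Proof.
split; last by case=> T [bin full]; apply: completion_of_packing full.
case=> F [F_new cardF cover]; apply: (packable_of_completion F_new _ cover).
by rewrite cardF mul2n -{2}[N * B.-1]odd_double_half leq_addl.
Qed.

End Spider.

(** * From numbers to vectors *)

Lemma digits_lt W q (v : 'I_q -> nat) : (forall j, v j < W) -> \sum_(j < q) v j * W ^ j < W ^ q.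
Proof.
elim: q v => [|q IH] v ltW; first by rewrite big_ord0.
rewrite big_ord_recr /= expnS.
have lt_low := IH (fun j => v (widen_ord (leqnSn q) j)) (fun _ => ltW _).
have lt_top : (v ord_max).+1 * W ^ q <= W * W ^ q by rewrite leq_mul2r ltW orbT.
by apply: leq_trans lt_top; rewrite mulSn ltn_add2r.
Qed.

Lemma digits_inj W q (u v : 'I_q -> nat) : (forall j, u j < W) -> (forall j, v j < W) ->
  \sum_(j < q) u j * W ^ j = \sum_(j < q) v j * W ^ j -> u =1 v.
Proof.
elim: q u v => [|q IH] u v ltu ltv e j; first by case: j.
pose low (f : 'I_q.+1 -> nat) i := f (widen_ord (leqnSn q) i).
move: e; rewrite !big_ord_recr /= => e.
have lt_u : \sum_(i < q) low u i * W ^ i < W ^ q by apply: digits_lt => i; apply: ltu.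
have lt_v : \sum_(i < q) low v i * W ^ i < W ^ q by apply: digits_lt => i; apply: ltv.
have W_gt0 : 0 < W ^ q by apply: leq_ltn_trans lt_u.
have top : u ord_max = v ord_max.
  have := congr1 (divn^~ (W ^ q)) e.
  by rewrite ![_ + _ * _]addnC !divnMDl // !divn_small // !addn0.
have [i ->|->] := unliftP ord_max j; last exact: top.
have -> : lift ord_max i = widen_ord (leqnSn q) i.
  by apply: val_inj; rewrite /= /bump leqNgt ltn_ord.
by apply: (IH (low u) (low v)) => [k|k|]; rewrite ?ltu ?ltv //; move: e; rewrite top => /addIn.
Qed.

Section Positional.
Variables (J : finType) (W : nat).

Definition positional (v : J -> nat) : nat := \sum_j v j * W ^ enum_rank j.

Lemma positional_ord v : positional v = \sum_(i < #|J|) v (enum_val i) * W ^ i.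
Proof.
rewrite /positional (reindex _ (onW_bij _ (enum_val_bij J))).
by apply: eq_bigr => i _; rewrite enum_valK.
Qed.

Lemma positional_lt v : (forall j, v j < W) -> positional v < W ^ #|J|.
Proof. by move=> ltW; rewrite positional_ord; apply: digits_lt => i; apply: ltW. Qed.

Lemma positional_inj u v : (forall j, u j < W) -> (forall j, v j < W) ->
  positional u = positional v -> u =1 v.
Proof.
move=> ltu ltv; rewrite !positional_ord => e j; rewrite -[j]enum_rankK.
by apply: (digits_inj (u := u \o enum_val) (v := v \o enum_val) _ _ e) => i /=.
Qed.

Lemma positional_sum (I : finType) (P : pred I) (D : I -> J -> nat) :
  \sum_(x | P x) positional (D x) = positional (fun j => \sum_(x | P x) D x j).
Proof.
by rewrite /positional exchange_big /=; apply: eq_bigr => j _; rewrite big_distrl.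
Qed.

(* The count is written above all digits, so that it never overflows. *)
Definition counted_number (count : nat) (v : J -> nat) : nat := count * W ^ #|J| + positional v.

Lemma counted_number_sum (I : finType) (P : pred I) (count : I -> nat) (D : I -> J -> nat) :
  \sum_(x | P x) counted_number (count x) (D x) =
  counted_number (\sum_(x | P x) count x) (fun j => \sum_(x | P x) D x j).
Proof. by rewrite /counted_number big_split /= positional_sum big_distrl. Qed.

Lemma counted_number_gt0 count v : 0 < W -> 0 < count -> 0 < counted_number count v.
Proof. by move=> W0 c0; rewrite addn_gt0 muln_gt0 c0 expn_gt0 W0. Qed.

Lemma counted_number_ltn count n u v : (forall j, u j < W) -> count < n ->
  counted_number count u < counted_number n v.
Proof.
move=> ltu lt_n; apply: (@leq_trans (count.+1 * W ^ #|J|)).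
  by rewrite /counted_number mulSn addnC ltn_add2r positional_lt.
by apply: leq_trans (leq_addr _ _); rewrite leq_mul2r lt_n orbT.
Qed.

Lemma counted_number_inj m n u v : (forall j, u j < W) -> (forall j, v j < W) ->
  counted_number m u = counted_number n v -> m = n /\ u =1 v.
Proof.
move=> ltu ltv e; case: (ltngtP m n) => [lt|lt|eq_mn].
- by have := counted_number_ltn v ltu lt; rewrite e ltnn.
- by have := counted_number_ltn u ltv lt; rewrite e ltnn.
- by split=> //; move: e; rewrite /counted_number eq_mn => /addnI; apply: positional_inj.
Qed.

End Positional.

Definition vector_packable (I J : finType) (count : I -> nat) (D : I -> J -> nat)
    (n : nat) (b : J -> nat) : Prop :=
  exists (T : finType) (bin : I -> T), forall q,
    \sum_(x | bin x == bin q) count x = n /\ (forall j, \sum_(x | bin x == bin q) D x j = b j).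

Definition digit_base (n M : nat) : nat := (n.+1 * M).+1.

Section VectorPacking.
Variables (I J : finType) (count : I -> nat) (D : I -> J -> nat) (n : nat) (b : J -> nat) (M : nat).
Hypotheses (count_gt0 : forall x, 0 < count x).
Hypotheses (D_leq : forall x j, D x j <= M) (b_leq : forall j, b j <= M).

Local Notation W := (digit_base n M).
Local Notation number := (@counted_number J W).

Lemma vector_packableP :
  packable (fun x => number (count x) (D x)) (number n b) <-> vector_packable count D n b.
Proof.
have W_gt : M < W by rewrite /digit_base ltnS mulSn leq_addr.
have ltb j : b j < W by apply: leq_ltn_trans (b_leq j) W_gt.
split=> -[T [bin full]]; exists T, bin => q; last first.
  have [eqn eqb] := full q; rewrite counted_number_sum eqn; congr (_ + _).
  by apply: eq_bigr => j _; rewrite eqb.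
have := full q; rewrite counted_number_sum => e.
suff lt_sum j : \sum_(x | bin x == bin q) D x j < W by case: (counted_number_inj lt_sum ltb e).
have le_n : \sum_(x | bin x == bin q) count x <= n.
  rewrite leqNgt; apply/negP => lt; move/eqP: e; apply/negP.
  by rewrite gtn_eqF // counted_number_ltn.
rewrite ltnS; apply: (@leq_trans (n * M)); last by rewrite leq_mul2r leqnSn orbT.
apply: (@leq_trans (\sum_(x | bin x == bin q) count x * M)); last first.
  by rewrite -big_distrl leq_mul2r le_n orbT.
apply: leq_sum => x _; apply: leq_trans (D_leq x j) _.
by rewrite leq_pmull.
Qed.

End VectorPacking.

(** * From vectors to matchings *)

Section Matching.
Variables (leader elem class : finType).
Variables (expects : leader -> class -> option nat).
Variables (class_of : elem -> class) (id_of : elem -> nat).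
Variables (quota : leader -> nat) (charge : elem -> nat).

Definition matching (f : elem -> leader) : Prop :=
  [/\ forall e, expects (f e) (class_of e) = Some (id_of e),
      forall l k, expects l k -> exists2 e, f e = l & class_of e = k,
      forall e e', f e = f e' -> class_of e = class_of e' -> e = e' &
      forall l, \sum_(e | f e == l) charge e = quota l].

End Matching.

Section MatchingDigits.
Variables (class : finType) (max_id max_quota : nat).

(* Digit [None] adds up charges; digits [Some (k, false)] and [Some (k, true)] count the
   elements of class [k] and add up their identifiers. *)
Definition leader_digit (expected : class -> option nat) (quota : nat)
    (j : option (class * bool)) : nat :=
  match j with
  | None => max_quota - quota
  | Some (k, false) => ~~ isSome (expected k)
  | Some (k, true) => max_id - odflt 0 (expected k)
  end.

Definition elem_digit (class_e : class) (id charge : nat) (j : option (class * bool)) : nat :=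
  match j with
  | None => charge
  | Some (k, is_id) => if k == class_e then (if is_id then id else 1) else 0
  end.

Definition bin_digit (j : option (class * bool)) : nat :=
  match j with None => max_quota | Some (_, false) => 1 | Some (_, true) => max_id end.

(* Elements count for one, so a bin without a leader would need [bin_count] elements but has
   room for one per class, and two leaders do not fit. *)
Definition leader_count (expected : class -> option nat) : nat :=
  4 * #|class| - \sum_k isSome (expected k).

Definition bin_count : nat := 4 * #|class|.

Definition matching_base : nat := digit_base bin_count (max_id + max_quota).+1.

Definition leader_weight (expected : class -> option nat) (quota : nat) : nat :=
  counted_number matching_base (leader_count expected) (leader_digit expected quota).

Definition elem_weight (class_e : class) (id charge : nat) : nat :=
  counted_number matching_base 1 (elem_digit class_e id charge).

Definition bin_capacity : nat := counted_number matching_base bin_count bin_digit.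

Lemma sum_expected_leq (expected : class -> option nat) : \sum_k isSome (expected k) <= #|class|.
Proof. by rewrite -sum1_card; apply: leq_sum => k _; case: isSome. Qed.

Lemma leader_digit_leq expected quota j : leader_digit expected quota j <= (max_id + max_quota).+1.
Proof. by case: j => [[k []]|] /=; [lia | case: isSome; lia | lia]. Qed.

Lemma elem_digit_leq class_e id charge j : id <= max_id -> charge <= max_quota ->
  elem_digit class_e id charge j <= (max_id + max_quota).+1.
Proof. by case: j => [[k []]|] /=; try case: eqP; lia. Qed.

Lemma bin_digit_leq j : bin_digit j <= (max_id + max_quota).+1.
Proof. by case: j => [[k []]|] /=; lia. Qed.

Lemma ltn_matching_base m : m <= (max_id + max_quota).+1 -> m < matching_base.
Proof. by move=> le; rewrite /matching_base /digit_base ltnS mulSn; lia. Qed.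

Lemma elem_weight_gt0 class_e id charge : 0 < elem_weight class_e id charge.
Proof. exact: counted_number_gt0. Qed.

Lemma elem_weight_leq class_e id charge : id <= max_id -> charge <= max_quota ->
  elem_weight class_e id charge <= bin_capacity.
Proof.
move=> le_id le_charge; apply/ltnW/counted_number_ltn => [j|].
  exact/ltn_matching_base/elem_digit_leq.
have : 0 < #|class| by apply/card_gt0P; exists class_e.
by rewrite /bin_count; lia.
Qed.

Lemma leader_count_gt0 expected : 0 < #|class| -> 0 < leader_count expected.
Proof. by have := sum_expected_leq expected; rewrite /leader_count; lia. Qed.

Lemma leader_weight_gt0 expected quota : 0 < #|class| -> 0 < leader_weight expected quota.
Proof. by move=> c0; apply: counted_number_gt0 => //; apply: leader_count_gt0. Qed.

Lemma leader_weight_leq (expected : class -> option nat) quota k : expected k ->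
  leader_weight expected quota <= bin_capacity.
Proof.
move=> exp_k; apply/ltnW/counted_number_ltn => [j|].
  exact/ltn_matching_base/leader_digit_leq.
have := sum_expected_leq expected; rewrite /leader_count /bin_count (bigD1 k) //= exp_k.
by lia.
Qed.

End MatchingDigits.

Section MatchingPacking.
Variables (leader elem class : finType).
Variables (expects : leader -> class -> option nat).
Variables (class_of : elem -> class) (id_of : elem -> nat).
Variables (quota : leader -> nat) (charge : elem -> nat) (max_id max_quota : nat).
Hypotheses (class_gt0 : 0 < #|class|) (expects_leq : forall l k, odflt 0 (expects l k) <= max_id).
Hypotheses (id_leq : forall e, id_of e <= max_id) (quota_leq : forall l, quota l <= max_quota).
Hypothesis charge_leq : forall e, charge e <= max_quota.

Definition item_count (x : leader + elem) : nat :=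
  match x with inl l => leader_count (expects l) | inr _ => 1 end.

Definition item_digit (x : leader + elem) : option (class * bool) -> nat :=
  match x with
  | inl l => leader_digit max_id max_quota (expects l) (quota l)
  | inr e => elem_digit (class_of e) (id_of e) (charge e)
  end.

Definition item_weight (x : leader + elem) : nat :=
  match x with
  | inl l => leader_weight max_id max_quota (expects l) (quota l)
  | inr e => elem_weight max_id max_quota (class_of e) (id_of e) (charge e)
  end.

Local Notation is_matching := (matching expects class_of id_of quota charge).
Local Notation packing :=
  (vector_packable item_count item_digit (bin_count class) (@bin_digit class max_id max_quota)).

Lemma item_packable_vector :
  packable item_weight (bin_capacity class max_id max_quota) <-> packing.
Proof.
rewrite -(@vector_packableP _ _ _ _ _ _ (max_id + max_quota).+1).
- by split=> -[T [bin full]]; exists T, bin => q; rewrite -[RHS](full q); apply: eq_bigr => -[].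
- by move=> [l|e] //=; apply: leader_count_gt0.
- by move=> [l|e] j; [apply: leader_digit_leq | apply: elem_digit_leq].
- exact: bin_digit_leq.
Qed.

Section BinsToMatching.
Variables (T : finType) (bin : leader + elem -> T).
Hypothesis bin_full : forall q, \sum_(x | bin x == bin q) item_count x = bin_count class /\
  (forall j, \sum_(x | bin x == bin q) item_digit x j = bin_digit max_id max_quota j).

Lemma leader_exists q : exists l, bin (inl l) = bin q.
Proof.
have [/existsP [l /eqP e]|none] := boolP [exists l, bin (inl l) == bin q]; first by exists l.
have no_leader (F : leader -> nat) : \sum_(l | bin (inl l) == bin q) F l = 0.
  by rewrite big1 // => l e; case/existsP: none; exists l.
have [count digits] := bin_full q; rewrite big_sumType no_leader /= in count.
have : \sum_(k : class) \sum_(e | bin (inr e) == bin q) elem_digit (class_of e) (id_of e) (charge e)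
    (Some (k, false)) = #|class|.
  rewrite (eq_bigr (fun=> 1)) ?sum1_card // => k _.
  by have := digits (Some (k, false)); rewrite big_sumType no_leader.
rewrite exchange_big /= (eq_bigr (fun=> 1)) => [|e _]; last by rewrite -big_mkcond big_pred1_eq.
rewrite add0n in count; rewrite count /bin_count => /eqP.
by rewrite -[X in _ == X]mul1n eqn_pmul2r.
Qed.

Lemma leader_uniq l l' : bin (inl l) = bin (inl l') -> l = l'.
Proof.
move=> e; apply/eqP; apply: contraT => ne.
have [count _] := bin_full (inl l'); move: count; rewrite big_sumType /=.
rewrite (bigD1 l) /=; last by rewrite e.
rewrite (bigD1 l') /=; last by rewrite eqxx eq_sym.
have ge x : 3 * #|class| <= leader_count (expects x).
  by have := sum_expected_leq (expects x); rewrite /leader_count; lia.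
by have := ge l; have := ge l'; rewrite /bin_count; lia.
Qed.

Variable f : elem -> leader.
Hypothesis bin_f : forall e, bin (inl (f e)) = bin (inr e).

Lemma bin_eq_leader e l : (bin (inr e) == bin (inl l)) = (f e == l).
Proof. by rewrite -bin_f; apply/eqP/eqP => [/leader_uniq|->]. Qed.

Lemma leader_digit_sum l j : leader_digit max_id max_quota (expects l) (quota l) j +
  \sum_(e | f e == l) elem_digit (class_of e) (id_of e) (charge e) j = bin_digit max_id max_quota j.
Proof.
have [_ digits] := bin_full (inl l); rewrite -(digits j) big_sumType /=; congr (_ + _).
  by rewrite (big_pred1 l) // => x; apply/eqP/eqP => [/leader_uniq|->].
by apply: eq_bigl => e; rewrite bin_eq_leader.
Qed.

Lemma class_count l k : \sum_(e | f e == l) (k == class_of e) = isSome (expects l k) :> nat.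
Proof.
have := leader_digit_sum l (Some (k, false)); rewrite /=.
rewrite (eq_bigr (fun e => nat_of_bool (k == class_of e))) => [|e _]; last by case: eqP.
by case: isSome; lia.
Qed.

Lemma class_id_sum l k :
  \sum_(e | f e == l) (if k == class_of e then id_of e else 0) = odflt 0 (expects l k).
Proof.
by have := leader_digit_sum l (Some (k, true)); have := expects_leq l k; rewrite /=; lia.
Qed.

Lemma class_inj e e' : f e = f e' -> class_of e = class_of e' -> e = e'.
Proof.
move=> eq_f eq_class; apply/eqP; apply: contraT => ne.
have := class_count (f e') (class_of e').
rewrite (bigD1 e) /=; last by rewrite eq_f.
rewrite (bigD1 e') /=; last by rewrite eqxx eq_sym.
by rewrite eq_class eqxx; case: isSome; lia.
Qed.

Lemma expects_id e : expects (f e) (class_of e) = Some (id_of e).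
Proof.
have := class_count (f e) (class_of e); have := class_id_sum (f e) (class_of e).
rewrite (bigD1 e) //= eqxx big1 ?addn0 => [|e' /andP [/eqP eq_f ne]]; last first.
  by case: eqP => // eq_class; case/eqP: ne; apply: class_inj.
by move=> id_e; rewrite (bigD1 e) //= eqxx; case: expects id_e => //= x ->.
Qed.

Lemma class_exists l k : expects l k -> exists2 e, f e = l & class_of e = k.
Proof.
move=> exp_lk; have := class_count l k; rewrite exp_lk.
have [/existsP [e /andP [/eqP fe /eqP ke]] _|none] :=
  boolP [exists e, (f e == l) && (k == class_of e)]; first by exists e.
rewrite big1 // => e fe; case: eqP => // ke; case/existsP: none.
by exists e; rewrite fe ke eqxx.
Qed.

Lemma is_matching_of_bins : is_matching f.
Proof.
split; [exact: expects_id | exact: class_exists | exact: class_inj |] => l.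
by have := leader_digit_sum l None; have := quota_leq l; rewrite /=; lia.
Qed.

End BinsToMatching.

Section MatchingToBins.
Variable f : elem -> leader.
Hypothesis f_matching : is_matching f.

Lemma matching_class_sum l k (F : elem -> nat) (c : nat) :
  (forall e, expects l k = Some (id_of e) -> F e = c) ->
  \sum_(e | f e == l) (if k == class_of e then F e else 0) = if expects l k then c else 0.
Proof.
have [exp_id exp_ex f_inj _] := f_matching => F_c.
case exp_lk: (expects l k) => [x|] /=; last first.
  rewrite big1 // => e /eqP fe; case: eqP => // ke.
  by have := exp_id e; rewrite fe -ke exp_lk.
have [|e fe ke] := exp_ex l k; first by rewrite exp_lk.
rewrite (bigD1 e) /=; last by rewrite fe.
rewrite ke eqxx F_c ?big1 ?addn0 // => [e' /andP [/eqP fe' ne]|].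
  by case: eqP => // ke'; case/eqP: ne; apply: f_inj; rewrite ?fe ?ke.
by rewrite -fe -ke exp_id.
Qed.

Lemma matching_digit_sum l j : leader_digit max_id max_quota (expects l) (quota l) j +
  \sum_(e | f e == l) elem_digit (class_of e) (id_of e) (charge e) j = bin_digit max_id max_quota j.
Proof.
have [_ _ _ charges] := f_matching; have le_q := quota_leq l.
case: j => [[k []]|] /=; last by rewrite charges subnK.
- rewrite (matching_class_sum (c := odflt 0 (expects l k))) => [|e -> //].
  by have := expects_leq l k; case: expects => [x|] /=; lia.
- by rewrite (matching_class_sum (F := fun=> 1) (c := 1)) //; case: isSome.
Qed.

Lemma matching_count l :
  leader_count (expects l) + \sum_(e | f e == l) 1 = bin_count class.
Proof.
have -> : \sum_(e | f e == l) 1 = \sum_k isSome (expects l k).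
  rewrite (eq_bigr (fun e => \sum_k (if k == class_of e then 1 else 0))) => [|e _]; last first.
    by rewrite -big_mkcond big_pred1_eq.
  rewrite exchange_big /=; apply: eq_bigr => k _.
  by rewrite (matching_class_sum (F := fun=> 1) (c := 1)).
by have := sum_expected_leq (expects l); rewrite /leader_count /bin_count; lia.
Qed.

Lemma packing_of_matching : packing.
Proof.
exists leader, (fun x => match x with inl l => l | inr e => f e end) => q.
set l := (match q with inl l => l | inr e => f e end).
split=> [|j]; rewrite big_sumType /= big_pred1_eq; first exact: matching_count.
exact: matching_digit_sum.
Qed.

End MatchingToBins.

Theorem packable_matching :
  packable item_weight (bin_capacity class max_id max_quota) <-> exists f, is_matching f.
Proof.
rewrite item_packable_vector; split=> [[T [bin full]]|[f f_matching]]; last first.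
  exact: packing_of_matching f_matching.
have [f bin_f] := fin_all_exists (fun e => leader_exists full (inr e)).
by exists f; apply: is_matching_of_bins full _ bin_f.
Qed.

End MatchingPacking.

(** * From matchings to tilings *)

Lemma tperm_eql (T : finType) (x y z : T) : (tperm x y z == x) = (z == y).
Proof. by rewrite -(inj_eq (@perm_inj _ (tperm x y))) tpermK tpermL. Qed.

(* [L] cells are joined by one edge per cell [i] and direction [d], from [i] to the cell
   [step d] further on in cyclic order; [shown d s i t] is the colour that the tile [t], put on
   cell [i], shows on its outgoing ([s = false]) or incoming ([s = true]) edge of direction [d]. *)
Section CyclicTiling.
Variables (L : nat) (dir tile colour : finType) (step : dir -> nat).
Variable shown : dir -> bool -> nat -> tile -> colour.
Hypothesis L_gt0 : 0 < L.

Definition edge_end (d : dir) (s : bool) (i : nat) : nat := if s then (i + step d) %% L else i.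

Lemma edge_end_lt d s (i : 'I_L) : edge_end d s i < L.
Proof. by case: s; rewrite /= ?ltn_pmod. Qed.

Definition edge_cell (d : dir) (s : bool) (i : 'I_L) : 'I_L := Ordinal (edge_end_lt d s i).

Lemma edge_cell_inj d s : injective (edge_cell d s).
Proof.
move=> i i' /(congr1 val) /=; case: s => /= [/eqP|]; last exact: val_inj.
by rewrite eqn_modDr !modn_small // => /eqP /val_inj.
Qed.

Definition edge_from (d : dir) (s : bool) : 'I_L -> 'I_L := finv (edge_cell d s).

Definition cyclic_tiling (tau : 'I_L -> tile) : Prop := forall d (i : 'I_L),
  shown d false i (tau i) = shown d true (edge_cell d true i) (tau (edge_cell d true i)).

Lemma cyclic_tiling_edge tau d s (i : 'I_L) : cyclic_tiling tau ->
  shown d s (edge_cell d s i) (tau (edge_cell d s i)) = shown d false i (tau i).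
Proof.
move=> tiling; case: s; first by rewrite tiling.
by have -> : edge_cell d false i = i by apply: val_inj.
Qed.

(* A tile bin [inl t] of a cell expects a cell switch and one element for each edge of the cell; an
   edge bin [inr (d, c)] expects an edge switch and the two elements of colour [c].  The element
   [inr (d, c, Some s)] is actual and [inl (t, Some (d, s))] a dummy.  The charges force a tile
   bin with the switch of the fixed tile [t0] to be all-actual, hence to be the tile of its cell,
   and an edge bin whose switch is not that of the fixed colour [c0] to be all-actual too. *)
Variables (t0 : tile) (c0 : colour).

Definition leader_kind : finType := (tile + dir * colour)%type.
Definition elem_kind : finType := (tile * option (dir * bool) + dir * colour * option bool)%type.
Definition edge_side : finType := option (dir * bool).
Definition token : finType := (option dir + colour)%type.

Definition token_id (i : nat) (x : token) : nat := i * #|token| + enum_rank x.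

Definition kind_expects (i : nat) (l : leader_kind) (k : edge_side) : option nat :=
  match l, k with
  | inl t, None => Some (token_id i (inl None))
  | inl t, Some (d, s) => Some (token_id i (inr (shown d s i t)))
  | inr (d, c), None => Some (token_id i (inl (Some d)))
  | inr (d, c), Some (d', s) =>
      if d' == d then Some (token_id (edge_end d s i) (inr c)) else None
  end.

Definition kind_class (e : elem_kind) : edge_side :=
  match e with
  | inl (_, k) => k
  | inr (d, _, o) => omap (pair d) o
  end.

Definition kind_id (i : nat) (e : elem_kind) : nat :=
  token_id i match e with
  | inl (_, None) => inl None
  | inl (t, Some (d, s)) => inr (shown d s i t)
  | inr (d, _, None) => inl (Some d)
  | inr (_, c, Some _) => inr c
  end.

Definition kind_quota (l : leader_kind) : nat := if l is inl _ then #|{: dir * bool}| else 2.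

Definition kind_charge (e : elem_kind) : nat :=
  match e with
  | inl (t, None) => if t == t0 then #|{: dir * bool}| else 0
  | inl (_, Some _) => 1
  | inr (_, c, None) => if c == c0 then 0 else 2
  | inr (_, _, Some _) => 0
  end.

Definition max_token_id : nat := L * #|token|.
Definition max_kind_quota : nat := #|{: dir * bool}| + 2.

Definition kind_weight (i : nat) (g : leader_kind + elem_kind) : nat :=
  match g with
  | inl l => leader_weight max_token_id max_kind_quota (kind_expects i l) (kind_quota l)
  | inr e => elem_weight max_token_id max_kind_quota (kind_class e) (kind_id i e) (kind_charge e)
  end.

Definition tiling_capacity : nat := bin_capacity edge_side max_token_id max_kind_quota.

Lemma token_id_leq (i : 'I_L) x : token_id i x <= max_token_id.
Proof.
apply: (@leq_trans ((i : nat).+1 * #|token|)); last by rewrite leq_mul2r ltn_ord orbT.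
by rewrite /token_id mulSnr leq_add2l ltnW.
Qed.

Lemma token_id_inj (i i' : 'I_L) x x' : token_id i x = token_id i' x' -> i = i' /\ x = x'.
Proof.
move=> e; have token_gt0 : 0 < #|token| by apply/card_gt0P; exists x.
have ei : i = i' :> nat.
  have := congr1 (divn^~ #|token|) e.
  by rewrite /token_id !divnMDl // !divn_small ?ltn_ord // !addn0.
split; first exact: val_inj.
by move: e; rewrite /token_id ei => /addnI /val_inj /enum_rank_inj.
Qed.

Lemma kind_expects_leq (i : 'I_L) l k : odflt 0 (kind_expects i l k) <= max_token_id.
Proof.
case: l k => [t|[d c]] [[d' s]|] /=; try exact: token_id_leq.
by case: eqP => //= _; apply: (token_id_leq (edge_cell d s i)).
Qed.

Lemma kind_id_leq (i : 'I_L) e : kind_id i e <= max_token_id.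
Proof. exact: token_id_leq. Qed.

Lemma kind_quota_leq l : kind_quota l <= max_kind_quota.
Proof. by rewrite /max_kind_quota; case: l => x /=; rewrite ?leq_addr ?leq_addl. Qed.

Lemma kind_charge_leq e : kind_charge e <= max_kind_quota.
Proof.
rewrite /max_kind_quota; case: e => [[t [ds|]]|[[d c] [s|]]] //=; last by case: eqP; lia.
  by rewrite addn2.
by case: eqP => // _; apply: leq_addr.
Qed.

Lemma edge_side_gt0 : 0 < #|edge_side|.
Proof. by apply/card_gt0P; exists None. Qed.

Lemma kind_weight_gt0 i g : 0 < kind_weight i g.
Proof.
case: g => [l|e]; first exact: leader_weight_gt0 edge_side_gt0.
exact: elem_weight_gt0.
Qed.

Lemma kind_weight_leq (i : 'I_L) g : kind_weight i g <= tiling_capacity.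
Proof.
case: g => [l|e]; last exact: elem_weight_leq (kind_id_leq i e) (kind_charge_leq e).
by apply: (@leader_weight_leq _ _ _ _ _ None); case: l => [t|[d c]].
Qed.

Definition tile_leader : finType := ('I_L * leader_kind)%type.
Definition tile_elem : finType := ('I_L * elem_kind)%type.

Definition tile_matching : (tile_elem -> tile_leader) -> Prop :=
  matching (fun (l : tile_leader) k => kind_expects l.1 l.2 k)
    (fun e : tile_elem => kind_class e.2)
    (fun e => kind_id e.1 e.2) (fun l => kind_quota l.2) (fun e => kind_charge e.2).

Definition at_cell (x : 'I_L * (leader_kind + elem_kind)) : tile_leader + tile_elem :=
  match x with (i, inl l) => inl (i, l) | (i, inr e) => inr (i, e) end.

Lemma kind_weight_at_cell (x : 'I_L * (leader_kind + elem_kind)) : kind_weight x.1 x.2 =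
  item_weight (fun (l : tile_leader) k => kind_expects l.1 l.2 k)
    (fun e : tile_elem => kind_class e.2)
    (fun e => kind_id e.1 e.2) (fun l => kind_quota l.2) (fun e => kind_charge e.2)
    max_token_id max_kind_quota (at_cell x).
Proof. by case: x => i []. Qed.

Lemma at_cell_bij : bijective at_cell.
Proof.
exists (fun y => match y with inl (i, l) => (i, inl l) | inr (i, e) => (i, inr e) end).
  by case=> i [].
by case=> [[]|[]].
Qed.

Lemma packable_tile_matching :
  packable (fun x : 'I_L * (leader_kind + elem_kind) => kind_weight x.1 x.2) tiling_capacity <->
  exists f, tile_matching f.
Proof.
rewrite (packable_reindex _ at_cell_bij kind_weight_at_cell); apply: packable_matching.
- exact: edge_side_gt0.
- by move=> l k; apply: kind_expects_leq.
- by move=> e; apply: kind_id_leq.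
- by move=> l; apply: kind_quota_leq.
- by move=> e; apply: kind_charge_leq.
Qed.

Section MatchingToTiling.
Variable f : tile_elem -> tile_leader.
Hypothesis f_matching : tile_matching f.

Lemma cell_switch_bin i : exists t, f (i, inl (t0, None)) = (i, inl t).
Proof.
have [exp_id _ _ _] := f_matching; have := exp_id (i, inl (t0, None)); rewrite /= /kind_id.
by case: (f _) => i' [t|[d c]] /= [/token_id_inj [-> //]]; exists t.
Qed.

Lemma edge_switch_bin d i : exists c, f (i, inr (d, c0, None)) = (i, inr (d, c)).
Proof.
have [exp_id _ _ _] := f_matching; have := exp_id (i, inr (d, c0, None)); rewrite /= /kind_id.
case: (f _) => i' [t|[d' c]] /= [/token_id_inj [-> //]].
by case=> ->; exists c.
Qed.

Lemma charge_full_bin e e' : f e = f e' -> e != e' -> kind_charge e.2 = kind_quota (f e).2 ->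
  kind_charge e'.2 = 0.
Proof.
have [_ _ _ charges] := f_matching => fe ne full; have := charges (f e).
rewrite (bigD1 e) //= (bigD1 e') /=; last by rewrite fe eqxx eq_sym.
move/eqP; rewrite full -[X in _ == X]addn0 eqn_add2l addn_eq0.
by case/andP=> /eqP.
Qed.

Lemma actual_elem sw d s (i' : 'I_L) c : kind_class sw.2 = None ->
  kind_charge sw.2 = kind_quota (f sw).2 ->
  kind_expects (f sw).1 (f sw).2 (Some (d, s)) = Some (token_id i' (inr c)) ->
  f (i', inr (d, c, Some s)) = f sw.
Proof.
have [exp_id exp_ex _ _] := f_matching => sw_class sw_full sw_exp.
have [|e fe e_class] := exp_ex (f sw) (Some (d, s)); first by rewrite sw_exp.
have ne : sw != e by apply: contra_eqN e_class => /eqP <-; rewrite sw_class.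
have uncharged := charge_full_bin (esym fe) ne sw_full.
have := exp_id e; rewrite e_class fe sw_exp /kind_id.
case: e fe e_class {ne} uncharged => j [[t [ds|]]|[[d' c'] [s'|]]] //= fe [ed es] _.
by case=> /token_id_inj [-> [->]]; rewrite -fe ed es.
Qed.

Lemma tiling_of_matching : exists tau, cyclic_tiling tau.
Proof.
have [exp_id exp_ex f_inj _] := f_matching.
have [tau tau_bin] := fin_all_exists cell_switch_bin.
exists tau => d i; have [c c_bin] := edge_switch_bin d i.
have tile_takes (i' : 'I_L) s : f (i', inr (d, shown d s i' (tau i'), Some s)) = (i', inl (tau i')).
  rewrite -tau_bin; apply: actual_elem; rewrite ?tau_bin //=.
  by rewrite eqxx.
have edge_takes c' s : c' != c -> f (edge_cell d s i, inr (d, c', Some s)) = (i, inr (d, c')).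
  move=> nc; have [[j sw] fsw sw_class] := exp_ex (i, inr (d, c')) None isT.
  rewrite -fsw; apply: actual_elem => //; rewrite fsw /= ?eqxx //.
  have := exp_id (j, sw); rewrite fsw [(j, sw).2]/= sw_class /kind_id /=.
  case: sw fsw sw_class => [[t [ds|]]|[[d' c''] [s'|]]] //= fsw _ [/token_id_inj [ei]] // [ed].
  case: eqP => // e0; move: fsw; rewrite e0 -ed -ei c_bin => -[e1].
  by rewrite e1 eqxx in nc.
have shows_c s : shown d s (edge_cell d s i) (tau (edge_cell d s i)) = c.
  by apply/eqP; apply: contraT => nc; have := edge_takes _ s nc; rewrite tile_takes.
have edge_out : edge_cell d false i = i by apply: val_inj.
by have := shows_c false; rewrite edge_out shows_c.
Qed.

End MatchingToTiling.

Section TilingToMatching.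
Variable tau : 'I_L -> tile.
Hypothesis tau_tiling : cyclic_tiling tau.

Definition tiling_bin (e : tile_elem) : tile_leader :=
  match e with
  | (i, inl (t, None)) => (i, inl (tperm t0 (tau i) t))
  | (i, inl (t, Some (d, s))) =>
      if t == tau i then (edge_from d s i, inr (d, shown d s i t)) else (i, inl t)
  | (i, inr (d, c, None)) => (i, inr (d, tperm c0 (shown d false i (tau i)) c))
  | (i, inr (d, c, Some s)) =>
      if c == shown d s i (tau i) then (i, inl (tau i)) else (edge_from d s i, inr (d, c))
  end.

Definition tiling_member (l : tile_leader) (k : edge_side) : tile_elem :=
  match l, k with
  | (i, inl t), None => (i, inl (tperm t0 (tau i) t, None))
  | (i, inl t), Some (d, s) =>
      (i, if t == tau i then inr (d, shown d s i t, Some s) else inl (t, Some (d, s)))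
  | (i, inr (d, c)), None => (i, inr (d, tperm c0 (shown d false i (tau i)) c, None))
  | (i, inr (d, c)), Some (_, s) =>
      let i' := edge_cell d s i in
      (i', if c == shown d s i' (tau i') then inl (tau i', Some (d, s)) else inr (d, c, Some s))
  end.

Lemma edge_cellK d s : cancel (edge_cell d s) (edge_from d s).
Proof. exact: finv_f (@edge_cell_inj d s). Qed.

Lemma edge_fromK d s : cancel (edge_from d s) (edge_cell d s).
Proof. exact: f_finv (@edge_cell_inj d s). Qed.

Lemma edge_end_from d s (i : 'I_L) : edge_end d s (edge_from d s i) = i.
Proof. by have := congr1 val (edge_fromK d s i). Qed.

Lemma tiling_bin_expects (e : tile_elem) :
  kind_expects (tiling_bin e).1 (tiling_bin e).2 (kind_class e.2) = Some (kind_id e.1 e.2).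
Proof.
case: e => i [[t [[d s]|]]|[[d c] [s|]]] //=.
  by case: eqP => [->|_] /=; rewrite ?eqxx ?edge_end_from.
by case: eqP => [->|_] /=; rewrite ?eqxx ?edge_end_from.
Qed.

Lemma tiling_memberK (e : tile_elem) : tiling_member (tiling_bin e) (kind_class e.2) = e.
Proof.
case: e => i [[t [[d s]|]]|[[d c] [s|]]] /=; rewrite ?tpermK //.
  have [->|/negbTE ne] := eqVneq t (tau i); last by rewrite /= !ne.
  by rewrite /= ?eqxx /= edge_fromK edge_end_from eqxx.
have [->|/negbTE ne] := eqVneq c (shown d s i (tau i)); first by rewrite /= !eqxx.
by rewrite /= edge_fromK edge_end_from ne.
Qed.

Lemma tiling_binK (l : tile_leader) k : kind_expects l.1 l.2 k ->
  tiling_bin (tiling_member l k) = l /\ kind_class (tiling_member l k).2 = k.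
Proof.
case: l k => i [t|[d c]] [[d' s]|] /=; rewrite ?tpermK //.
  by move=> _; have [->|/negbTE ne] := eqVneq t (tau i); rewrite /= ?eqxx ?ne.
have [-> _|//] := eqVneq d' d.
by case: eqP => [->|/eqP/negbTE ne]; rewrite /= ?eqxx ?ne edge_cellK.
Qed.

Lemma tiling_charge_sum (l : tile_leader) :
  \sum_(e | tiling_bin e == l) kind_charge e.2 =
  \sum_(k | isSome (kind_expects l.1 l.2 k)) kind_charge (tiling_member l k).2.
Proof.
rewrite (reindex_onto (tiling_member l) (fun e => kind_class e.2)) => [|e /eqP <-].
  apply: eq_bigl => k; apply/andP/idP => [[/eqP e_bin /eqP e_class]|/tiling_binK [-> ->]].
    by have := tiling_bin_expects (tiling_member l k); rewrite e_bin e_class => ->.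
  by rewrite !eqxx.
exact: tiling_memberK.
Qed.

Lemma tile_bin_charge i t :
  \sum_(e | tiling_bin e == (i, inl t)) kind_charge e.2 = #|{: dir * bool}|.
Proof.
rewrite tiling_charge_sum /= (bigD1 None) //=; have [->|ne] := eqVneq t (tau i).
  by rewrite tperm_eql eqxx big1 ?addn0 // => -[[d s]|].
rewrite tperm_eql (negbTE ne) add0n (eq_bigr (fun=> 1)) => [|[[d s]|] //].
rewrite (eq_bigl (predC1 None)) => [|[[d s]|] //].
by rewrite sum1_card cardC1 card_option.
Qed.

Lemma edge_bin_charge i d c :
  \sum_(e | tiling_bin e == (i, inr (d, c))) kind_charge e.2 = 2.
Proof.
rewrite tiling_charge_sum /= (bigD1 None) //=.
have shown_end s := cyclic_tiling_edge d s i tau_tiling.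
have [->|ne] := eqVneq c (shown d false i (tau i)).
  rewrite tperm_eql eqxx add0n (eq_bigr (fun=> 1)) => [|[[d' s]|] /andP [_ ne] //]; last first.
    by rewrite /= shown_end eqxx.
  have <- : #|[set Some (d, true); Some (d, false)]| = 2.
    by rewrite cards2 (inj_eq Some_inj) xpair_eqE eqxx.
  rewrite sum1_card; apply: eq_card => -[[d' s]|].
    by rewrite !inE unfold_in /= !(inj_eq Some_inj) !xpair_eqE; case: (d' == d); case: s.
  by rewrite !inE unfold_in.
rewrite tperm_eql (negbTE ne) big1 // => -[[d' s]|] /andP [_ ] //= _.
by rewrite shown_end (negbTE ne).
Qed.

Lemma matching_of_tiling : tile_matching tiling_bin.
Proof.
split=> [e|l k exp_lk|e e' eq_bin eq_class|[i [t|[d c]]]].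
- exact: tiling_bin_expects.
- by have [] := tiling_binK exp_lk; exists (tiling_member l k).
- by rewrite -(tiling_memberK e) -(tiling_memberK e') eq_bin eq_class.
- exact: tile_bin_charge.
- exact: edge_bin_charge.
Qed.

End TilingToMatching.

Theorem packable_tiling :
  packable (fun x : 'I_L * (leader_kind + elem_kind) => kind_weight x.1 x.2) tiling_capacity <->
  exists tau, cyclic_tiling tau.
Proof.
rewrite packable_tile_matching; split=> [[f f_matching]|[tau tau_tiling]].
  exact: tiling_of_matching f_matching.
by exists (tiling_bin tau); apply: matching_of_tiling.
Qed.

End CyclicTiling.

(** * Computation tableaux *)

Section Rows.
Variable M : TM.

Definition state : finType := 'I_(tm_n M).+1.
Definition cell : finType := (option bool * option state)%type.
Definition blank : cell := (None, None).

(* A configuration is placed on a one-way infinite row of cells, with the head on cell [h]. *)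
Definition symbol_at (c : config M) (h x : nat) : option bool :=
  if x < h then nth None (c_left c) (h - x).-1
  else if x == h then c_head c else nth None (c_right c) (x - h).-1.

Definition cell_at (c : config M) (h x : nat) : cell :=
  (symbol_at c h x, if x == h then Some (c_state c) else None).

Definition transition (q : state) (s : option bool) : state * option bool * dir :=
  if q == tm_halt M then (q, s, DStay) else tm_delta q s.

Definition head_move (c : config M) (h : nat) : nat :=
  match (transition (c_state c) (c_head c)).2 with DLeft => h.-1 | DRight => h.+1 | DStay => h end.

Lemma symbol_at_head c h : symbol_at c h h = c_head c.
Proof. by rewrite /symbol_at ltnn eqxx. Qed.

Lemma symbol_at_left (q : state) (l r : seq (option bool)) s a h x : 0 < h ->
  symbol_at (Config q (behead l) (head None l) (s :: r)) h.-1 x =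
  if x == h then s else symbol_at (Config q l a r) h x.
Proof.
case: h => // h _; rewrite /symbol_at /=; case: (ltngtP x h.+1) => [lt|gt|->].
- case: (ltngtP x h) => [lt'|gt'|->]; [| lia | by rewrite subSnn nth0].
  by rewrite nth_behead; congr (nth _ _ _); lia.
- have -> : (x < h) = false by lia.
  have -> : (x == h) = false by lia.
  by have -> : (x - h).-1 = (x - h.+1).-1.+1 by lia.
- by rewrite ltnNge leqnSn subSnn ifF //; lia.
Qed.

Lemma symbol_at_right (q : state) (l r : seq (option bool)) s a h x :
  symbol_at (Config q (s :: l) (head None r) (behead r)) h.+1 x =
  if x == h then s else symbol_at (Config q l a r) h x.
Proof.
rewrite /symbol_at /=; case: (ltngtP x h) => [lt|gt|->].
- have -> : x < h.+1 by lia.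
  by have -> : (h.+1 - x).-1 = (h - x).-1.+1 by lia.
- case: (ltngtP x h.+1) => [lt'|gt'|->]; [lia | | by rewrite subSnn nth0].
  by rewrite nth_behead; congr (nth _ _ _); lia.
- by rewrite ltnSn subSnn.
Qed.

Lemma symbol_at_step c h x : 0 < h ->
  symbol_at (step c) (head_move c h) x =
  if x == h then (transition (c_state c) (c_head c)).1.2 else symbol_at c h x.
Proof.
case: c => q l a r h0; rewrite /step /head_move /transition /=.
case: ifP => _ /=; first by case: eqP => // ->; rewrite symbol_at_head.
case: (tm_delta q a) => [[q' s] []] /=.
- exact: symbol_at_left.
- exact: symbol_at_right.
- by rewrite /symbol_at /=; case: ltngtP.
Qed.

Lemma c_state_step (c : config M) : c_state (step c) = (transition (c_state c) (c_head c)).1.1.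
Proof. by rewrite /step /transition; case: ifP => // _; case: tm_delta => [[q s] []]. Qed.

Definition cell_action (u : cell) : option (state * option bool * dir) :=
  if u.2 is Some q then Some (transition q u.1) else None.

Definition local_step (l m r : cell) : cell :=
  (if cell_action m is Some (_, s, _) then s else m.1,
   if cell_action m is Some (q, _, DStay) then Some q
   else if cell_action l is Some (q, _, DRight) then Some q
   else if cell_action r is Some (q, _, DLeft) then Some q else None).

Definition left_of (f : nat -> cell) (x : nat) : cell := if x is x'.+1 then f x' else blank.

Lemma cell_action_at c h x : cell_action (cell_at c h x) =
  if x == h then Some (transition (c_state c) (c_head c)) else None.
Proof. by rewrite /cell_action /cell_at /=; case: eqP => [->|//]; rewrite symbol_at_head. Qed.

Lemma cell_action_left_of c h x : cell_action (left_of (cell_at c h) x) =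
  if x == h.+1 then Some (transition (c_state c) (c_head c)) else None.
Proof. by case: x => [|x] //=; rewrite cell_action_at eqSS. Qed.

Lemma cell_at_step c h x : 0 < h ->
  cell_at (step c) (head_move c h) x =
  local_step (left_of (cell_at c h) x) (cell_at c h x) (cell_at c h x.+1).
Proof.
move=> h0; rewrite /cell_at symbol_at_step // c_state_step -/(cell_at c h).
rewrite /local_step !cell_action_at cell_action_left_of /head_move.
case: (transition _ _) => [[q s] d]; congr (_, _); first by case: (x == h).
have -> : (x.+1 == h) = (x == h.-1) by lia.
by case: d; case: (x == h); case: (x == h.+1); case: (x == h.-1).
Qed.

Section Run.
Variables (z : seq bool) (start : nat).

Fixpoint head_at (t : nat) : nat :=
  if t is t'.+1 then head_move (run M t' z) (head_at t') else start.

Definition row (t x : nat) : cell := cell_at (run M t z) (head_at t) x.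

Lemma head_at_bound t : start - t <= head_at t <= start + t.
Proof.
elim: t => [|t IH] /=; first by lia.
by rewrite /head_move; case: (transition _ _).2; lia.
Qed.

Lemma rowS t x : t < start -> row t.+1 x = local_step (left_of (row t) x) (row t x) (row t x.+1).
Proof.
move=> lt; have h0 : 0 < head_at t by have := head_at_bound t; lia.
exact: (@cell_at_step (run M t z) (head_at t) x h0).
Qed.

Lemma row0 x : row 0 x = ((if x < start then None else nth None (map Some z) (x - start)),
                          if x == start then Some (tm_start M) else None).
Proof.
rewrite /row /cell_at /symbol_at /run /=; congr (_, _); case: (ltngtP x start) => [lt|gt|->].
- by rewrite nth_nil.
- by rewrite nth_behead; congr (nth _ _ _); lia.
- by rewrite subnn nth0.
Qed.

Lemma row_right t x : t <= start -> start + t < x -> start + size z <= x -> row t x = blank.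
Proof.
elim: t x => [|t IH] x le lt le_x.
  have ne : (x == start) = false by lia.
  by rewrite row0 ne ifF; [rewrite nth_default // size_map; lia | lia].
rewrite rowS // !IH; try lia.
case: x lt le_x => [|x] lt le_x //=; case: (leqP (start + size z) x) => [le'|_].
  by rewrite IH //; lia.
by rewrite /local_step cell_action_at; case: eqP => [e|//]; have := head_at_bound t; lia.
Qed.

Lemma output_true t : (output (run M t z) == [:: true]) =
  ((row t (head_at t)).1 == Some true) && ((row t (head_at t).+1).1 == None).
Proof.
rewrite /row /cell_at /= symbol_at_head /symbol_at /output.
have -> : ((head_at t).+1 < head_at t) = false by lia.
have -> : ((head_at t).+1 == head_at t) = false by lia.
have -> : ((head_at t).+1 - head_at t).-1 = 0 by lia.
case: (c_head _) => [b|] //=.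
by case: (c_right _) => [|[c|] s] /=; case: b.
Qed.

End Run.
End Rows.

Lemma gap_free_word (g : nat -> option bool) m :
  (forall j, j.+1 < m -> g j = None -> g j.+1 = None) ->
  exists2 y, size y <= m & forall j, j < m -> g j = nth None (map Some y) j.
Proof.
elim: m g => [|m IH] g g_None; first by exists [::].
case e: (g 0) => [b|].
  have [j jm|y sy gy] := IH (g \o succn); first by apply: g_None.
  by exists (b :: y) => // -[|j] jm //=; apply: gy.
exists [::] => // j jm; rewrite nth_nil.
by elim: j jm => // j IHj jm; apply: g_None => //; apply: IHj; lia.
Qed.

Lemma size_pair_enc (w y : seq bool) : size (pair_enc w y) = 2 * size w + 2 + size y.
Proof.
rewrite /pair_enc !size_cat; have -> : size (flatten [seq [:: true; b] | b <- w]) = 2 * size w.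
  by elim: w => //= b s ->; rewrite mulnS.
by rewrite -addnA.
Qed.

Section Tableau.
Variables (M : TM) (w : seq bool) (T Y : nat).

Definition width : nat := 2 * T + 3.
Definition origin : nat := T.+1.
Definition prefix_size : nat := 2 * size w + 2.

Definition prefix_bit (j : nat) : bool := (j < 2 * size w) && (~~ odd j || nth false w j./2).

Lemma nth_prefix y j : j < prefix_size ->
  nth None (map Some (pair_enc w y)) j = Some (prefix_bit j).
Proof.
rewrite /prefix_size /prefix_bit /pair_enc; elim: w j => [|c s IH] [|[|j]] lt;
  try (by rewrite /= mul2n ?doubleS); try (by []).
rewrite /= in lt *; rewrite IH; last by lia.
by rewrite negbK; congr (Some (_ && _)); lia.
Qed.

Lemma nth_suffix y j :
  nth None (map Some (pair_enc w y)) (prefix_size + j) = nth None (map Some y) j.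
Proof.
rewrite /pair_enc catA map_cat nth_cat size_map.
have -> : size (flatten [seq [:: true; b] | b <- w] ++ [:: false; false]) = prefix_size.
  by have := size_pair_enc w [::]; rewrite /pair_enc cats0 addn0.
by rewrite ltnNge leq_addr /= addKn.
Qed.

(* The certificate is not specified: on its [Y] cells only blanks may follow a blank. *)
Definition initial_symbol (p : nat) (a b : option bool) : bool :=
  if p < origin then a == None
  else if p < origin + prefix_size then a == Some (prefix_bit (p - origin))
  else if p < origin + prefix_size + Y then (a == None) ==> (b == None)
  else a == None.

Definition initial_cell (p : nat) (m r : cell M) : bool :=
  (m.2 == if p == origin then Some (tm_start M) else None) && initial_symbol p m.1 r.1.

Definition accepting_cell (m r : cell M) : bool :=
  isSome m.2 ==> (m.1 == Some true) && (r.1 == None).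

Definition tableau (c : nat -> nat -> cell M) : Prop :=
  [/\ forall r, r <= T -> c r width = blank M,
      forall p, p < width -> initial_cell p (c 0 p) (c 0 p.+1),
      forall r p, r < T -> p < width ->
        c r.+1 p = local_step (left_of (c r) p) (c r p) (c r p.+1) &
      forall p, p < width -> accepting_cell (c T p) (c T p.+1)].

Lemma initial_cell_row y p : size y <= Y -> p < width ->
  initial_cell p (row M (pair_enc w y) origin 0 p) (row M (pair_enc w y) origin 0 p.+1).
Proof.
move=> sy pw; rewrite /initial_cell /initial_symbol !row0 /= eqxx /=; case: ltnP => [//|ge].
case: ltnP => [lt|ge2]; first by rewrite nth_prefix //; lia.
have -> : (p.+1 < origin) = false by lia.
have -> : p - origin = prefix_size + (p - origin - prefix_size) by lia.
have -> : p.+1 - origin = prefix_size + (p - origin - prefix_size).+1 by lia.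
rewrite !nth_suffix; case: ifP => [lt|ge3].
  apply/implyP; move: (p - origin - prefix_size) => j.
  by elim: y j {sy} => [|b y IH] [|j] //=; apply: IH.
by rewrite nth_default // size_map; lia.
Qed.

Lemma initial_cells_row c : tableau c -> origin + prefix_size + Y < width ->
  exists2 y, size y <= Y & forall p, p < width -> c 0 p = row M (pair_enc w y) origin 0 p.
Proof.
case=> _ init _ _ fit.
have [|y sy c_y] := @gap_free_word (fun j => (c 0 (origin + prefix_size + j)).1) Y.
  move=> j jY e; have pw : origin + prefix_size + j < width by lia.
  have /andP [_] := init _ pw; rewrite /initial_symbol e.
  have -> : (origin + prefix_size + j < origin) = false by lia.
  have -> : (origin + prefix_size + j < origin + prefix_size) = false by lia.
  have -> : origin + prefix_size + j < origin + prefix_size + Y by lia.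
  by rewrite addnS => /eqP.
exists y => // p pw; rewrite row0 [c 0 p]surjective_pairing.
have /andP [/eqP -> sym_p] := init p pw; congr (_, _); move: sym_p; rewrite /initial_symbol.
case: ltnP => [_ /eqP //|ge]; case: ltnP => [lt /eqP ->|ge2].
  by rewrite nth_prefix //; lia.
have -> : p - origin = prefix_size + (p - (origin + prefix_size)) by lia.
rewrite nth_suffix; case: ltnP => [lt _|ge3 /eqP ->].
  by rewrite -c_y ?subnKC //; lia.
by rewrite nth_default // size_map; lia.
Qed.

Lemma tableau_row c y : tableau c -> origin + prefix_size + Y < width -> size y <= Y ->
  (forall p, p < width -> c 0 p = row M (pair_enc w y) origin 0 p) ->
  forall r p, r <= T -> p <= width -> c r p = row M (pair_enc w y) origin r p.
Proof.
case=> border _ next _ fit sy c0 r p; have sz := size_pair_enc w y.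
have blank_border r' : r' <= T -> row M (pair_enc w y) origin r' width = blank M.
  by move=> leT; apply: row_right; move: fit; rewrite /origin /width /prefix_size; lia.
elim: r p => [|r IH] p rT; rewrite leq_eqVlt => /predU1P [->|pw].
- by rewrite border ?blank_border.
- exact: c0.
- by rewrite border ?blank_border.
- rewrite next // rowS; last by rewrite /origin; lia.
  rewrite !IH; try lia.
  by case: p pw => [|p] pw //=; rewrite IH //; lia.
Qed.

Variable b : seq bool -> bool.
Hypothesis fit : prefix_size + Y <= T.
Hypothesis b_ok : forall y, size y <= Y -> output (run M T (pair_enc w y)) = [:: b (pair_enc w y)].

Let fit_width : origin + prefix_size + Y < width.
Proof. by rewrite /origin /width; lia. Qed.

Lemma accepting_row y : size y <= Y ->
  b (pair_enc w y) <-> forall p, p < width ->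
    accepting_cell (row M (pair_enc w y) origin T p) (row M (pair_enc w y) origin T p.+1).
Proof.
move=> sy; set z := pair_enc w y; have hb := head_at_bound M z origin T.
have hw : head_at M z origin T < width by move: hb; rewrite /origin /width; lia.
have := output_true M z origin T; rewrite /z b_ok // eqseq_cons andbT eqb_id -/z => ->.
split=> [acc p _|acc]; last by have := acc _ hw; rewrite /accepting_cell {1}/row /cell_at /= eqxx.
apply/implyP; rewrite {1}/row /cell_at /=; case: eqP => // -> _; exact: acc.
Qed.

Theorem certificate_tableau : (exists2 y, size y <= Y & b (pair_enc w y)) <-> exists c, tableau c.
Proof.
split=> [[y sy /(accepting_row sy) acc]|[c tab]].
  exists (row M (pair_enc w y) origin); have sz := size_pair_enc w y.
  split=> // [r rT|p pw|r p rT pw].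
  - by apply: row_right; move: fit; rewrite /origin /width /prefix_size; lia.
  - exact: initial_cell_row.
  - by apply: rowS; rewrite /origin; lia.
have [y sy c0] := initial_cells_row tab fit_width.
have c_row := tableau_row tab fit_width sy c0; have [_ _ _ acc] := tab.
by exists y => //; apply/(accepting_row sy) => p pw; rewrite -!c_row // ?acc // ltnW.
Qed.

End Tableau.

(** * Tableaux as cyclic tilings *)

Section TableauTiling.
Variables (M : TM) (w : seq bool) (T Y : nat).

Definition area : nat := T.+1 * width T.

Lemma width_gt0 : 0 < width T. Proof. by rewrite /width addn3. Qed.

Lemma area_gt0 : 0 < area. Proof. by rewrite muln_gt0 width_gt0. Qed.

Definition tile : finType := (cell M * cell M * cell M)%type.
Definition tile_left (t : tile) : cell M := t.1.1.
Definition tile_mid (t : tile) : cell M := t.1.2.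
Definition tile_right (t : tile) : cell M := t.2.

Definition colour : finType := option (cell M * cell M).

Definition direction_step (vertical : bool) : nat := if vertical then width T else 1.

Definition legal_tile (r p : nat) (t : tile) : bool :=
  [&& (r == 0) ==> initial_cell w T Y p (tile_mid t) (tile_right t),
      (r == T) ==> accepting_cell (tile_mid t) (tile_right t),
      (p == 0) ==> (tile_left t == blank M) &
      (p == (width T).-1) ==> (tile_right t == blank M)].

Definition border_colour : colour := Some (blank M, blank M).

(* Illegal tiles show [None], which no incoming edge shows.  Cyclic neighbours across the border
   of the tableau are not related, so all tiles there show the same colour. *)
Definition shown (vertical incoming : bool) (i : nat) (t : tile) : colour :=
  let r := i %/ width T in let p := i %% width T in
  match vertical, incoming with
  | false, false =>
      if legal_tile r p t then
        (if p == (width T).-1 then border_colour else Some (tile_mid t, tile_right t))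
      else None
  | false, true => if p == 0 then border_colour else Some (tile_left t, tile_mid t)
  | true, false =>
      if r == T then border_colour
      else Some (local_step (tile_left t) (tile_mid t) (tile_right t), blank M)
  | true, true => if r == 0 then border_colour else Some (tile_mid t, blank M)
  end.

Local Notation tableau_tiling := (cyclic_tiling direction_step shown area_gt0).

Lemma grid_div r p : p < width T -> (r * width T + p) %/ width T = r.
Proof. by move=> lt; rewrite divnMDl ?width_gt0 // divn_small // addn0. Qed.

Lemma grid_mod r p : p < width T -> (r * width T + p) %% width T = p.
Proof. by move=> lt; rewrite modnMDl modn_small. Qed.

Lemma grid_lt r p : r <= T -> p < width T -> r * width T + p < area.
Proof.
move=> rT lt; apply: (@leq_trans (r.+1 * width T)); first by rewrite mulSnr ltn_add2l.
by rewrite leq_mul2r ltnS rT orbT.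
Qed.

Lemma gridP i : i < area -> exists r p, [/\ i = r * width T + p, r <= T & p < width T].
Proof.
move=> lt; exists (i %/ width T), (i %% width T); rewrite -divn_eq ltn_mod width_gt0.
by split=> //; rewrite -ltnS ltn_divLR ?width_gt0.
Qed.

Lemma next_column r p : r <= T -> p.+1 < width T ->
  (r * width T + p + 1) %% area = r * width T + p.+1.
Proof. by move=> rT lt; rewrite -addnA addn1 modn_small ?grid_lt. Qed.

Lemma next_column_last r : (r * width T + (width T).-1 + 1) %% area %% width T = 0.
Proof.
rewrite modn_dvdm ?dvdn_mull // -addnA addn1 prednK ?width_gt0 //.
by rewrite modnMDl modnn.
Qed.

Lemma next_row r p : r < T -> p < width T ->
  (r * width T + p + width T) %% area = r.+1 * width T + p.
Proof. by move=> rT lt; rewrite addnAC -mulSnr modn_small ?grid_lt. Qed.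

Lemma next_row_last p : p < width T -> (T * width T + p + width T) %% area %/ width T = 0.
Proof.
move=> lt; rewrite addnAC -mulSnr -/area modnDl modn_small ?divn_small //.
exact: (@grid_lt 0).
Qed.

Lemma tiling_of_tableau (c : nat -> nat -> cell M) : tableau w T Y c ->
  exists tau, tableau_tiling tau.
Proof.
case=> border init next acc.
pose tau_at r p : tile := (left_of (c r) p, c r p, c r p.+1).
have legal r p : r <= T -> p < width T -> legal_tile r p (tau_at r p).
  move=> rT pw; apply/and4P; split; apply/implyP => /eqP e.
  - by rewrite e; apply: init.
  - by rewrite e; apply: acc.
  - by rewrite e.
  - by rewrite /tile_right /= e prednK ?width_gt0 // border.
exists (fun i : 'I_area => tau_at (i %/ width T) (i %% width T)) => -[] i;
  have [r [p [ei rT pw]]] := gridP (ltn_ord i); rewrite /shown /= ei grid_div // grid_mod //.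
- have [->|ne] := eqVneq r T; first by rewrite next_row_last.
  have rT' : r < T by rewrite ltn_neqAle ne.
  by rewrite next_row ?grid_div ?grid_mod // /tau_at /tile_mid /= next.
- rewrite legal //; have [->|ne] := eqVneq p (width T).-1; first by rewrite next_column_last.
  have pw' : p.+1 < width T by move: ne pw; have := width_gt0; lia.
  by rewrite next_column ?grid_div ?grid_mod.
Qed.

Section TableauOfTiling.
Variable tau : 'I_area -> tile.
Hypothesis tau_tiling : tableau_tiling tau.

Let area_ord (i : nat) : 'I_area := insubd (Ordinal area_gt0) i.

Definition grid_tile (r p : nat) : tile := tau (area_ord (r * width T + p)).

Lemma shown_next_tile r p d : r <= T -> p < width T ->
  shown d false (r * width T + p) (grid_tile r p) =
  shown d true ((r * width T + p + direction_step d) %% area)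
    (tau (area_ord ((r * width T + p + direction_step d) %% area))).
Proof.
move=> rT pw; have idx : area_ord (r * width T + p) = r * width T + p :> nat.
  by rewrite -[LHS]/(val _) val_insubd grid_lt.
have step_tau (i : 'I_area) : shown d false i (tau i) =
    shown d true ((i + direction_step d) %% area) (tau (area_ord ((i + direction_step d) %% area))).
  rewrite tau_tiling; congr (shown _ _ _ (tau _)); apply: val_inj.
  by rewrite val_insubd ltn_pmod ?area_gt0.
by have := step_tau (area_ord (r * width T + p)); rewrite idx.
Qed.

Lemma grid_tile_legal r p : r <= T -> p < width T -> legal_tile r p (grid_tile r p).
Proof.
move=> rT pw; have := shown_next_tile false rT pw; rewrite /shown grid_div // grid_mod //.
by case: ifP => // _; case: ifP.
Qed.

Lemma grid_tile_horizontal r p : r <= T -> p.+1 < width T ->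
  tile_mid (grid_tile r p) = tile_left (grid_tile r p.+1) /\
  tile_right (grid_tile r p) = tile_mid (grid_tile r p.+1).
Proof.
move=> rT lt; have pw := ltnW lt; have := shown_next_tile false rT pw.
rewrite /= next_column // /shown !grid_div // !grid_mod // grid_tile_legal //.
by rewrite ifF; [case | have := width_gt0; lia].
Qed.

Lemma grid_tile_vertical r p : r < T -> p < width T ->
  local_step (tile_left (grid_tile r p)) (tile_mid (grid_tile r p)) (tile_right (grid_tile r p)) =
  tile_mid (grid_tile r.+1 p).
Proof.
move=> rT pw; have := shown_next_tile true (ltnW rT) pw.
rewrite /= next_row // /shown !grid_div //=.
by rewrite ifF; [case | lia].
Qed.

Definition grid_cell (r p : nat) : cell M :=
  if p < width T then tile_mid (grid_tile r p) else blank M.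

Lemma grid_cell_left r p : r <= T -> p < width T ->
  left_of (grid_cell r) p = tile_left (grid_tile r p).
Proof.
case: p => [|p] rT pw /=; last first.
  by rewrite /grid_cell (ltnW pw); have [-> _] := grid_tile_horizontal rT pw.
by have /and4P [_ _ /implyP /(_ (eqxx 0)) /eqP -> _] := grid_tile_legal rT pw.
Qed.

Lemma grid_cell_right r p : r <= T -> p < width T -> grid_cell r p.+1 = tile_right (grid_tile r p).
Proof.
move=> rT pw; rewrite /grid_cell; case: ltnP => [lt|ge].
  by have [_ ->] := grid_tile_horizontal rT lt.
have ep : p = (width T).-1 by lia.
by have /and4P [_ _ _ /implyP /(_ (introT eqP ep)) /eqP ->] := grid_tile_legal rT pw.
Qed.

Lemma tableau_of_tiling : tableau w T Y grid_cell.
Proof.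
have mid r p : p < width T -> grid_cell r p = tile_mid (grid_tile r p) by rewrite /grid_cell => ->.
split=> [r rT|p pw|r p rT pw|p pw].
- by rewrite /grid_cell ltnn.
- rewrite grid_cell_right // mid //.
  by have /and4P [/implyP /(_ (eqxx 0)) //] := grid_tile_legal (leq0n T) pw.
- by rewrite grid_cell_left ?grid_cell_right ?mid ?grid_tile_vertical // ltnW.
- rewrite grid_cell_right // mid //.
  by have /and4P [_ /implyP /(_ (eqxx T)) //] := grid_tile_legal (leqnn T) pw.
Qed.

End TableauOfTiling.

Theorem tableau_cyclic_tiling :
  (exists c : nat -> nat -> cell M, tableau w T Y c) <-> exists tau, tableau_tiling tau.
Proof.
split=> [[c]|[tau tau_tiling]]; first exact: tiling_of_tableau.
by exists (grid_cell tau); apply: tableau_of_tiling.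
Qed.

End TableauTiling.

(** * Arithmetic as loop programs *)

Definition loop_nat k (F : context k -> nat) : Prop := loop_prog F (fun _ => [::]).
Definition loop_bool k (b : context k -> bool) : Prop := loop_nat (fun g => nat_of_bool (b g)).
Definition loop_word k (G : context k -> seq bool) : Prop := loop_prog (fun _ => 0) G.

(* A value in a finite type counts as computed when all its numerical functions are. *)
Definition loop_fin k (X : finType) (x : context k -> X) : Prop :=
  forall h : X -> nat, loop_nat (fun g => h (x g)).

Lemma loop_nat_ext k (F F' : context k -> nat) : F =1 F' -> loop_nat F -> loop_nat F'.
Proof. by move=> e; apply: prog_ext e _. Qed.

Lemma loop_bool_ext k (b c : context k -> bool) : b =1 c -> loop_bool b -> loop_bool c.
Proof. by move=> e; apply: loop_nat_ext => g; rewrite e. Qed.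

Lemma loop_nat_const k c : @loop_nat k (fun _ => c).
Proof. by elim: c => [|c IH]; [apply: prog_zero | apply: prog_succ]. Qed.

Lemma loop_nat_input_size k : @loop_nat k (fun g => size (input_of g)).
Proof. by elim: k => [|k IH]; [apply: prog_input_size | apply: prog_weaken IH]. Qed.

Lemma loop_nat_sum k (F : context k -> nat) (F1 : context k -> nat -> nat) :
  loop_nat F -> @loop_nat k.+1 (fun g => F1 g.1 g.2) -> loop_nat (fun g => \sum_(i < F g) F1 g i).
Proof.
move=> progF progF1; apply: prog_ext (prog_for (G1 := fun _ _ => [::]) progF progF1) => // g.
by elim: (iota 0 (F g)).
Qed.

Lemma loop_nat_if_eq k (F1 F2 F3 F4 : context k -> nat) :
  loop_nat F1 -> loop_nat F2 -> loop_nat F3 -> loop_nat F4 ->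
  loop_nat (fun g => if F1 g == F2 g then F3 g else F4 g).
Proof.
move=> prog1 prog2 prog3 prog4; apply: prog_ext (prog_if prog1 prog2 prog3 prog4) => // g.
by case: eqP.
Qed.

Lemma loop_bool_const k b : @loop_bool k (fun _ => b).
Proof. exact: loop_nat_const. Qed.

Lemma loop_bool_eq k (F G : context k -> nat) :
  loop_nat F -> loop_nat G -> loop_bool (fun g => F g == G g).
Proof.
move=> progF progG; have := loop_nat_if_eq progF progG (loop_nat_const k 1) (loop_nat_const k 0).
by apply: loop_nat_ext => g; case: eqP.
Qed.

Lemma loop_nat_if k (b : context k -> bool) (F G : context k -> nat) :
  loop_bool b -> loop_nat F -> loop_nat G -> loop_nat (fun g => if b g then F g else G g).
Proof.
move=> prog_b progF progG; have := loop_nat_if_eq prog_b (loop_nat_const k 1) progF progG.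
by apply: loop_nat_ext => g; case: (b g).
Qed.

Lemma loop_fin_const k (X : finType) (x : X) : @loop_fin k X (fun _ => x).
Proof. by move=> h; apply: loop_nat_const. Qed.

Lemma loop_fin_if k (X : finType) (b : context k -> bool) (x y : context k -> X) :
  loop_bool b -> loop_fin x -> loop_fin y -> loop_fin (fun g => if b g then x g else y g).
Proof.
move=> prog_b progx progy h; apply: loop_nat_ext (loop_nat_if prog_b (progx h) (progy h)) => g.
by case: (b g).
Qed.

Lemma loop_bool_fin k (X : finType) (x : context k -> X) (P : pred X) :
  loop_fin x -> loop_bool (fun g => P (x g)).
Proof. by move=> progx; apply: (progx (fun x => nat_of_bool (P x))). Qed.

Lemma loop_bool_if k (b c d : context k -> bool) :
  loop_bool b -> loop_bool c -> loop_bool d -> loop_bool (fun g => if b g then c g else d g).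
Proof.
by move=> pb pc pd; apply: loop_nat_ext (loop_nat_if pb pc pd) => g; case: (b g).
Qed.

Lemma loop_bool_neg k (b : context k -> bool) : loop_bool b -> loop_bool (fun g => ~~ b g).
Proof. by move=> pb; apply: loop_bool_if pb (loop_bool_const k false) (loop_bool_const k true). Qed.

Lemma loop_bool_and k (b c : context k -> bool) :
  loop_bool b -> loop_bool c -> loop_bool (fun g => b g && c g).
Proof. by move=> pb pc; apply: loop_bool_if pb pc (loop_bool_const k false). Qed.

Lemma loop_bool_or k (b c : context k -> bool) :
  loop_bool b -> loop_bool c -> loop_bool (fun g => b g || c g).
Proof. by move=> pb pc; apply: loop_bool_if pb (loop_bool_const k true) pc. Qed.

Lemma loop_bool_imply k (b c : context k -> bool) :
  loop_bool b -> loop_bool c -> loop_bool (fun g => b g ==> c g).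
Proof. by move=> pb pc; apply: loop_bool_if pb pc (loop_bool_const k true). Qed.

Lemma loop_nat_add k (F G : context k -> nat) :
  loop_nat F -> loop_nat G -> loop_nat (fun g => F g + G g).
Proof.
move=> pF pG.
apply: (@loop_nat_ext _ (fun g => \sum_(i < 2) (if (i : nat) == 0 then F g else G g))).
  by move=> g; rewrite !big_ord_recr big_ord0.
apply: (loop_nat_sum (F1 := fun g i => if i == 0 then F g else G g)); first exact: loop_nat_const.
apply: loop_nat_if_eq; [exact: prog_counter | exact: loop_nat_const | exact: prog_weaken pF |].
exact: prog_weaken pG.
Qed.

Lemma loop_nat_mul k (F G : context k -> nat) :
  loop_nat F -> loop_nat G -> loop_nat (fun g => F g * G g).
Proof.
move=> pF pG; apply: (@loop_nat_ext _ (fun g => \sum_(i < F g) G g)).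
  by move=> g; rewrite sum_nat_const card_ord.
exact: (loop_nat_sum (F1 := fun g i => G g)) pF (prog_weaken pG).
Qed.

Lemma loop_nat_exp k (F : context k -> nat) c : loop_nat F -> loop_nat (fun g => F g ^ c).
Proof.
move=> pF; elim: c => [|c IH]; first exact: loop_nat_const.
by apply: loop_nat_ext (loop_nat_mul pF IH) => g; rewrite expnS.
Qed.

Lemma loop_nat_bigsum k (I : Type) (s : seq I) (F : I -> context k -> nat) :
  (forall i, loop_nat (F i)) -> loop_nat (fun g => \sum_(i <- s) F i g).
Proof.
move=> pF; elim: s => [|i s IH].
  by apply: loop_nat_ext (loop_nat_const k 0) => g; rewrite big_nil.
by apply: loop_nat_ext (loop_nat_add (pF i) IH) => g; rewrite big_cons.
Qed.

Lemma sum_nat_ltn N m : \sum_(u < N) (u < m) = minn m N.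
Proof. by elim: N => [|N IH]; rewrite ?big_ord0 ?minn0 // big_ord_recr /= IH; case: ltnP; lia. Qed.

Lemma loop_bool_ltn k (F G : context k -> nat) :
  loop_nat F -> loop_nat G -> loop_bool (fun g => F g < G g).
Proof.
move=> pF pG; apply: (@loop_nat_ext _ (fun g => \sum_(i < G g) ((i : nat) == F g))).
  move=> g; elim: (G g) => [|m IH]; first by rewrite big_ord0.
  by rewrite big_ord_recr /= IH; lia.
apply: (loop_nat_sum (F1 := fun g i => i == F g) pG).
exact: loop_bool_eq (prog_counter k) (prog_weaken pF).
Qed.

Lemma loop_bool_leq k (F G : context k -> nat) :
  loop_nat F -> loop_nat G -> loop_bool (fun g => F g <= G g).
Proof. by move=> pF pG; apply: loop_bool_ltn pF (prog_succ pG). Qed.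

Lemma loop_nat_sub k (F G : context k -> nat) :
  loop_nat F -> loop_nat G -> loop_nat (fun g => F g - G g).
Proof.
move=> pF pG; apply: (@loop_nat_ext _ (fun g => \sum_(i < F g) (G g <= i))).
  move=> g; elim: (F g) => [|m IH]; first by rewrite big_ord0.
  by rewrite big_ord_recr /= IH; case: leqP; lia.
apply: (loop_nat_sum (F1 := fun g i => G g <= i) pF).
exact: loop_bool_leq (prog_weaken pG) (prog_counter k).
Qed.

Lemma loop_nat_div k (F G : context k -> nat) :
  loop_nat F -> loop_nat G -> loop_nat (fun g => F g %/ G g).
Proof.
move=> pF pG; apply: (@loop_nat_ext _
  (fun g => if G g == 0 then 0 else \sum_(u < F g) (u.+1 * G g <= F g))).
  move=> g; case: posnP => [->|G0]; first by rewrite divn0.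
  rewrite (eq_bigr (fun u : 'I_(F g) => nat_of_bool (u < F g %/ G g))) => [|u _].
    by rewrite sum_nat_ltn; apply/minn_idPl; apply: leq_div.
  by rewrite leq_divRL.
apply: (loop_nat_if_eq pG (loop_nat_const k 0) (loop_nat_const k 0)).
apply: (loop_nat_sum (F1 := fun g i => i.+1 * G g <= F g) pF).
exact: loop_bool_leq (loop_nat_mul (prog_succ (prog_counter k)) (prog_weaken pG)) (prog_weaken pF).
Qed.

Lemma loop_nat_mod k (F G : context k -> nat) :
  loop_nat F -> loop_nat G -> loop_nat (fun g => F g %% G g).
Proof.
move=> pF pG; apply: loop_nat_ext (loop_nat_sub pF (loop_nat_mul (loop_nat_div pF pG) pG)) => g.
by rewrite {1}(divn_eq (F g) (G g)) addKn.
Qed.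

Lemma loop_nat_half k (F : context k -> nat) : loop_nat F -> loop_nat (fun g => (F g)./2).
Proof.
by move=> pF; apply: loop_nat_ext (loop_nat_div pF (loop_nat_const k 2)) => g; rewrite divn2.
Qed.

Lemma loop_bool_odd k (F : context k -> nat) : loop_nat F -> loop_bool (fun g => odd (F g)).
Proof.
by move=> pF; apply: loop_nat_ext (loop_nat_mod pF (loop_nat_const k 2)) => g; rewrite modn2.
Qed.

Lemma loop_nat_pred k (F : context k -> nat) : loop_nat F -> loop_nat (fun g => (F g).-1).
Proof.
by move=> pF; apply: loop_nat_ext (loop_nat_sub pF (loop_nat_const k 1)) => g; rewrite subn1.
Qed.

Lemma loop_nat_nth k (X : Type) (x0 : X) (s : seq X)
    (F : X -> context k -> nat) (G : context k -> nat) :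
  (forall x, loop_nat (F x)) -> loop_nat G -> loop_nat (fun g => F (nth x0 s (G g)) g).
Proof.
move=> pF; elim: s G => [|x s IH] G pG.
  by apply: loop_nat_ext (pF x0) => g; rewrite nth_nil.
have := loop_nat_if_eq pG (loop_nat_const k 0) (pF x) (IH _ (loop_nat_pred pG)).
by apply: loop_nat_ext => g; case: (G g).
Qed.

Lemma loop_word_nil k : @loop_word k (fun _ => [::]).
Proof. exact: prog_zero. Qed.

Lemma loop_word_cat k (G1 G2 : context k -> seq bool) :
  loop_word G1 -> loop_word G2 -> loop_word (fun g => G1 g ++ G2 g).
Proof. exact: prog_seq. Qed.

Lemma loop_word_for k (F : context k -> nat) (G : context k -> nat -> seq bool) :
  loop_nat F -> @loop_word k.+1 (fun g => G g.1 g.2) ->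
  loop_word (fun g => flatten [seq G g i | i <- iota 0 (F g)]).
Proof.
move=> pF pG; apply: prog_ext (prog_for (F1 := fun _ _ => 0) pF pG) => // g.
by rewrite big1.
Qed.

Lemma loop_word_if k (b : context k -> bool) (G1 G2 : context k -> seq bool) :
  loop_bool b -> loop_word G1 -> loop_word G2 -> loop_word (fun g => if b g then G1 g else G2 g).
Proof.
move=> pb p1 p2; apply: prog_ext (prog_if pb (loop_nat_const k 1) p1 p2) => g.
  by case: (b g).
by case: (b g).
Qed.

(** * Binary encodings *)

Lemma bits_aux_fuel f f' m : m <= f -> m <= f' -> bits_aux f m = bits_aux f' m.
Proof.
elim: f f' m => [|f IH] [|f'] [|m] //= lf lf'; congr (_ :: _); apply: IH; lia.
Qed.

Lemma bits_rec m : 0 < m -> bits m = odd m :: bits m./2.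
Proof. by case: m => // m _; rewrite /bits /=; congr (_ :: _); apply: bits_aux_fuel; lia. Qed.

Lemma bits_inj : injective bits.
Proof.
pose value s := foldr (fun (b : bool) x => b + x.*2) 0 s.
apply: (can_inj (g := value)) => m; have [k] := ubnP m; elim: k m => // k IH m lt.
case: (posnP m) => [->//|m0]; rewrite bits_rec //= IH; last by lia.
by rewrite odd_double_half.
Qed.

Lemma enc_nat_inj m m' s s' : enc_nat m ++ s = enc_nat m' ++ s' -> m = m' /\ s = s'.
Proof.
rewrite /enc_nat -!catA => eq_enc; suff : bits m = bits m' /\ s = s' by case=> /bits_inj.
elim: (bits m) (bits m') eq_enc => [|b l IH] [|b' l'] //= []; first by move=> ->.
by move=> -> /IH [-> ->].
Qed.

Lemma enc_nats_cons m s : enc_nats (m :: s) = enc_nat m ++ enc_nats s.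
Proof. by []. Qed.

Lemma enc_nats_cat s s' : enc_nats (s ++ s') = enc_nats s ++ enc_nats s'.
Proof. by rewrite /enc_nats map_cat flatten_cat. Qed.

Lemma enc_nats_inj : injective enc_nats.
Proof.
have nonempty m s : enc_nats (m :: s) <> [::] by rewrite enc_nats_cons /enc_nat; case: (bits m).
elim=> [|m s IH] [|m' s'] // eq_enc.
- by have := nonempty m' s'; rewrite -eq_enc.
- by have := nonempty m s; rewrite eq_enc.
by have [-> /IH ->] := enc_nat_inj eq_enc.
Qed.

Lemma enc_instance_inj n k t E n' k' t' E' :
  enc_instance n k t E = enc_instance n' k' t' E' -> [/\ n = n', k = k', t = t' & E = E'].
Proof.
move=> /enc_nats_inj [-> -> -> eq_E]; split=> //.
elim: E E' eq_E => [|[x y] E IH] [|[x' y'] E'] //= [-> ->].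
by move=> /IH ->.
Qed.

Lemma size_bits m e : (e < size (bits m)) = (2 ^ e <= m).
Proof.
elim: e m => [|e IH] m; case: (posnP m) => [->|m0].
- by [].
- by rewrite bits_rec.
- by rewrite [RHS]leqNgt expn_gt0.
rewrite bits_rec //= ltnS IH expnS mul2n; move: (2 ^ e) => x.
by apply/idP/idP; lia.
Qed.

Lemma bits_exp m : bits m = [seq odd (m %/ 2 ^ e) | e <- iota 0 (size (bits m))].
Proof.
have [k] := ubnP m; elim: k m => // k IH m lt.
case: (posnP m) => [->//|m0]; rewrite bits_rec //= divn1; congr (_ :: _).
rewrite {1}IH; last by lia.
rewrite -[1]/(1 + 0) iotaDl -map_comp; apply: eq_map => e /=.
by rewrite add1n expnS -divn2 divnMA.
Qed.

Lemma pnat2_odd_divisors p :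
  2.-nat p = (0 < p) && (\sum_(d < p.+1) [&& 1 < d, odd d & p %% d == 0] == 0).
Proof.
have [->//|p0] := posnP p; apply/idP/idP => [pow2|].
  rewrite sum_nat_eq0; apply/forallP => d; apply/implyP => _; rewrite eqb0.
  apply/negP => /and3P [d1 d_odd d_dvd]; have /p_natP [[|e] ed] := pnat_dvd d_dvd pow2.
    by rewrite ed in d1.
  by rewrite ed oddX in d_odd.
rewrite sum_nat_eq0 => /forallP no_odd; apply/pnatP => // q q_prime q_dvd.
case: (even_prime q_prime) => [-> //|q_odd].
have qp : q < p.+1 by rewrite ltnS dvdn_leq.
by have := no_odd (Ordinal qp); rewrite /= prime_gt1 // q_odd -/(dvdn q p) q_dvd.
Qed.

Lemma pnat2_iota m :
  [seq p <- iota 0 m.+1 | 2.-nat p] = [seq 2 ^ e | e <- iota 0 (size (bits m))].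
Proof.
apply: (irr_sorted_eq ltn_trans ltnn).
- by apply: (sorted_filter ltn_trans); apply: iota_ltn_sorted.
- rewrite sorted_map; apply: sub_sorted (iota_ltn_sorted 0 _) => x y /= lt.
  by rewrite ltn_exp2l.
move=> p; rewrite mem_filter mem_iota add0n ltnS /=; apply/andP/mapP.
  by case=> /p_natP [e ->] le; exists e => //; rewrite mem_iota add0n size_bits.
case=> e; rewrite mem_iota add0n size_bits => le ->; split=> //.
by rewrite pnatX pnat_id.
Qed.

Lemma enc_natE m : enc_nat m =
  flatten [seq (if 2.-nat p then [:: true] ++ (if odd (m %/ p) then [:: true] else [:: false])
                else [::]) | p <- iota 0 m.+1] ++ [:: false; false].
Proof.
have bitsE : bits m = [seq odd (m %/ p) | p <- iota 0 m.+1 & 2.-nat p].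
  by rewrite pnat2_iota -map_comp -bits_exp.
rewrite /enc_nat bitsE; congr (_ ++ _); elim: (iota 0 m.+1) => //= p s IH.
by case: ifP => _ //=; rewrite IH; case: odd.
Qed.

Lemma loop_bool_pnat2 k (F : context k -> nat) : loop_nat F -> loop_bool (fun g => 2.-nat (F g)).
Proof.
move=> pF; apply: loop_bool_ext => [g|]; first by rewrite pnat2_odd_divisors.
apply: loop_bool_and; first exact: loop_bool_ltn (loop_nat_const k 0) pF.
apply: loop_bool_eq (loop_nat_const k 0).
apply: (loop_nat_sum (F1 := fun g d => [&& 1 < d, odd d & F g %% d == 0])); first exact: prog_succ.
have pd := prog_counter k.
apply: loop_bool_and; first exact: loop_bool_ltn (loop_nat_const _ 1) pd.
apply: loop_bool_and; first exact: loop_bool_odd pd.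
exact: loop_bool_eq (loop_nat_mod (prog_weaken pF) pd) (loop_nat_const _ 0).
Qed.

Lemma loop_word_enc_nat k (F : context k -> nat) : loop_nat F -> loop_word (fun g => enc_nat (F g)).
Proof.
move=> pF; apply: prog_ext => [g|g|]; [by [] | by rewrite enc_natE |].
apply: loop_word_cat; last exact: loop_word_cat (prog_emit k false) (prog_emit k false).
apply: (loop_word_for (G := fun g p => if 2.-nat p
  then [:: true] ++ (if odd (F g %/ p) then [:: true] else [:: false]) else [::])).
  exact: prog_succ.
have pp := prog_counter k.
apply: loop_word_if; [exact: loop_bool_pnat2 pp | | exact: loop_word_nil].
apply: loop_word_cat; first exact: prog_emit.
apply: loop_word_if; [| exact: prog_emit ..].
exact: loop_bool_odd (loop_nat_div (prog_weaken pF) pp).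
Qed.

(** * Spider instances *)

Definition spider_instance (a : nat -> nat) (Q B : nat) : seq bool :=
  let N := leg_start a Q in enc_instance N.+1 B.+1 (N * B.-1)./2 (spider_edges a Q).

Lemma spider_instanceP (a : nat -> nat) Q B : 2 < Q ->
  (forall q, q < Q -> 0 < a q) -> (forall q, q < Q -> a q <= B) ->
  SPIDER_COMPLETION (spider_instance a Q B) <-> packable (fun q : 'I_Q => a q) B.
Proof.
move=> Q_ge3 a_gt0 a_leB; rewrite -(spider_completion_packable a_gt0 Q_ge3 a_leB); split.
  by case=> n [k [t [E [/enc_instance_inj [<- <- <- <-] _ _ _ completion]]]].
move=> completion; exists (leg_start a Q).+1, B.+1, (leg_start a Q * B.-1)./2, (spider_edges a Q).
split=> //; [exact: wf_spider_edges | exact: is_spider_edges |].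
rewrite ltnS; apply: (packable_leq (Ordinal (ltnW (ltnW Q_ge3)))).
exact/spider_completion_packable.
Qed.

Section SpiderProgram.
Variables (a : seq bool -> nat -> nat) (Q B : seq bool -> nat).
Hypothesis loop_a : forall k (F : context k -> nat), loop_nat F ->
  loop_nat (fun g => a (input_of g) (F g)).
Hypotheses (loop_Q : forall k, @loop_nat k (fun g => Q (input_of g))) (loop_B : @loop_nat 0 B).

Lemma loop_nat_leg_start k (F : context k -> nat) :
  loop_nat F -> loop_nat (fun g => leg_start (a (input_of g)) (F g)).
Proof.
move=> pF; apply: (loop_nat_sum (F1 := fun g i => a (input_of g) i) pF).
exact: loop_a (prog_counter k).
Qed.

Definition enc_leg_edge (w : seq bool) (q s : nat) : seq bool :=
  enc_nat (if s == 0 then 0 else leg_start (a w) q + s) ++ enc_nat (leg_start (a w) q + s).+1.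

Lemma spider_instanceE w : spider_instance (a w) (Q w) (B w) =
  enc_nat (leg_start (a w) (Q w)).+1 ++ enc_nat (B w).+1 ++
  enc_nat (leg_start (a w) (Q w) * (B w).-1)./2 ++
  flatten [seq flatten [seq enc_leg_edge w q s | s <- iota 0 (a w q)] | q <- iota 0 (Q w)].
Proof.
rewrite /spider_instance /enc_instance 3!enc_nats_cons; do 3!congr (_ ++ _).
rewrite /spider_edges; elim: (iota 0 (Q w)) => //= q s IH.
rewrite map_cat flatten_cat enc_nats_cat IH; congr (_ ++ _).
rewrite /leg_edges -map_comp; elim: (iota 0 (a w q)) => //= u l IHl.
by rewrite 2!enc_nats_cons IHl /enc_leg_edge catA.
Qed.

Lemma loop_word_spider_instance : @loop_word 0 (fun w => spider_instance (a w) (Q w) (B w)).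
Proof.
have pN := loop_nat_leg_start (loop_Q 0).
apply: prog_ext => [w|w|]; [by [] | by rewrite spider_instanceE |].
apply: loop_word_cat; first exact: loop_word_enc_nat (prog_succ pN).
apply: loop_word_cat; first exact: loop_word_enc_nat (prog_succ loop_B).
apply: loop_word_cat.
  exact: loop_word_enc_nat (loop_nat_half (loop_nat_mul pN (loop_nat_pred loop_B))).
apply: (@loop_word_for 0 Q (fun w q => flatten [seq enc_leg_edge w q s | s <- iota 0 (a w q)])).
  exact: loop_Q 0.
apply: (@loop_word_for 1 (fun g => a g.1 g.2) (fun g s => enc_leg_edge g.1 g.2 s)).
  exact: loop_a (prog_counter 0).
have p_end : @loop_nat 2 (fun g => leg_start (a (input_of g)) g.1.2 + g.2).
  exact: loop_nat_add (loop_nat_leg_start (prog_weaken (prog_counter 0))) (prog_counter 1).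
apply: loop_word_cat; last exact: loop_word_enc_nat (prog_succ p_end).
apply: loop_word_enc_nat; apply: (@loop_nat_if_eq 2) p_end; first exact: prog_counter.
  exact: loop_nat_const.
exact: loop_nat_const.
Qed.

End SpiderProgram.

(** * Computable tiling problems reduce to spider completion *)

Lemma loop_nat_counted_number k (J : finType) (W count : context k -> nat)
    (v : J -> context k -> nat) :
  loop_nat W -> loop_nat count -> (forall j, loop_nat (v j)) ->
  loop_nat (fun g => counted_number (W g) (count g) (fun j => v j g)).
Proof.
move=> pW pc pv; apply: loop_nat_add; first exact: loop_nat_mul pc (loop_nat_exp _ pW).
apply: (@loop_nat_bigsum k _ (index_enum J) (fun j g => v j g * W g ^ enum_rank j)) => j.
exact: loop_nat_mul (pv j) (loop_nat_exp _ pW).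
Qed.

Section MatchingWeights.
Variables (k : nat) (class : finType) (max_id : context k -> nat) (max_quota : nat).
Hypothesis loop_max_id : loop_nat max_id.

Lemma loop_nat_matching_base : loop_nat (fun g => matching_base class (max_id g) max_quota).
Proof.
have p_digit : loop_nat (fun g => (max_id g + max_quota).+1).
  exact: prog_succ (loop_nat_add loop_max_id (loop_nat_const k max_quota)).
exact: prog_succ (loop_nat_mul (loop_nat_const k _) p_digit).
Qed.

Lemma loop_nat_leader_weight (expected : context k -> class -> option nat) quota :
  (forall c, loop_bool (fun g => isSome (expected g c))) ->
  (forall c, loop_nat (fun g => odflt 0 (expected g c))) ->
  loop_nat (fun g => leader_weight (max_id g) max_quota (expected g) quota).
Proof.
move=> p_some p_id; apply: (@loop_nat_counted_number k _ _ _
  (fun j g => leader_digit (max_id g) max_quota (expected g) quota j)) loop_nat_matching_base _ _.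
  apply: loop_nat_sub; first exact: loop_nat_const.
  exact: (@loop_nat_bigsum k _ (index_enum class) (fun c g => nat_of_bool (expected g c))).
case=> [[c []]|] /=; [| exact: loop_bool_neg | exact: loop_nat_const].
exact: loop_nat_sub.
Qed.

Lemma loop_nat_elem_weight (c : class) (id : context k -> nat) charge : loop_nat id ->
  loop_nat (fun g => elem_weight (max_id g) max_quota c (id g) charge).
Proof.
move=> p_id; apply: (@loop_nat_counted_number k _ _ _
  (fun j g => elem_digit c (id g) charge j)) loop_nat_matching_base _ _.
  exact: loop_nat_const.
case=> [[c' []]|] /=; try exact: loop_nat_const.
by case: eqP => _; [exact: p_id | exact: loop_nat_const].
Qed.

Lemma loop_nat_bin_capacity : loop_nat (fun g => bin_capacity class (max_id g) max_quota).
Proof.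
apply: (@loop_nat_counted_number k _ _ _ (fun j g => bin_digit (max_id g) max_quota j))
  loop_nat_matching_base _ _; first exact: loop_nat_const.
by case=> [[c []]|] /=; [exact: loop_max_id | exact: loop_nat_const ..].
Qed.

End MatchingWeights.

Section TilingReduction.
Variables (dir tile colour : finType) (t0 : tile) (c0 : colour).
Variables (L : seq bool -> nat) (step : seq bool -> dir -> nat).
Variable shown : seq bool -> dir -> bool -> nat -> tile -> colour.
Hypotheses (L_gt0 : forall w, 0 < L w) (L_ge3 : forall w, 2 < L w).
Hypothesis loop_L : forall k, @loop_nat k (fun g => L (input_of g)).
Hypothesis loop_step : forall k d, @loop_nat k (fun g => step (input_of g) d).
Hypothesis loop_shown : forall k (F : context k -> nat) d s t, loop_nat F ->
  loop_fin (fun g => shown (input_of g) d s (F g) t).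

Local Notation kind := (leader_kind dir tile colour + elem_kind dir tile colour)%type.

Let weight (w : seq bool) : nat -> kind -> nat := kind_weight (L w) (step w) (shown w) t0 c0.

Lemma loop_nat_token_id k (F : context k -> nat) (x : context k -> token dir colour) :
  loop_nat F -> loop_fin x -> loop_nat (fun g => token_id (F g) (x g)).
Proof.
move=> pF px; apply: loop_nat_add; first exact: loop_nat_mul pF (loop_nat_const k _).
exact: (px (fun x => enum_rank x)).
Qed.

Lemma loop_fin_inr k (X X' : finType) (x : context k -> X) :
  loop_fin x -> loop_fin (fun g => inr (x g) : X' + X).
Proof. by move=> px h; apply: (px (fun x => h (inr x))). Qed.

Lemma loop_nat_edge_end k (F : context k -> nat) d s : loop_nat F ->
  loop_nat (fun g => edge_end (L (input_of g)) (step (input_of g)) d s (F g)).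
Proof.
by move=> pF; case: s => //; apply: loop_nat_mod (loop_L k); apply: loop_nat_add pF (loop_step k d).
Qed.

Lemma loop_nat_max_token_id k : @loop_nat k (fun g => max_token_id (L (input_of g)) dir colour).
Proof. exact: loop_nat_mul (loop_L k) (loop_nat_const k _). Qed.

Lemma loop_nat_kind_expects k (F : context k -> nat) l c : loop_nat F ->
  loop_nat (fun g => odflt 0 (kind_expects (L (input_of g)) (step (input_of g)) (shown (input_of g))
    (F g) l c)).
Proof.
move=> pF; case: l c => [t|[d c]] [[d' s]|] /=.
- exact: loop_nat_token_id pF (loop_fin_inr (loop_shown d' s t pF)).
- exact: loop_nat_token_id pF (@loop_fin_const _ _ _).
- case: eqP => _ /=; last exact: loop_nat_const.
  exact: loop_nat_token_id (loop_nat_edge_end d s pF) (@loop_fin_const _ _ _).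
- exact: loop_nat_token_id pF (@loop_fin_const _ _ _).
Qed.

Lemma loop_bool_kind_expects k (F : context k -> nat) l c :
  loop_bool (fun g => isSome (kind_expects (L (input_of g)) (step (input_of g)) (shown (input_of g))
    (F g) l c)).
Proof.
case: l c => [t|[d c]] [[d' s]|] /=; try exact: loop_bool_const.
by case: eqP => _; apply: loop_bool_const.
Qed.

Lemma loop_nat_kind_id k (F : context k -> nat) e : loop_nat F ->
  loop_nat (fun g => kind_id (shown (input_of g)) (F g) e).
Proof.
move=> pF; apply: (loop_nat_token_id pF).
case: e => [[t [[d s]|]]|[[d c] [s|]]]; try exact: loop_fin_const.
exact: loop_fin_inr (loop_shown d s t pF).
Qed.

Lemma loop_nat_weight k (F : context k -> nat) g0 : loop_nat F ->
  loop_nat (fun g => weight (input_of g) (F g) g0).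
Proof.
move=> pF; have p_max := loop_nat_max_token_id k; case: g0 => [l|e].
  pose expected g := kind_expects (L (input_of g)) (step (input_of g)) (shown (input_of g)) (F g) l.
  apply: (@loop_nat_leader_weight _ _ _ _ p_max expected) => c.
    exact: loop_bool_kind_expects.
  exact: loop_nat_kind_expects.
exact: (@loop_nat_elem_weight _ _ _ _ p_max _ _ (kind_charge t0 c0 e) (loop_nat_kind_id e pF)).
Qed.

Definition num_kinds : nat := #|{: kind}|.

Lemma num_kinds_gt0 : 0 < num_kinds.
Proof. by apply/card_gt0P; exists (inl (inl t0)). Qed.

Definition num_legs (w : seq bool) : nat := L w * num_kinds.

Definition nth_kind (q : nat) : kind := nth (inl (inl t0)) (enum {: kind}) q.

Definition leg_length (w : seq bool) (q : nat) : nat :=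
  weight w (q %/ num_kinds) (nth_kind (q %% num_kinds)).

Lemma loop_nat_leg_length k (F : context k -> nat) : loop_nat F ->
  loop_nat (fun g => leg_length (input_of g) (F g)).
Proof.
move=> pF; have p_cell := loop_nat_div pF (loop_nat_const k num_kinds).
have p_kind := loop_nat_mod pF (loop_nat_const k num_kinds).
exact: (loop_nat_nth _ _ (fun g0 => loop_nat_weight g0 p_cell) p_kind).
Qed.

Definition leg_item w (q : 'I_(num_legs w)) : 'I_(L w) * kind :=
  (insubd (Ordinal (L_gt0 w)) (q %/ num_kinds), nth_kind (q %% num_kinds)).

Lemma leg_item_cell w (q : 'I_(num_legs w)) : (leg_item q).1 = q %/ num_kinds :> nat.
Proof. by rewrite -[LHS]/(val _) val_insubd ltn_divLR ?num_kinds_gt0 // ltn_ord. Qed.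

Lemma leg_item_bij w : bijective (@leg_item w).
Proof.
apply: inj_card_bij => [q q' e|]; last by rewrite card_prod !card_ord.
apply: val_inj; rewrite /= (divn_eq q num_kinds) (divn_eq q' num_kinds).
have := congr1 (fun x => nat_of_ord x.1) e; rewrite !leg_item_cell => ->; congr (_ + _).
have /eqP := congr1 snd e; rewrite nth_uniq ?enum_uniq -?cardE ?ltn_mod ?num_kinds_gt0 //.
by move/eqP.
Qed.

Lemma leg_lengthE w (q : 'I_(num_legs w)) : leg_length w q = weight w (leg_item q).1 (leg_item q).2.
Proof. by rewrite leg_item_cell. Qed.

Definition tiling_reduction (w : seq bool) : seq bool :=
  spider_instance (leg_length w) (num_legs w) (tiling_capacity (L w) dir colour).

Lemma tiling_reduction_poly_time : poly_time_computable tiling_reduction.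
Proof.
apply: loop_prog_poly_time; apply: loop_word_spider_instance.
- exact: loop_nat_leg_length.
- by move=> k; apply: loop_nat_mul (loop_L k) (loop_nat_const k _).
- exact: loop_nat_bin_capacity (loop_nat_max_token_id 0).
Qed.

Theorem tiling_reductionP w :
  SPIDER_COMPLETION (tiling_reduction w) <->
  exists tau, cyclic_tiling (step w) (shown w) (L_gt0 w) tau.
Proof.
rewrite spider_instanceP.
- pose item_length (x : 'I_(L w) * kind) := weight w x.1 x.2.
  rewrite (packable_reindex (a := item_length) _ (@leg_item_bij w) (@leg_lengthE w)).
  exact: (packable_tiling (step w) (shown w) (L_gt0 w) t0 c0).
- exact: leq_trans (L_ge3 w) (leq_pmulr _ num_kinds_gt0).
- by move=> q lt; apply: kind_weight_gt0.
- by move=> q lt; rewrite (leg_lengthE (Ordinal lt)); apply: kind_weight_leq.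
Qed.

End TilingReduction.

(** * The reduction from verifiers *)

Section VerifierReduction.
Variables (M : TM) (cert_coef cert_deg time_coef time_deg : nat).

Definition cert_size (n : nat) : nat := cert_coef * n ^ cert_deg + cert_coef.
Definition pair_size (n : nat) : nat := 2 * n + 2 + cert_size n.
Definition horizon (n : nat) : nat := time_coef * pair_size n ^ time_deg + time_coef + pair_size n.

Local Notation T w := (horizon (size w)).
Local Notation Y w := (cert_size (size w)).

Lemma loop_nat_cert_size k : @loop_nat k (fun g => Y (input_of g)).
Proof.
have p_coef := loop_nat_const k cert_coef.
exact: loop_nat_add (loop_nat_mul p_coef (loop_nat_exp _ (loop_nat_input_size k))) p_coef.
Qed.

Lemma loop_nat_prefix_size k : @loop_nat k (fun g => prefix_size (input_of g)).
Proof.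
have p2 := loop_nat_const k 2.
exact: loop_nat_add (loop_nat_mul p2 (loop_nat_input_size k)) p2.
Qed.

Lemma loop_nat_horizon k : @loop_nat k (fun g => T (input_of g)).
Proof.
have p_pair : @loop_nat k (fun g => pair_size (size (input_of g))).
  exact: loop_nat_add (loop_nat_prefix_size k) (loop_nat_cert_size k).
have p_coef := loop_nat_const k time_coef.
exact: loop_nat_add (loop_nat_add (loop_nat_mul p_coef (loop_nat_exp _ p_pair)) p_coef) p_pair.
Qed.

Lemma loop_nat_width k : @loop_nat k (fun g => width (T (input_of g))).
Proof.
exact: loop_nat_add (loop_nat_mul (loop_nat_const k 2) (loop_nat_horizon k)) (loop_nat_const k 3).
Qed.

Lemma loop_nat_area k : @loop_nat k (fun g => area (T (input_of g))).
Proof. exact: loop_nat_mul (prog_succ (loop_nat_horizon k)) (loop_nat_width k). Qed.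

Lemma loop_nat_direction_step k d : @loop_nat k (fun g => direction_step (T (input_of g)) d).
Proof. by case: d; [exact: loop_nat_width | exact: loop_nat_const]. Qed.

Lemma loop_bool_prefix_bit k (F : context k -> nat) : loop_nat F ->
  loop_bool (fun g => prefix_bit (input_of g) (F g)).
Proof.
move=> pF; apply: (@loop_bool_ext _ (fun g => (F g < 2 * size (input_of g)) &&
    (~~ odd (F g) || nth false (rev (input_of g)) (size (input_of g) - (F g)./2.+1)))).
  move=> g; rewrite /prefix_bit; case: ltnP => //= lt; congr (_ || _).
  by rewrite nth_rev; [congr nth; lia | lia].
have p_size := loop_nat_input_size k.
apply: loop_bool_and; first exact: loop_bool_ltn pF (loop_nat_mul (loop_nat_const k 2) p_size).
apply: loop_bool_or; first exact: loop_bool_neg (loop_bool_odd pF).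
exact: prog_input_bit (loop_nat_sub p_size (prog_succ (loop_nat_half pF))).
Qed.

Lemma loop_nat_origin k : @loop_nat k (fun g => origin (T (input_of g))).
Proof. exact: prog_succ (loop_nat_horizon k). Qed.

Lemma loop_bool_initial_symbol k (F : context k -> nat) a b : loop_nat F ->
  loop_bool (fun g => initial_symbol (input_of g) (T (input_of g)) (Y (input_of g)) (F g) a b).
Proof.
move=> pF; have p_origin := loop_nat_origin k.
have p_prefix := loop_nat_add p_origin (loop_nat_prefix_size k).
apply: loop_bool_if; [exact: loop_bool_ltn pF p_origin | exact: loop_bool_const |].
apply: loop_bool_if; [exact: loop_bool_ltn pF p_prefix | |].
  have := loop_bool_if (loop_bool_prefix_bit (loop_nat_sub pF p_origin))
    (loop_bool_const k (a == Some true)) (loop_bool_const k (a == Some false)).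
  by apply: loop_bool_ext => g; case: prefix_bit.
apply: loop_bool_if; [| exact: loop_bool_const ..].
exact: loop_bool_ltn pF (loop_nat_add p_prefix (loop_nat_cert_size k)).
Qed.

Lemma loop_bool_initial_cell k (F : context k -> nat) (m r : cell M) : loop_nat F ->
  loop_bool (fun g => initial_cell (input_of g) (T (input_of g)) (Y (input_of g)) (F g) m r).
Proof.
move=> pF; apply: loop_bool_and; last exact: loop_bool_initial_symbol.
apply: (loop_bool_fin (fun q => m.2 == q)); apply: loop_fin_if; [| exact: loop_fin_const ..].
exact: loop_bool_eq pF (loop_nat_origin k).
Qed.

Lemma loop_bool_legal_tile k (R F : context k -> nat) (t : tile M) : loop_nat R -> loop_nat F ->
  loop_bool (fun g => legal_tile (input_of g) (T (input_of g)) (Y (input_of g)) (R g) (F g) t).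
Proof.
move=> pR pF; have p0 := loop_nat_const k 0.
apply: loop_bool_and.
  exact: loop_bool_imply (loop_bool_eq pR p0) (loop_bool_initial_cell _ _ pF).
apply: loop_bool_and.
  exact: loop_bool_imply (loop_bool_eq pR (loop_nat_horizon k)) (loop_bool_const k _).
apply: loop_bool_and; first exact: loop_bool_imply (loop_bool_eq pF p0) (loop_bool_const k _).
apply: loop_bool_imply (loop_bool_const k _).
exact: loop_bool_eq pF (loop_nat_pred (loop_nat_width k)).
Qed.

Lemma loop_fin_shown k (F : context k -> nat) d s (t : tile M) : loop_nat F ->
  loop_fin (fun g => shown (input_of g) (T (input_of g)) (Y (input_of g)) d s (F g) t).
Proof.
move=> pF; have p_row := loop_nat_div pF (loop_nat_width k).
have p_col := loop_nat_mod pF (loop_nat_width k); have p0 := loop_nat_const k 0.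
have p_const := @loop_fin_const k (colour M).
case: d s => -[] /=.
- exact: loop_fin_if (loop_bool_eq p_row p0) (p_const _) (p_const _).
- exact: loop_fin_if (loop_bool_eq p_row (loop_nat_horizon k)) (p_const _) (p_const _).
- exact: loop_fin_if (loop_bool_eq p_col p0) (p_const _) (p_const _).
- apply: loop_fin_if (p_const _); first exact: loop_bool_legal_tile.
  have p_last := loop_nat_pred (loop_nat_width k).
  exact: loop_fin_if (loop_bool_eq p_col p_last) (p_const _) (p_const _).
Qed.

Lemma area_ge3 t : 2 < area t.
Proof. by rewrite /area /width mulSn; lia. Qed.

Definition blank_tile : tile M := (blank M, blank M, blank M).

Definition verifier_reduction : seq bool -> seq bool :=
  tiling_reduction blank_tile (border_colour M) (fun w => area (T w))
    (fun w => direction_step (T w)) (fun w => shown w (T w) (Y w)).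

Lemma verifier_reduction_poly_time : poly_time_computable verifier_reduction.
Proof.
apply: tiling_reduction_poly_time => k; first exact: loop_nat_area.
  exact: loop_nat_direction_step.
by move=> F d s t; apply: loop_fin_shown.
Qed.

Lemma halted_run t t' z : t <= t' -> halted (run M t z) -> run M t' z = run M t z.
Proof.
move=> /subnK <- halts; rewrite /run iterD -/(run M t z); elim: (t' - t) => //= m ->.
by move: halts; rewrite /halted /step => ->.
Qed.

Lemma time_bound_horizon w y : size y <= Y w ->
  time_coef * size (pair_enc w y) ^ time_deg + time_coef <= T w.
Proof.
move=> sy; have le : size (pair_enc w y) <= pair_size (size w).
  by rewrite size_pair_enc /pair_size leq_add2l.
apply: leq_trans (leq_addr _ _); rewrite leq_add2r leq_mul2l.
by case: (time_deg) => [|d]; rewrite ?expn0 ?leqnn ?orbT // leq_exp2r // le orbT.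
Qed.

Theorem verifier_reductionP (b : seq bool -> bool) w :
  (forall z, let t := time_coef * size z ^ time_deg + time_coef in
     halted (run M t z) /\ output (run M t z) = [:: b z]) ->
  (exists2 y, size y <= Y w & b (pair_enc w y)) <-> SPIDER_COMPLETION (verifier_reduction w).
Proof.
move=> M_ok; have fit : prefix_size w + Y w <= T w by apply: leq_addl.
have b_ok y : size y <= Y w -> output (run M (T w) (pair_enc w y)) = [:: b (pair_enc w y)].
  move=> sy; have [halts <-] := M_ok (pair_enc w y).
  by congr output; apply: halted_run halts; apply: time_bound_horizon.
rewrite (certificate_tableau fit b_ok) tableau_cyclic_tiling.
have reduces := tiling_reductionP blank_tile (border_colour M) (fun w => direction_step (T w))
  (fun w => shown w (T w) (Y w)) (fun w => area_gt0 (T w)) (fun w => area_ge3 (T w)).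
by rewrite /verifier_reduction reduces.
Qed.

End VerifierReduction.

Theorem theorem4 : NP_hard SPIDER_COMPLETION.
Proof.
move=> L' [V [[b [[M [time_coef [time_deg M_ok]]] Vb]] [cert_coef [cert_deg L'V]]]].
exists (verifier_reduction M cert_coef cert_deg time_coef time_deg).
split=> [|w]; first exact: verifier_reduction_poly_time.
rewrite -(verifier_reductionP _ _ _ M_ok) L'V.
by split=> [[y [sy /Vb]]|[y sy /Vb]]; exists y.
Qed.
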